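(* For each $n$ (with $p=p(n)$), let $(x_i,y_i)\in\mathbb{R}^{p+1}\times\mathbb{R}$, $i\in[n]$, be i.i.d. and satisfy the feature and response assumptions (F1)-(F3) and (Y1)-(Y4) given in the context. Let $\hat\beta_k$, $k\in\{0\}\cup[K]$, be the gradient descent iterates with step sizes $\delta_0,\dots,\delta_{K-1}$ and initialization $\hat\beta_0$. Assume there are constants $\Delta,B_0,\zeta_L,\zeta_U$ (independent of $n,p$) such that (1) $\sum_{k=1}^K\delta_{k-1}\le\Delta$, (2) $\|\hat\beta_0\|_2\le B_0$, and (3) $0<\zeta_L\le p/n\le\zeta_U<\infty$. Let $K=o\big(n(\log n)^{-3/2}\big)$. Assume further that the distribution of the noise $\varepsilon_i$ is continuous with density bounded by a constant $\kappa_{\mathrm{pdf}}$. Let $\hat\alpha_k(q)$ denote the $q$-quantile of $\{y_i-x_i^\top\hat\beta_{k,-i}:i\in[n]\}$. Then, for any quantile levels $0\le q_1\le q_2\le1$, letting $\mathcal{I}_k=[\hat\alpha_k(q_1),\hat\alpha_k(q_2)]$, as $n,p\to\infty$, $$\max_{k\in[K]}\Big|\mathbb{P}_{(x_0,y_0)}\big(y_0-x_0^\top\hat\beta_k\in\mathcal{I}_k\mid X,y\big)-(q_2-q_1)\Big|\longrightarrow0\quad\text{almost surely}.$$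
   Context: A distribution $\mu$ satisfies the $T_2$-inequality with constant $\sigma(\mu)\ge0$ if $W_2(\mu,\nu)\le\sqrt{2\sigma^2(\mu)D_{\mathrm{KL}}(\nu\|\mu)}$ for every distribution $\nu$, where $W_2$ is the 2-Wasserstein distance and $D_{\mathrm{KL}}$ the Kullback-Leibler divergence. Feature assumptions: (F1) $x_i^\top=((\Sigma^{1/2}z_i)^\top,1)$, where $z_i\in\mathbb{R}^p$ has i.i.d. entries drawn from a distribution $\mu_z$ and $\Sigma\in\mathbb{R}^{p\times p}$ is positive semidefinite. (F2) $\mu_z$ has mean $0$, variance $1$ and satisfies the $T_2$-inequality with constant $\sigma_z$. (F3) $\|\Sigma\|_{\mathrm{op}}\le\sigma_\Sigma$. Response assumptions: (Y1) $y_i=f(x_i)+\varepsilon_i$, where $\varepsilon_i$ is independent of $x_i$ and drawn from a distribution $\mu_\varepsilon$. (Y2) $\mu_\varepsilon$ has mean $0$ and satisfies the $T_2$-inequality with constant $\sigma_\varepsilon$. (Y3) $f:\mathbb{R}^{p+1}\to\mathbb{R}$ is $L_f$-Lipschitz continuous, where (without loss of generality) $L_f\le1$. (Y4) $\mathbb{E}[y_i^8]\le m_8$, $\mathbb{E}[y_i^4]\le m_4$, $\mathbb{E}[y_i^2]\le m_2$. The constants $\sigma_z,\sigma_\Sigma,\sigma_\varepsilon,m_2,m_4,m_8,\kappa_{\mathrm{pdf}}$ do not change with $n,p$. $[K]=\{1,\dots,K\}$; $K$ and the step sizes may depend on $n$. $X\in\mathbb{R}^{n\times(p+1)}$ has rows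 $x_i^\top$ and $y=(y_i)_{i\le n}$. Gradient descent with positive step sizes from a fixed (non-random) initial vector $\hat\beta_0\in\mathbb{R}^{p+1}$: $\hat\beta_k=\hat\beta_{k-1}+\frac{\delta_{k-1}}{n}X^\top(y-X\hat\beta_{k-1})$, $k\in[K]$. The leave-one-out iterate is the same procedure run without the $i$-th sample: $\hat\beta_{0,-i}=\hat\beta_0$ and $\hat\beta_{k,-i}=\hat\beta_{k-1,-i}+\frac{\delta_{k-1}}{n}X_{-i}^\top(y_{-i}-X_{-i}\hat\beta_{k-1,-i})$, where $X_{-i},y_{-i}$ are $X,y$ with the $i$-th row/entry removed. $(x_0,y_0)$ is a test point independent of the training data with the same distribution as $(x_1,y_1)$. The $q$-quantile of a collection of $n$ real numbers is the $q$-quantile of the empirical distribution putting mass $1/n$ on each, i.e. the $\lceil nq\rceil$-th smallest value (the smallest value if $q=0$). *)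

(* Defs.v *)
From HB Require Import structures.
From mathcomp Require Export all_boot all_order all_algebra.
From mathcomp Require Export all_classical all_reals all_analysis.

Set Implicit Arguments.
Unset Strict Implicit.
Unset Printing Implicit Defensive.

Export Order.TTheory GRing.Theory Num.Theory.
Export numFieldNormedType.Exports.

Global Open Scope classical_set_scope.
Global Open Scope ring_scope.

Section LinearAlgebra.
Context {R : realType}.

(* The norm that the library puts on matrices is the max norm, hence a separate
   Euclidean norm. *)
Definition l2norm (d : nat) (v : 'cV[R]_d) : R :=
  Num.sqrt (\sum_(i < d) v i 0 ^+ 2).

Definition opnorm (m d : nat) (A : 'M[R]_(m, d)) : R :=
  sup [set l2norm (A *m v) | v in [set v : 'cV[R]_d | l2norm v <= 1]].

Definition psd (d : nat) (A : 'M[R]_d) : Prop :=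
  A^T = A /\ forall v : 'cV[R]_d, 0 <= (v^T *m A *m v) 0 0.

(* [S] is the positive semidefinite square root of [A]; it is unique. *)
Definition psd_sqrt (d : nat) (A S : 'M[R]_d) : Prop :=
  psd S /\ S *m S = A.

Definition lipschitz_l2 (d : nat) (L : R) (f : 'cV[R]_d -> R) : Prop :=
  forall u v, `|f u - f v| <= L * l2norm (u - v).

End LinearAlgebra.

Section Transport.
Context {R : realType}.
Local Open Scope ereal_scope.
Implicit Types mu nu : probability R R.

Definition coupling mu nu : set (probability (R * R)%type R) :=
  [set pi | (forall A, measurable A -> pi (A `*` setT) = mu A) /\
            (forall B, measurable B -> pi (setT `*` B) = nu B)].

Definition W2 mu nu : \bar R :=
  (ereal_inf [set \int[pi]_w ((w.1 - w.2) ^+ 2)%R%:E | pi in coupling mu nu])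
    `^ (2^-1)%R.

(* D_KL(nu || mu) *)
Definition KL nu mu : \bar R :=
  if `[< nu `<< mu >]
  then \int[nu]_x lne (Radon_Nikodym (charge_of_finite_measure nu) mu x)
  else +oo.

Definition T2_inequality mu (sigma : R) : Prop :=
  (0 <= sigma)%R /\
  forall nu, W2 mu nu <= ((2 * sigma ^+ 2)%R%:E * KL nu mu) `^ (2^-1)%R.

Definition has_density_le mu (kappa : R) : Prop :=
  exists g : R -> R,
    [/\ measurable_fun setT g,
        forall t, (0 <= g t <= kappa)%R
      & forall A, measurable A -> mu A = \int[lebesgue_measure]_(t in A) (g t)%:E].

End Transport.

Section Probability.
Context {R : realType} {d : measure_display} {Omega : measurableType d}.
Variable P : probability Omega R.

Definition borel (T : topologicalType) : set (set T) := <<s @open T >>.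

Definition random_element (T : topologicalType) (X : Omega -> T) : Prop :=
  forall B, borel B -> measurable (X @^-1` B).

Definition identically_distributed (T : topologicalType) (X Y : Omega -> T) :
    Prop :=
  forall B, borel B -> P (X @^-1` B) = P (Y @^-1` B).

Definition independent2 (T U : topologicalType) (X : Omega -> T)
    (Y : Omega -> U) : Prop :=
  forall A B, borel A -> borel B ->
    P (X @^-1` A `&` Y @^-1` B) = (P (X @^-1` A) * P (Y @^-1` B))%E.

Definition mutually_independent (I : finType) (T : topologicalType)
    (X : I -> Omega -> T) : Prop :=
  forall (J : {set I}) (A : I -> set T), (forall i, borel (A i)) ->
    P (\bigcap_(i in [set j | j \in J]) X i @^-1` A i) =
    (\prod_(i in J) P (X i @^-1` A i))%E.

Definition iid (I : finType) (T : topologicalType) (X : I -> Omega -> T) :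
    Prop :=
  mutually_independent X /\ forall i j, identically_distributed (X i) (X j).

Definition has_law (X : {RV P >-> R}) (mu : probability R R) : Prop :=
  forall A, measurable A -> distribution P X A = mu A.

Definition sigma_of (T : topologicalType) (X : Omega -> T) : set (set Omega) :=
  preimage_set_system setT X (@borel T).

(* [g] is a version of the conditional probability P(E | X). *)
Definition cond_prob (T : topologicalType) (X : Omega -> T) (E : set Omega)
    (g : Omega -> R) : Prop :=
  [/\ forall B, borel B -> sigma_of X (g @^-1` B),
      P.-integrable setT (EFin \o g)
    & forall A, sigma_of X A -> (\int[P]_(w in A) (g w)%:E)%E = P (A `&` E)].

End Probability.

Section GradientDescent.
Context {R : realType}.

(* The number [m] of rows and the normalisation [N] are separate, because the
   leave-one-out iterates keep the factor [1 / N] while using [N.-1] rows. *)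
Fixpoint gd (N m d : nat) (delta : nat -> R) (X : 'M[R]_(m, d)) (y : 'cV[R]_m)
    (b0 : 'cV[R]_d) (k : nat) : 'cV[R]_d :=
  if k is k'.+1 then
    let b := gd N delta X y b0 k' in
    b + (delta k' / N%:R) *: (X^T *m (y - X *m b))
  else b0.

Definition gd_full (n d : nat) (delta : nat -> R) (X : 'M[R]_(n, d))
    (y : 'cV[R]_n) (b0 : 'cV[R]_d) (k : nat) : 'cV[R]_d :=
  gd n delta X y b0 k.

Definition gd_loo (n d : nat) (delta : nat -> R) (X : 'M[R]_(n, d))
    (y : 'cV[R]_n) (b0 : 'cV[R]_d) (i : 'I_n) (k : nat) : 'cV[R]_d :=
  gd n delta (row' i X) (row' i y) b0 k.

Definition residual (d : nat) (x : 'cV[R]_d) (y : R) (b : 'cV[R]_d) : R :=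
  y - (x^T *m b) 0 0.

Definition loo_residuals (n d : nat) (delta : nat -> R) (X : 'M[R]_(n, d))
    (y : 'cV[R]_n) (b0 : 'cV[R]_d) (k : nat) : seq R :=
  [seq residual (row i X)^T (y i 0) (gd_loo delta X y b0 i k) | i : 'I_n].

(* The [ceil (n q)]-th smallest of [n] values, counting from 1; the truncated
   predecessor makes it the smallest one for [q = 0]. *)
Definition quantile (s : seq R) (q : R) : R :=
  nth 0 (sort <=%R s) (`|Num.ceil ((size s)%:R * q)|%N).-1.

Definition design (n d : nat) (Omega : Type) (x : 'I_n -> Omega -> 'cV[R]_d)
    (w : Omega) : 'M[R]_(n, d) :=
  \matrix_(i < n) (x i w)^T.

Definition response (n : nat) (Omega : Type) (y : 'I_n -> Omega -> R)
    (w : Omega) : 'cV[R]_n :=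
  \col_(i < n) y i w.

End GradientDescent.

(* Main.v *)
(** By the bounded density of the noise, the conditional coverage is
    [F (alpha q2) - F (alpha q1)], where [F] is the distribution function of the
    test residual given the training data, so it suffices that the empirical
    distribution function of the leave-one-out residuals is uniformly close to
    [F].  Cut the sample into blocks of size about [n^(1/8)].  Leaving out a
    whole block instead of one observation moves the iterates by
    [O(block size / n)] in eighth moment, on the event that the design has
    operator norm [O(sqrt n)] (discrete Gronwall), and given the observations
    outside a block the residuals within it are iid, so that Hoeffding's
    inequality applies block by block on a grid of thresholds.  All failure
    probabilities are [O(n^(-3/2))], even after a union over [k <= n], and
    Borel-Cantelli concludes.  The T2 inequality enters through the sub-Gaussian
    Laplace transform of [mu_z]: transporting [mu_z] to its exponential tilts
    bounds the variation of their means by the divergence, which is the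
    log-Laplace transform up to a linear term. *)

From HB Require Import structures.
Require Import Defs.
From mathcomp Require Import measurable_realfun.
From mathcomp Require Import ring lra zify.

Set Implicit Arguments.
Unset Strict Implicit.
Unset Printing Implicit Defensive.

(** * Laplace transform bound from the T2 inequality *)

(** A leave-one-out residual involves an iterate that depends on all the other observations, so the
    indicators in the empirical distribution function are dependent and Hoeffding's inequality
    cannot be applied to all of them at once. Removing a block makes its residuals conditionally iid
    but displaces the iterate, and the two effects compete. The displacement caused by [b]
    observations has eighth moment of order [(b / n)^4]; a union over about [n^2] pairs of a step
    and an index leaves [b^4 / n^2], which is [n^(-3/2)] when [b] is about [n^(1/8)]. Hoeffding then
    gives an exponential in [- b], still smaller than any power of [n]. Order eight is the highest
    moment assumed for the response, and Markov's inequality at that order absorbs the union.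

    The moment bounds hold on a good design, yet the truncation to it must not depend on the
    observation that is being integrated out. Hence the good event is defined for every set [S] of
    observations, is determined by the rows in [S], and shrinks as [S] grows. *)

Section Tilting.
Context {R : realType}.

Lemma integral_cst_probability d (T : measurableType d) (P : probability T R) (c : R) :
  (\int[P]_x c%:E = c%:E)%E.
Proof.
apply: (etrans (integral_cst P measurableT c%:E)).
by apply: (etrans (congr1 (mule c%:E) (probability_setT P))); rewrite mule1.
Qed.

Lemma bounded_integrable d (T : measurableType d) (P : probability T R)
    (f : T -> R) (M : R) :
  measurable_fun setT f -> (forall x, `|f x| <= M) ->
  P.-integrable setT (EFin \o f).
Proof.
move=> mf fM; apply: (le_integrable measurableT _ _
  (finite_measure_integrable_cst P M measurableT)).
- exact/measurable_EFinP.
- move=> x _ /=; rewrite lee_fin (le_trans (fM x))// ler_norm//.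
Qed.

Lemma measurable_lne d (T : measurableType d) (h : T -> \bar R) :
  measurable_fun setT h -> measurable_fun setT (fun x => lne (h x)).
Proof.
move=> mh.
pose a x := if fine (h x) <= 0 then -oo%E else (ln (fine (h x)))%:E : \bar R.
have mf : measurable_fun setT (fun x => fine (h x)).
  by apply: (measurableT_comp (@fine_measurable R setT measurableT) mh).
have ma : measurable_fun setT a.
  apply: measurable_fun_ifT => //; first exact: measurable_fun_ler.
  by apply/measurable_EFinP; exact: (measurableT_comp (@measurable_ln R)).
rewrite (_ : (fun x => lne (h x)) = fun x => if h x == +oo%E then +oo%E else a x).
  apply: measurable_fun_ifT => //.
  apply: (measurable_fun_bool true).
  rewrite (_ : _ @^-1` _ = h @^-1` [set +oo%E]).
    exact: (mh measurableT _ (emeasurable_set1 +oo%E)).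
  by apply/seteqP; split => x /=; [move/eqP | move=> ->; rewrite eqxx].
by apply/funext => x; rewrite /a; case: (h x) => [r||] //=; rewrite lexx.
Qed.

Lemma density_probability d (T : measurableType d) (P : probability T R)
    (rho : T -> R) :
  measurable_fun setT rho -> (forall x, 0 <= rho x) ->
  (\int[P]_x (rho x)%:E = 1)%E ->
  exists nu : probability T R,
    forall A, measurable A -> nu A = (\int[P]_(x in A) (rho x)%:E)%E.
Proof.
move=> mrho rho0 rho1.
pose m (A : set T) := (\int[P]_(x in A) (rho x)%:E)%E.
have m0 : m set0 = 0%E by rewrite /m integral_set0.
have mge0 A : (0 <= m A)%E by apply: integral_ge0 => x _; rewrite lee_fin.
have msa : semi_sigma_additive m.
  move=> /= F mF tF mUF; rewrite /m; apply: cvg_toP.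
    apply: ereal_nondecreasing_is_cvgn => i j ij.
    apply: lee_sum_nneg_natr => // k _ _; apply: integral_ge0 => /= x Fkx.
    by rewrite lee_fin.
  rewrite ge0_integral_bigcup//=.
  - apply/measurable_funTS/measurable_EFinP => //.
  - by move=> x _; rewrite lee_fin.
pose M := isMeasure.Build _ T R m m0 mge0 msa.
pose mm : {measure set T -> \bar R} := HB.pack m M.
have mm1 : mm setT = 1%E by [].
pose M1 := @Measure_isProbability.Build _ T R mm mm1.
pose nu : probability T R := HB.pack m M M1.
by exists nu.
Qed.

Lemma density_Radon_Nikodym d (T : measurableType d) (P nu : probability T R)
    (rho : T -> R) :
  measurable_fun setT rho ->
  P.-integrable setT (EFin \o rho) ->
  (forall A, measurable A -> nu A = (\int[P]_(x in A) (rho x)%:E)%E) ->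
  nu `<< P /\
  {ae P, forall x, Radon_Nikodym (charge_of_finite_measure nu) P x = (rho x)%:E}.
Proof.
move=> mrho irho nuE.
have dom : nu `<< P.
  move=> N PN A mA AN; rewrite nuE//.
  apply: null_set_integral => //.
    exact: measurable_funTS (measurable_int _ irho).
  exact: PN.
split => //.
have : ae_eq P setT (Radon_Nikodym (charge_of_finite_measure nu) P) (EFin \o rho).
  apply: integral_ae_eq => //.
  - exact: Radon_Nikodym_integrable.
  - exact/measurable_EFinP.
  - by move=> A _ mA; rewrite -Radon_Nikodym_integral//= -nuE.
by apply: filterS => x /(_ I).
Qed.

Lemma coupling_fst (mu nu : probability R R) (pi : probability (R * R)%type R)
    (f : R -> \bar R) : coupling mu nu pi -> measurable_fun setT f ->
  mu.-integrable setT f ->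
  pi.-integrable setT (f \o fst) /\ (\int[pi]_w f w.1 = \int[mu]_x f x)%E.
Proof.
move=> [pi1 _] mf intf.
have mf1 : measurable_fun setT (f \o (fst : R * R -> R)) by exact: measurableT_comp.
have E (A : set R) : measurable A -> A `<=` setT -> pushforward pi (fst : R * R -> R) A = mu A.
  move=> mA _; rewrite -pi1// /pushforward; congr (pi _).
  by apply/seteqP; split => [[x y]|[x y] []].
have intpi : pi.-integrable setT (f \o (fst : R * R -> R)).
  apply/integrableP; split => //.
  have := (@ge0_integral_pushforward _ _ _ _ _ _ (@measurable_fst _ _ R R)
    pi setT (abse \o f) measurableT).
  rewrite preimage_setT /= => <-//.
  + rewrite (eq_measure_integral mu)//.
    by case/integrableP : intf.
  + exact: measurableT_comp.
split => //.
rewrite -(eq_measure_integral mu (m1 := pushforward pi (fst : R * R -> R)))//.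
by rewrite (integral_pushforward (@measurable_fst _ _ R R)) ?preimage_setT.
Qed.

Lemma coupling_sym (mu nu : probability R R) (pi : probability (R * R)%type R) :
  coupling mu nu pi -> forall f : R -> \bar R, measurable_fun setT f ->
  nu.-integrable setT f ->
  pi.-integrable setT (f \o snd) /\ (\int[pi]_w f w.2 = \int[nu]_x f x)%E.
Proof.
move=> [_ pi2] f mf intf.
have mf1 : measurable_fun setT (f \o (snd : R * R -> R)) by exact: measurableT_comp.
have E (A : set R) : measurable A -> A `<=` setT -> pushforward pi (snd : R * R -> R) A = nu A.
  move=> mA _; rewrite -pi2// /pushforward; congr (pi _).
  by apply/seteqP; split => [[x y]|[x y] []].
have intpi : pi.-integrable setT (f \o (snd : R * R -> R)).
  apply/integrableP; split => //.
  have := (@ge0_integral_pushforward _ _ _ _ _ _ (@measurable_snd _ _ R R)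
    pi setT (abse \o f) measurableT).
  rewrite preimage_setT /= => <-//.
  + rewrite (eq_measure_integral nu)//.
    by case/integrableP : intf.
  + exact: measurableT_comp.
split => //.
rewrite -(eq_measure_integral nu (m1 := pushforward pi (snd : R * R -> R)))//.
by rewrite (integral_pushforward (@measurable_snd _ _ R R)) ?preimage_setT.
Qed.

(* Integrates [2 c (g y - g x) <= (x - y)^2 + c^2] at [c = nu g - mu g]. *)
Lemma transport_lower (mu nu : probability R R) (g : R -> R) (M : R) :
  measurable_fun setT g -> (forall x, `|g x| <= M) ->
  (forall x y, `|g x - g y| <= `|x - y|) ->
  ((((\int[nu]_x g x) - \int[mu]_x g x)%R ^+ 2)%:E `^ (2^-1) <= W2 mu nu)%E.
Proof.
move=> mg gM glip.
set c := (_ - _)%R.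
rewrite /W2; apply: gt0_ler_poweR => //.
- by rewrite in_itv/= lee_fin leey sqr_ge0.
- rewrite in_itv/= leey andbT; apply: le_ereal_inf_tmp => _ [pi _ <-].
  by apply: integral_ge0 => w _; rewrite lee_fin sqr_ge0.
apply: le_ereal_inf_tmp => _ [pi cpi <-].
have mgE : measurable_fun setT (EFin \o g) by exact/measurable_EFinP.
have imu : mu.-integrable setT (EFin \o g) by exact: bounded_integrable gM.
have inu : nu.-integrable setT (EFin \o g) by exact: bounded_integrable gM.
have [ip1 e1] := coupling_fst cpi mgE imu.
have [ip2 e2] := coupling_sym cpi mgE inu.
have msq : measurable_fun setT (fun w : R * R => ((w.1 - w.2) ^+ 2)%R%:E).
  by apply/measurable_EFinP; apply: measurable_funX; exact: measurable_funB.
(* A coupling of infinite cost satisfies the bound trivially; a finite cost makes the squared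
   distance integrable, which the comparison of integrals at the end requires. *)
have [//|fin] := leP +oo%E (\int[pi]_w ((w.1 - w.2) ^+ 2)%R%:E)%E.
  by apply: le_trans; rewrite leey.
have isq : pi.-integrable setT (fun w : R * R => ((w.1 - w.2) ^+ 2)%R%:E).
  apply/integrableP; split => //.
  rewrite (eq_integral (fun w : R * R => ((w.1 - w.2) ^+ 2)%R%:E))// => w _.
  by rewrite gee0_abs// lee_fin sqr_ge0.
pose h (w : R * R) : \bar R := (2 * c * (g w.2 - g w.1) - c ^+ 2)%:E.
have hE : h = (fun w => (2 * c)%:E * ((EFin \o g \o snd) w - (EFin \o g \o fst) w) - (c ^+ 2)%:E)%E.
  by [].
have i1 : pi.-integrable setT (fun w => (EFin \o g \o snd) w - (EFin \o g \o fst) w)%E.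
  exact: integrableB.
have i2 : pi.-integrable setT (fun w => (2 * c)%:E * ((EFin \o g \o snd) w - (EFin \o g \o fst) w))%E.
  exact: integrableZl.
have i3 : pi.-integrable setT (fun w : R * R => (c ^+ 2)%:E).
  exact: finite_measure_integrable_cst.
have ih : pi.-integrable setT h by rewrite hE; exact: integrableB.
have -> : (c ^+ 2)%:E = (\int[pi]_w h w)%E.
  rewrite hE integralB// integralZl// integralB//.
  have -> : (\int[pi]_x (EFin \o g \o snd) x)%E = (\int[nu]_x g x)%R%:E.
    by rewrite [LHS]e2 /Rintegral fineK// integrable_fin_num.
  have -> : (\int[pi]_x (EFin \o g \o fst) x)%E = (\int[mu]_x g x)%R%:E.
    by rewrite [LHS]e1 /Rintegral fineK// integrable_fin_num.
  rewrite (integral_cst_probability pi).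
  transitivity ((2 * c * (\int[nu]_x g x - \int[mu]_x g x)%R - c ^+ 2)%:E).
    by congr (_%:E); rewrite -/c; ring.
  by rewrite EFinB EFinM EFinB.
apply: le_integral => // w _; rewrite lee_fin.
have : (g w.2 - g w.1) ^+ 2 <= (w.1 - w.2) ^+ 2.
  rewrite -(real_normK (num_real (g _ - _))) -(real_normK (num_real (w.1 - _))).
  by rewrite ler_sqr ?nnegrE// [leRHS]distrC.
by have := sqr_ge0 (c - (g w.2 - g w.1)); nra.
Qed.


(** The logarithm of the density [expR (t * g) / Z] is affine in [g], so its mean under the tilt is
    explicit. Nonnegativity is recorded because it later allows squaring the T2 bound and enlarging
    its constant. *)
Lemma KL_tilt (mu nu : probability R R) (g : R -> R) (M t Z : R) :
  measurable_fun setT g -> (forall x, `|g x| <= M) -> 0 < Z ->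
  (\int[mu]_x (expR (t * g x))%:E = Z%:E)%E ->
  (forall A, measurable A -> nu A = (\int[mu]_(x in A) (expR (t * g x) / Z)%:E)%E) ->
  KL nu mu = (t * (\int[nu]_x g x)%R - ln Z)%:E /\ (0 <= KL nu mu)%E.
Proof.
move=> mg gM Z0 ZE nuE.
set rho := fun x => expR (t * g x) / Z.
have me : measurable_fun setT (fun x : R => expR (t * g x)).
  by apply: measurableT_comp => //; exact: measurable_funM.
have mrho : measurable_fun setT rho by exact: measurable_funM.
have tg x : `|t * g x| <= `|t| * M by rewrite normrM ler_wpM2l.
have irho : mu.-integrable setT (EFin \o rho).
  apply: (@bounded_integrable _ _ _ _ (expR (`|t| * M) / Z)) => // x.
  rewrite ger0_norm ?divr_ge0 ?expR_ge0 ?(ltW Z0)//.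
  rewrite ler_pM2r ?invr_gt0// ler_expR.
  by apply: le_trans (tg x); exact: ler_norm.
have [dom RN] := density_Radon_Nikodym mrho irho nuE.
have rho_gt0 x : 0 < rho x by rewrite divr_gt0 ?expR_gt0.
have lnrho x : ln (rho x) = t * g x - ln Z.
  by rewrite /rho ln_div ?posrE ?expR_gt0// expRK.
have mln : measurable_fun setT (fun x => t * g x - ln Z).
  by apply: measurable_funB => //; exact: measurable_funM.
have KLE : KL nu mu = (\int[nu]_x (t * g x - ln Z)%:E)%E.
  rewrite /KL asboolT//; apply: ae_eq_integral => //.
  - apply: measurable_lne; apply: measurable_int; exact: (@Radon_Nikodym_integrable _ _ _ (charge_of_finite_measure nu) mu dom).
  - exact/measurable_EFinP.
  - apply: (null_dominates_ae_eq _ dom) => //.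
    by apply: filterS RN => x -> _; rewrite lne_EFin// lnrho.
have ig : nu.-integrable setT (EFin \o g) by exact: bounded_integrable gM.
have itg : nu.-integrable setT (fun x => t%:E * (EFin \o g) x)%E by exact: integrableZl.
have ic : nu.-integrable setT (fun x : R => (ln Z)%:E).
  exact: finite_measure_integrable_cst.
have iln : nu.-integrable setT (fun x => (t * g x - ln Z)%:E).
  apply: (eq_integrable measurableT (fun x => t%:E * (EFin \o g) x - (ln Z)%:E)%E) => //.
  exact: integrableB.
split.
  rewrite KLE; have -> : (\int[nu]_x (t * g x - ln Z)%:E =
    \int[nu]_x (t%:E * (EFin \o g) x - (ln Z)%:E))%E by [].
  rewrite integralB// integralZl// integral_cst_probability.
  by rewrite /Rintegral EFinB EFinM fineK// integrable_fin_num.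
rewrite KLE.
have iinv : nu.-integrable setT (fun x => (1 - (rho x)^-1)%:E).
  apply: (@bounded_integrable _ _ _ _ (1 + Z * expR (`|t| * M))) => //.
    apply: measurable_funB => //.
    rewrite (_ : (fun x => (rho x)^-1) = fun x => expR (- (t * g x)) * Z).
      apply: measurable_funM => //; apply: measurableT_comp => //.
      by apply: measurableT_comp => //; exact: measurable_funM.
    by apply/funext => x; rewrite /rho invfM invrK expRN.
  move=> x; rewrite (le_trans (ler_normB _ _))// normr1 lerD2l.
  rewrite /rho invfM invrK -expRN normrM mulrC.
  rewrite (ger0_norm (expR_ge0 _)) (gtr0_norm Z0) ler_pM2l// ler_expR.
  by apply: le_trans (tg x); rewrite -normrN; exact: ler_norm.
(* Gibbs' inequality: [ln r >= 1 - 1 / r], and [1 - 1 / rho] has mean zero under [nu], because a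
   change of variables turns it into [rho - 1] under [mu]. *)
have -> : (0 = \int[nu]_x (1 - (rho x)^-1)%:E)%E.
  have RNeq : (\int[nu]_x (1 - (rho x)^-1)%:E = \int[mu]_x (rho x - 1)%:E)%E.
    rewrite -(Radon_Nikodym_change_of_variables dom)//.
    apply: ae_eq_integral => //.
    - apply: emeasurable_funM; first exact: measurable_int iinv.
      exact: measurable_int (@Radon_Nikodym_integrable _ _ _ (charge_of_finite_measure nu) mu dom).
    - by apply/measurable_EFinP; exact: measurable_funB.
    - apply: filterS RN => x -> _; rewrite -EFinM mulrBl mul1r mulVf//.
      by rewrite gt_eqF.
  rewrite RNeq; have -> : (\int[mu]_x (rho x - 1)%:E =
     \int[mu]_x ((rho x)%:E - 1%:E))%E by [].
  rewrite integralB//; last exact: finite_measure_integrable_cst.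
  rewrite integral_cst_probability.
  rewrite -nuE// (@probability_setT _ _ _ nu) subee//.
apply: le_integral => // x _; rewrite lee_fin -lnrho.
have := @le_ln1Dx R ((rho x)^-1 - 1).
rewrite addrCA subrr addr0 lnV ?posrE// ltrBDl subrr invr_gt0 => /(_ (rho_gt0 x)).
lra.
Qed.

(** Let [m] and [a] be the means of [g] under the tilt and under [mu]. T2 at the tilt reads
    [(m - a)^2 <= 2 sigma^2 (t m - ln Z)]; solving for [ln Z] and completing the square in [m - a]
    gives the Gaussian bound without differentiating in [t]. The constant [sigma + 1] is there to
    divide by it when [sigma = 0]. *)
Lemma T2_bounded_mgf (mu : probability R R) (sigma : R) (g : R -> R) (M t : R) :
  T2_inequality mu sigma ->
  measurable_fun setT g -> (forall x, `|g x| <= M) ->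
  (forall x y, `|g x - g y| <= `|x - y|) ->
  (\int[mu]_x (expR (t * g x))%:E <=
    (expR (t * (\int[mu]_x g x)%R + (sigma + 1) ^+ 2 * t ^+ 2 / 2))%:E)%E.
Proof.
move=> [sigma0 T2] mg gM glip.
have me : measurable_fun setT (fun x : R => expR (t * g x)).
  by apply: measurableT_comp => //; exact: measurable_funM.
have tg x : `|t * g x| <= `|t| * M by rewrite normrM ler_wpM2l.
have ie : mu.-integrable setT (EFin \o (fun x : R => expR (t * g x))).
  apply: (@bounded_integrable _ _ _ _ (expR (`|t| * M))) => // x.
  rewrite ger0_norm ?expR_ge0// ler_expR.
  by apply: le_trans (tg x); exact: ler_norm.
have [Z ZE] : exists Z : R, (\int[mu]_x (expR (t * g x))%:E = Z%:E)%E.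
  exists (fine (\int[mu]_x (expR (t * g x))%:E)).
  by rewrite fineK// integrable_fin_num.
have Z0 : 0 < Z.
  rewrite -lte_fin -ZE; apply: (@lt_le_trans _ _ (expR (- (`|t| * M)))%:E).
    by rewrite lte_fin expR_gt0.
  have -> : ((expR (- (`|t| * M)))%:E = \int[mu]_x (expR (- (`|t| * M)))%:E)%E.
    by rewrite integral_cst_probability.
  apply: ge0_le_integral => //.
  - exact/measurable_EFinP.
  - move=> x _; rewrite lee_fin ler_expR lerNl.
    by apply: le_trans (tg x); rewrite -normrN; exact: ler_norm.
have [nu nuE] : exists nu : probability R R, forall A, measurable A ->
    nu A = (\int[mu]_(x in A) (expR (t * g x) / Z)%:E)%E.
  apply: density_probability => //.
  - exact: measurable_funM.
  - by move=> x; rewrite divr_ge0 ?expR_ge0 ?ltW.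
  - have -> : (\int[mu]_x (expR (t * g x) / Z)%:E =
      \int[mu]_x (Z^-1%:E * (expR (t * g x))%:E))%E.
      by apply: eq_integral => x _; rewrite -EFinM mulrC.
    by rewrite integralZl// ZE -EFinM mulVf ?gt_eqF.
have [KLE KL0] := KL_tilt mg gM Z0 ZE nuE.
set m := \int[nu]_x g x in KLE; set a := \int[mu]_x g x.
have low := transport_lower mu nu mg gM glip.
rewrite -/m -/a in low.
have /(le_trans low) := T2 nu.
rewrite KLE -EFinM !poweR_EFin lee_fin.
move: KL0; rewrite KLE lee_fin => KL0.
have s0 : 0 <= 2 * sigma ^+ 2 * (t * m - ln Z) by rewrite !mulr_ge0 ?sqr_ge0.
move=> /(ge0_ler_powR (ler0n R 2)); rewrite !nnegrE !powR_ge0 => /(_ isT isT).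
rewrite -!powRrM mulVf// !powRr1 ?sqr_ge0// => H.
rewrite ZE lee_fin -[leLHS]lnK ?posrE// ler_expR.
set s := sigma + 1.
have sgt0 : 0 < s by rewrite /s; lra.
have H2 : (m - a) ^+ 2 <= 2 * s ^+ 2 * (t * m - ln Z).
  apply: (le_trans H); rewrite ler_wpM2r// ler_wpM2l// /s; nra.
have sE : (m - a) / s * s = m - a by rewrite divfK// gt_eqF.
move: H2; rewrite -sE; set q := (m - a) / s => H2.
have mE : m = q * s + a by rewrite sE; ring.
have s2 : 0 < s ^+ 2 by rewrite exprn_gt0.
have : q ^+ 2 <= 2 * (t * m - ln Z).
  move: H2; rewrite exprMn => H2.
  rewrite -(ler_pM2r s2); apply: le_trans H2 _; rewrite mulrAC//.
rewrite mE => H4; have := sqr_ge0 (q - s * t); nra.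
Qed.


(** A bounded 1-Lipschitz test function that agrees with the identity on [[-M, M]], which brings the
    identity within reach of the bounded case. *)
Definition clamp (M x : R) : R := Num.max (- M) (Num.min x M).

Lemma clamp_norm M x : 0 <= M -> `|clamp M x| <= M.
Proof.
move=> M0; rewrite /clamp ler_norml.
by case: (leP x M) => h1; case: (leP (- M) x) => h2; case: (leP (- M) M) => h3;
  apply/andP; split; lra.
Qed.

Lemma clamp_norm_le M x : 0 <= M -> `|clamp M x| <= `|x|.
Proof.
move=> M0; have := ler_norm x; have := ler_norm (- x); rewrite normrN => a b.
rewrite /clamp ler_norml.
by case: (leP x M) => h1; case: (leP (- M) x) => h2; case: (leP (- M) M) => h3;
  apply/andP; split; lra.
Qed.

Lemma clamp_lip M x y : `|clamp M x - clamp M y| <= `|x - y|.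
Proof.
have := ler_norm (x - y); have := ler_norm (- (x - y)); rewrite normrN => a b.
rewrite /clamp ler_norml.
by case: (leP x M) => h1; case: (leP y M) => h2; case: (leP (- M) x) => h3;
  case: (leP (- M) y) => h4; case: (leP (- M) M) => h5; apply/andP; split; lra.
Qed.

Lemma clamp_id M x : `|x| <= M -> clamp M x = x.
Proof. by rewrite ler_norml => /andP[h1 h2]; rewrite /clamp min_l// max_r. Qed.

Lemma measurable_clamp M : measurable_fun setT (clamp M).
Proof. by apply: measurable_maxr => //; exact: measurable_minr. Qed.

Lemma le_limn_einf (u v : (\bar R)^nat) :
  (forall n, u n <= v n)%E -> (limn_einf u <= limn_einf v)%E.
Proof.
move=> uv; rewrite !limn_einf_lim; apply: lee_lim.
- exact: is_cvg_einfs.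
- exact: is_cvg_einfs.
near=> n; apply: le_ereal_inf_tmp => _ [m /= nm <-].
by apply: le_trans (uv m); apply: ereal_inf_lbound; exists m.
Unshelve. all: by end_near. Qed.

(** The truncations of the identity satisfy the bounded case. Their means tend to zero by dominated
    convergence, but no integrable majorant of the exponentials is known beforehand, so these pass
    to the limit by Fatou's lemma. *)
Lemma T2_mgf (mu : probability R R) (sigma t : R) :
  T2_inequality mu sigma ->
  mu.-integrable setT (fun x : R => x%:E) -> ('E_mu[fun x : R => x] = 0)%E ->
  (\int[mu]_x (expR (t * x))%:E <= (expR ((sigma + 1) ^+ 2 * t ^+ 2 / 2))%:E)%E.
Proof.
move=> T2 ix Ex.
pose g n x := clamp n%:R x.
have mg n : measurable_fun setT (g n) by exact: measurable_clamp.
have gcvg (x : R) : \forall n \near \oo, g n x = x.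
  near=> n; apply: clamp_id; near: n; exact: nbhs_infty_ger.
have acvg : (fun n => \int[mu]_x (g n x))%R @ \oo --> (0 : R).
  have [| | | | |_ _ h] := @dominated_convergence _ _ _ mu setT measurableT
    (fun n x => (g n x)%:E) (fun x => x%:E) (fun x => `|x|%:E).
  - by move=> n; apply/measurable_EFinP.
  - exact: measurable_int ix.
  - apply: aeW => x _; apply: cvg_near_cst.
    by apply: filterS (gcvg x) => n ->.
  - exact: (integrable_abse ix).
  - apply: aeW => x n _; rewrite lee_fin; exact: clamp_norm_le.
  have E0 : (\int[mu]_x x%:E)%E = 0%:E by move: Ex; rewrite unlock.
  by rewrite E0 in h; exact: fine_cvg h.
have bcvg : (fun n => (expR (t * (\int[mu]_x (g n x))%R + (sigma + 1) ^+ 2 * t ^+ 2 / 2))%:E)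
   @ \oo --> (expR ((sigma + 1) ^+ 2 * t ^+ 2 / 2))%:E.
  apply: cvg_EFin; first by near=> n.
  apply: (@continuous_cvg _ _ _ _ _ _ (@expR R)); first exact: continuous_expR.
  rewrite -[X in _ --> X]add0r -[X in _ --> X + _](mulr0 t).
  by apply: cvgD; [apply: cvgM => //; exact: cvg_cst | exact: cvg_cst].
have mexp n : measurable_fun setT (fun x => (expR (t * g n x))%:E).
  by apply/measurable_EFinP; apply: measurableT_comp => //; exact: measurable_funM.
have fat := @fatou _ _ _ mu setT measurableT (fun n x => (expR (t * g n x))%:E) mexp.
have -> : (\int[mu]_x (expR (t * x))%:E =
    \int[mu]_x limn_einf (fun n => (expR (t * g n x))%:E))%E.
  apply: eq_integral => x _.
  have h : (fun n => (expR (t * g n x))%:E) @ \oo --> (expR (t * x))%:E.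
    by apply: cvg_near_cst; apply: filterS (gcvg x) => n ->.
  rewrite is_cvg_limn_einfE; last by apply/cvg_ex; eexists; exact: h.
  by rewrite (cvg_lim _ h).
apply: (le_trans (fat _)); first by move=> n x _; rewrite lee_fin expR_ge0.
rewrite -[leRHS](cvg_lim _ bcvg)// -is_cvg_limn_einfE; last first.
  by apply/cvg_ex; eexists; exact: bcvg.
apply: le_limn_einf => n.
apply: T2_bounded_mgf => //.
- by move=> x; exact: clamp_norm.
- by move=> x y; exact: clamp_lip.
Unshelve. all: by end_near. Qed.

End Tilting.

(** * Borel sigma-algebras and independence *)

HB.instance Definition _ (T U : ptopologicalType) := Pointed.on (T * U)%type.

(* The measurable sets of [borelType T] are convertible to [borel]. *)
Definition borelType (T : ptopologicalType) : Type := T.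

HB.instance Definition _ (T : ptopologicalType) :=
  Measurable.copy (borelType T) (g_sigma_algebraType (@open T)).

Section Borel.
Context {R : realType}.

Definition countable_basis (T : topologicalType) (I : countType)
    (B : I -> set T) : Prop :=
  forall x U, nbhs x U -> exists i, B i x /\ B i `<=` U.

Lemma countable_basis_R :
  countable_basis (fun i : rat * nat => ball (ratr i.1 : R) (i.2.+1%:R)^-1).
Proof.
have H (x e : R) : 0 < e -> exists i : rat * nat,
    ball (ratr i.1 : R) (i.2.+1%:R)^-1 x /\ ball (ratr i.1 : R) (i.2.+1%:R)^-1 `<=` ball x e.
  move=> e0.
  have [k /= ke] : exists k : nat, (k.+1%:R)^-1 < e / 2 :> R.
    have [k _ hk] := near_infty_natSinv_lt (PosNum (divr_gt0 e0 (ltr0n R 2))).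
    by exists k; apply: (hk k) => /=.
  move: ke; set a := (k.+1%:R)^-1 => ke.
  have a0 : 0 < a by rewrite invr_gt0 ltr0n.
  have [q /andP[q1 q2]] : exists q : rat, x - a < ratr q < x + a.
    have /rat_in_itvoo [q] : x - a < x + a by lra.
    by rewrite in_itv /= => h; exists q.
  exists (q, k); split => /=; rewrite -/a.
    by rewrite /ball /= ltr_norml; apply/andP; split; lra.
  move=> y; rewrite /ball /= !ltr_norml => /andP[h1 h2].
  by apply/andP; split; lra.
move=> x U /nbhs_ballP [e /= e0 eU].
have [i [h1 h2]] := H x e e0.
by exists i; split => //; exact: subset_trans eU.
Qed.

Lemma countable_basis_prod (T U : topologicalType) (I J : countType)
    (B : I -> set T) (C : J -> set U) :
  countable_basis B -> countable_basis C ->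
  countable_basis (fun i : I * J => B i.1 `*` C i.2).
Proof.
move=> hB hC [x y] W [[/= A1 A2] [/= n1 n2] h].
have [i [Bx BA]] := hB x A1 n1; have [j [Cy CA]] := hC y A2 n2.
exists (i, j); split => // -[a b] [/= Ba Cb]; apply: h; split => /=.
- exact: BA.
- exact: CA.
Qed.

Lemma countable_basis_mx (T : topologicalType) (I : countType)
    (B : I -> set T) (m n : nat) :
  countable_basis B ->
  countable_basis (fun c : 'M[I]_(m, n) =>
    [set X : 'M[T]_(m, n) | forall i j, B (c i j) (X i j)]).
Proof.
move=> hB X U [P PX PU].
have h (ij : 'I_m * 'I_n) : exists c, B c (X ij.1 ij.2) /\ B c `<=` P ij.1 ij.2.
  by apply: hB; exact: PX.
have [f fP] := choice h.
exists (\matrix_(i, j) f (i, j)); split => [i j|Y BY]; first by rewrite mxE; case: (fP (i, j)).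
apply: PU => i j; have [_ +] := fP (i, j); apply => /=.
by have := BY i j; rewrite mxE.
Qed.

(** An open set is the union of the countably many basic sets contained in it, so the preimages of
    basic sets suffice. This turns coordinatewise measurability into measurability for [borel] of
    spaces of matrices and of pairs. *)
Lemma measurable_borel d (Omega : measurableType d) (T : ptopologicalType)
    (I : countType) (B : I -> set T) (X : Omega -> T) :
  countable_basis B -> (forall i, measurable (X @^-1` B i)) ->
  measurable_fun setT (X : Omega -> borelType T).
Proof.
move=> hB mX.
apply: (@measurability _ _ Omega (borelType T) setT X (@open T)) => // _ [U oU <-].
rewrite setTI.
rewrite (_ : _ @^-1` _ = \bigcup_i (if `[< B i `<=` U >] then X @^-1` B i else set0)).
  apply: countable_bigcupT_measurable; first exact: countableP.
  by move=> i; case: ifP.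
apply/seteqP; split => [w Uw|w [i _]].
  have [i [Bi iU]] := hB (X w) U (open_nbhs_nbhs (conj oU Uw)).
  by exists i => //; rewrite asboolT.
by case: asboolP => // iU Biw; exact: iU.
Qed.

Lemma measurable_preimage d (Omega : measurableType d) d' (T : measurableType d')
    (X : Omega -> T) (A : set T) :
  measurable_fun setT X -> measurable A -> measurable (X @^-1` A).
Proof. by move=> mX mA; rewrite -[_ @^-1` _]setTI; exact: mX. Qed.

Lemma measurable_mx_coords d (Omega : measurableType d) (I : countType)
    (B : I -> set R) (m n : nat) (X : Omega -> 'M[R]_(m, n)) (c : 'M[I]_(m, n)) :
  (forall i, measurable (B i)) ->
  (forall i j, measurable_fun setT (fun w => X w i j)) ->
  measurable (X @^-1` [set X : 'M[R]_(m, n) | forall i j, B (c i j) (X i j)]).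
Proof.
move=> mB mX.
rewrite (_ : _ @^-1` _ = \bigcap_(ij in [set: 'I_m * 'I_n])
   ((fun w => X w ij.1 ij.2) @^-1` B (c ij.1 ij.2))).
  by apply: fin_bigcap_measurable => // ij _; exact: measurable_preimage.
apply/seteqP; split => [w h [i j] _|w h i j]; first exact: h.
exact: (h (i, j)).
Qed.

Lemma measurable_ratball (i : rat * nat) :
  measurable (ball (ratr i.1 : R) (i.2.+1%:R)^-1).
Proof. exact: measurable_ball. Qed.

Lemma measurable_mx_borel d (Omega : measurableType d) (m n : nat)
    (X : Omega -> 'M[R]_(m, n)) :
  (forall i j, measurable_fun setT (fun w => X w i j)) ->
  measurable_fun setT (X : Omega -> borelType 'M[R]_(m, n)).
Proof.
move=> mX; apply: (measurable_borel (countable_basis_mx countable_basis_R)) => c.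
exact: (measurable_mx_coords _ measurable_ratball).
Qed.

Lemma measurable_mxR_borel d (Omega : measurableType d) (m n : nat)
    (X : Omega -> 'M[R]_(m, n)) (y : Omega -> R) :
  (forall i j, measurable_fun setT (fun w => X w i j)) ->
  measurable_fun setT y ->
  measurable_fun setT ((fun w => (X w, y w)) : Omega -> borelType ('M[R]_(m, n) * R)%type).
Proof.
move=> mX my; apply: (@measurable_borel _ Omega ('M[R]_(m, n) * R)%type _ _ _
  (countable_basis_prod (countable_basis_mx countable_basis_R) countable_basis_R)) => c.
rewrite (_ : _ @^-1` _ = X @^-1` [set X : 'M[R]_(m, n) | forall i j,
    ball (ratr (c.1 i j).1 : R) ((c.1 i j).2.+1%:R)^-1 (X i j)] `&`
  y @^-1` (ball (ratr c.2.1 : R) (c.2.2.+1%:R)^-1)) //.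
apply: measurableI; first exact: (measurable_mx_coords _ measurable_ratball).
by apply: (measurable_preimage my); exact: measurable_ball.
Qed.

Lemma measurable_mxmx_borel d (Omega : measurableType d) (m n k l : nat)
    (X : Omega -> 'M[R]_(m, n)) (Y : Omega -> 'M[R]_(k, l)) :
  (forall i j, measurable_fun setT (fun w => X w i j)) ->
  (forall i j, measurable_fun setT (fun w => Y w i j)) ->
  measurable_fun setT
    ((fun w => (X w, Y w)) : Omega -> borelType ('M[R]_(m, n) * 'M[R]_(k, l))%type).
Proof.
move=> mX mY; apply: (@measurable_borel _ Omega ('M[R]_(m, n) * 'M[R]_(k, l))%type _ _ _ (countable_basis_prod
  (countable_basis_mx countable_basis_R) (countable_basis_mx countable_basis_R))) => c.
rewrite (_ : _ @^-1` _ = X @^-1` [set X : 'M[R]_(m, n) | forall i j,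
    ball (ratr (c.1 i j).1 : R) ((c.1 i j).2.+1%:R)^-1 (X i j)] `&`
  Y @^-1` [set X : 'M[R]_(k, l) | forall i j,
    ball (ratr (c.2 i j).1 : R) ((c.2 i j).2.+1%:R)^-1 (X i j)]) //.
by apply: measurableI; exact: (measurable_mx_coords _ measurable_ratball).
Qed.

Lemma continuous_measurable_borel (T : ptopologicalType) (f : T -> R) :
  continuous f -> measurable_fun setT (f : borelType T -> R).
Proof.
move=> cf; apply: (@measurability _ _ (borelType T) R setT f _ (RGenOInfty.measurableE R)) => _ [_ [x ->] <-].
rewrite setTI; apply: sub_sigma_algebra.
by apply: open_comp; [move=> t _; exact: cf | exact: rray_open].
Qed.

Lemma measurable_fst_coord (m n : nat) (U : ptopologicalType) i j :
  measurable_fun setT ((fun e => e.1 i j) : borelType ('M[R]_(m, n) * U)%type -> R).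
Proof.
apply: (@continuous_measurable_borel ('M[R]_(m, n) * U)%type (fun e => e.1 i j)) => e.
apply: (@continuous_comp _ _ _ fst (fun X : 'M[R]_(m, n) => X i j)).
  exact: cvg_fst.
exact: coord_continuous.
Qed.

Lemma measurable_snd_coord (m n : nat) (U : ptopologicalType) i j :
  measurable_fun setT ((fun e => e.2 i j) : borelType (U * 'M[R]_(m, n))%type -> R).
Proof.
apply: (@continuous_measurable_borel (U * 'M[R]_(m, n))%type (fun e => e.2 i j)) => e.
apply: (@continuous_comp _ _ _ snd (fun X : 'M[R]_(m, n) => X i j)).
  exact: cvg_snd.
exact: coord_continuous.
Qed.

Lemma measurable_snd_real (U : ptopologicalType) :
  measurable_fun setT ((fun e => e.2) : borelType (U * R)%type -> R).
Proof. by apply: (@continuous_measurable_borel (U * R)%type (fun e => e.2)) => e; exact: cvg_snd. Qed.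

End Borel.


Section Independence.
Context {R : realType} {d : measure_display} {Omega : measurableType d}.
Variable P : probability Omega R.

(* The pi-system generating the events that depend on all coordinates but the
   [i]-th. *)
Definition other_events (I : finType) (T : topologicalType) (D : I -> Omega -> T)
    (i : I) : set (set Omega) :=
  [set F | exists f : I -> set T, (forall j, borel (f j)) /\
     F = \bigcap_(j in [set j | j != i]) D j @^-1` f j].

(** Uniqueness of measures: the restriction of [P] to the event about coordinate [i], and [P] scaled
    by the probability of that event, are finite measures that agree on a pi-system. *)
Lemma other_events_indep (I : finType) (T : ptopologicalType) (D : I -> Omega -> T)
    (i : I) (A : set T) (E : set Omega) :
  (forall j, measurable_fun setT (D j : Omega -> borelType T)) ->
  mutually_independent P D -> borel A -> <<s other_events D i >> E ->
  P (D i @^-1` A `&` E) = (P (D i @^-1` A) * P E)%E.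
Proof.
move=> mD mi bA.
have mDB j B : borel B -> measurable (D j @^-1` B).
  by move=> bB; exact: (@measurable_preimage _ _ _ (borelType T) (D j)).
have mA := mDB i A bA.
have bT : borel [set: T] by exact: (@measurableT _ (borelType T)).
pose pA : {nonneg R} := NngNum (fine_ge0 (measure_ge0 P (D i @^-1` A))).
have pAE : (pA%:num)%:E = P (D i @^-1` A) by rewrite /= fineK// fin_num_measure.
move=> sE; rewrite -pAE setIC.
apply: (@g_sigma_algebra_measure_unique _ R Omega (other_events D i) _
  (fun=> setT) _ _ (mrestr P mA) (mscale pA P) _ _ _ E sE).
- move=> _ [f [bf ->]]; apply: fin_bigcap_measurable; first exact: finite_finset.
  by move=> j _; exact: mDB.
- move=> _; exists (fun=> setT); split => //.
  by apply/seteqP; split.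
- by rewrite bigcup_const.
- move=> _ _ [f [bf ->]] [g [bg ->]]; exists (fun j => f j `&` g j); split.
    by move=> j; exact: (@measurableI _ (borelType T) _ _ (bf j) (bg j)).
  apply/seteqP; split => [w [hf hg] j ji|w h].
    by split; [exact: hf | exact: hg].
  by split => j ji; have [] := h j ji.
- move=> _ [f [bf ->]].
  (* One family of sets serves both uses of mutual independence: over all indices for the
     intersection, and over the indices other than [i] for [F] alone. *)
  pose g j := if j == i then A else f j.
  have bg j : borel (g j) by rewrite /g; case: ifP.
  have E1 : \bigcap_(j in [set j | j != i]) D j @^-1` f j =
      \bigcap_(j in [set j | j \in [set j | j != i]%SET]) D j @^-1` g j.
    apply/seteqP; split => w h j /=; rewrite ?inE => ji; have := h j; rewrite /= ?inE => /(_ ji);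
    by rewrite /g (negbTE ji).
  have E2 : D i @^-1` A `&` \bigcap_(j in [set j | j != i]) D j @^-1` f j =
      \bigcap_(j in [set j | j \in [set: I]%SET]) D j @^-1` g j.
    apply/seteqP; split => [w [hA h] j _|w h].
      by rewrite /g; case: ifPn => [/eqP ->//|ji]; exact: h.
    split; first by have := h i; rewrite /= inE /g eqxx; apply.
    by move=> j ji; have := h j; rewrite /= inE /g (negbTE ji); apply.
  set F := \bigcap_(j in [set j | j != i]) D j @^-1` f j.
  have FE : P (D i @^-1` A `&` F) = (P (D i @^-1` A) * P F)%E.
    rewrite /F E2 E1 mi// mi// (bigD1 i) ?inE//= {1}/g eqxx; congr (_ * _)%E.
    by apply: eq_bigl => j; rewrite !inE.
  apply: (etrans (congr1 P (setIC F (D i @^-1` A)))); apply: (etrans FE).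
  exact: (congr1 (fun t => t * P F)%E (esym pAE)).
- move=> _; apply: (@le_lt_trans _ _ (P (D i @^-1` A))).
    by rewrite le_eqVlt; apply/orP; left; apply/eqP; exact: (congr1 P (setTI _)).
  exact: le_lt_trans (probability_le1 P mA) (ltry _).
Qed.


Lemma measurable_other (I : finType) (T : ptopologicalType) (D : I -> Omega -> T) i j :
  j != i ->
  measurable_fun setT (D j : g_sigma_algebraType (other_events D i) -> borelType T).
Proof.
move=> ji _ A mA; rewrite setTI; apply: sub_sigma_algebra.
exists (fun k => if k == j then A else setT); split.
  by move=> k; case: ifP => // _; exact: (@measurableT _ (borelType T)).
apply/seteqP; split => [w DA k /= ki|w /(_ j ji)]; last by rewrite /= eqxx.
by case: eqP => [->|].
Qed.

Lemma indep_other d2 (T2 : measurableType d2) (I : finType) (T : ptopologicalType)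
    (D : I -> Omega -> T) (i : I) (V : Omega -> T2) :
  (forall j, measurable_fun setT (D j : Omega -> borelType T)) ->
  mutually_independent P D ->
  measurable_fun setT (V : g_sigma_algebraType (other_events D i) -> T2) ->
  forall (A : set (borelType T)) B, measurable A -> measurable B ->
  P (D i @^-1` A `&` V @^-1` B) = (P (D i @^-1` A) * P (V @^-1` B))%E.
Proof.
move=> mD mi mV A B mA mB; apply: other_events_indep => //.
by rewrite -[_ @^-1` _]setTI; exact: mV.
Qed.

Lemma measurable_of_other d2 (T2 : measurableType d2) (I : finType)
    (T : ptopologicalType) (D : I -> Omega -> T) (i : I) (V : Omega -> T2) :
  (forall j, measurable_fun setT (D j : Omega -> borelType T)) ->
  measurable_fun setT (V : g_sigma_algebraType (other_events D i) -> T2) ->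
  measurable_fun setT (V : Omega -> T2).
Proof.
move=> mD mV _ A mA; have := mV measurableT A mA; rewrite /measurable /=.
apply: smallest_sub; first exact: sigma_algebra_measurable.
move=> _ [f [bf ->]]; apply: fin_bigcap_measurable; first exact: finite_finset.
by move=> j _; exact: (measurable_preimage (mD j) (bf j)).
Qed.

Section Fubini.
Context {d1 d2 : measure_display} {T1 : measurableType d1} {T2 : measurableType d2}.
Variables (U : Omega -> T1) (V : Omega -> T2) (Q : probability T1 R).
Hypothesis mU : measurable_fun setT U.
Hypothesis mV : measurable_fun setT V.
Hypothesis UQ : forall A, measurable A -> P (U @^-1` A) = Q A.
Hypothesis UV : forall A B, measurable A -> measurable B ->
  P (U @^-1` A `&` V @^-1` B) = (P (U @^-1` A) * P (V @^-1` B))%E.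

(** The joint law of [V] and [U] agrees with the product of the marginals on rectangles, hence
    everywhere; Tonelli then integrates [U] out while [V] stays frozen. *)
Lemma indep_fubini (g : T2 * T1 -> \bar R) :
  measurable_fun setT g -> (forall x, (0 <= g x)%E) ->
  (\int[P]_w g (V w, U w) = \int[P]_w \int[Q]_u g (V w, u))%E.
Proof.
move=> mg g0.
pose V' : {mfun Omega >-> T2} := HB.pack V (@isMeasurableFun.Build _ _ _ _ V mV).
have mW : measurable_fun setT (fun w => (V w, U w)) by exact: measurable_fun_pair.
pose W' : {mfun Omega >-> (T2 * T1)%type} :=
  HB.pack (fun w => (V w, U w)) (@isMeasurableFun.Build _ _ _ _ (fun w => (V w, U w)) mW).
have WE A : measurable A -> ((distribution P V') \x Q)%E A = distribution P W' A.
  apply: product_measure_unique => B C mB mC.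
  have E : P ((fun w => (V w, U w)) @^-1` (B `*` C)) = (P (V @^-1` B) * Q C)%E.
    rewrite -UQ// muleC -UV//; congr (P _).
    by apply/seteqP; split => w [].
  exact: E.
transitivity (\int[distribution P W']_x g x)%E.
  by rewrite ge0_integral_distribution.
transitivity (\int[((distribution P V') \x Q)%E]_x g x)%E.
  by apply: eq_measure_integral => A mA _; exact: esym (WE A mA).
rewrite fubini_tonelli1// ge0_integral_distribution//.
- exact: measurable_fun_fubini_tonelli_F.
- by move=> x; exact: integral_ge0.
Qed.

Lemma indep_fubini_set (A : set (T2 * T1)) : measurable A ->
  P [set w | A (V w, U w)] = (\int[P]_w Q [set u | A (V w, u)])%E.
Proof.
move=> mA.
have mW : measurable_fun setT (fun w => (V w, U w)) by exact: measurable_fun_pair.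
have mAW : measurable [set w | A (V w, U w)].
  exact: (measurable_preimage mW mA).
transitivity (\int[P]_w (\1_[set w | A (V w, U w)] w)%:E)%E.
  by rewrite integral_indic// setIT.
transitivity (\int[P]_w (\1_A (V w, U w))%:E)%E.
  by apply: eq_integral => w _; rewrite !indicE; congr (_%:R%:E); apply/idP/idP; rewrite !inE.
rewrite (indep_fubini (g := fun x => (\1_A x)%:E)).
- apply: eq_integral => w _.
  transitivity (\int[Q]_u (\1_[set u | A (V w, u)] u)%:E)%E.
    by apply: eq_integral => u _; rewrite !indicE; congr (_%:R%:E); apply/idP/idP; rewrite !inE.
  rewrite integral_indic// ?setIT//.
  rewrite (_ : [set u | _] = xsection A (V w)); first exact: measurable_xsection.
  by apply/seteqP; split => u; rewrite /xsection /= inE.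
- by apply/measurable_EFinP; exact: measurable_indic.
- by move=> x; rewrite lee_fin.
Qed.

End Fubini.

(** Induction on a duplicate-free list of indices: the product over the tail is measurable with
    respect to the coordinates other than the head, which can then be integrated out. *)
Lemma indep_integral_prod (I : finType) (T : ptopologicalType) (D : I -> Omega -> T)
    (g : I -> T -> R) :
  (forall j, measurable_fun setT (D j : Omega -> borelType T)) ->
  mutually_independent P D ->
  (forall j, measurable_fun setT (g j : borelType T -> R)) ->
  (forall j x, 0 <= g j x) ->
  (\int[P]_w (\prod_j g j (D j w))%:E = \prod_j \int[P]_w (g j (D j w))%:E)%E.
Proof.
move=> mD mi mg g0.
suff : forall s : seq I, uniq s ->
    (\int[P]_w (\prod_(j <- s) g j (D j w))%:E =
     \prod_(j <- s) \int[P]_w (g j (D j w))%:E)%E.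
  by apply; exact: index_enum_uniq.
elim => [_|i s IH /= /andP[nis us]].
  under eq_integral do rewrite big_nil.
  by rewrite big_nil integral_cst_probability.
rewrite big_cons -(IH us).
pose V w := \prod_(j <- s) g j (D j w).
have mV : measurable_fun setT (V : g_sigma_algebraType (other_events D i) -> R).
  rewrite /V; elim: s nis {IH us V} => [_|k s IH].
    rewrite (_ : (fun w => _) = cst 1); first exact: measurable_cst.
    by apply/funext => w; rewrite big_nil.
  rewrite inE negb_or => /andP[ki nis].
  under eq_fun do rewrite big_cons.
  apply: measurable_funM; last exact: IH.
  apply: (@measurableT_comp _ _ _ _ (borelType T) _ (g k)) => //.
  by apply: measurable_other; rewrite eq_sym.
have mV' := measurable_of_other mD mV.
have V0 w : 0 <= V w by rewrite /V prodr_ge0.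
pose Di' : {mfun Omega >-> borelType T} :=
  HB.pack (D i) (@isMeasurableFun.Build _ _ _ _ (D i : Omega -> borelType T) (mD i)).
(* The absolute value makes the integrand nonnegative on the whole product space, as Tonelli
   requires; along [V] it changes nothing, since [V] is nonnegative. *)
have := @indep_fubini _ _ (borelType T) _ (D i) V (distribution P Di') (mD i) mV'
  (fun A _ => erefl) (fun A B => @indep_other _ _ _ _ _ _ _ mD mi mV A B)
  (fun x => (`|x.1| * g i x.2)%:E).
have mgi : measurable_fun setT (fun x : R * borelType T => g i x.2).
  by apply: (@measurableT_comp _ _ _ _ (borelType T) _ (g i)).
rewrite /= => H.
under eq_integral => w _ do rewrite big_cons mulrC -[X in X * _](ger0_norm (V0 w)).
rewrite H.
- have mgE : measurable_fun setT (fun u : borelType T => (g i u)%:E).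
    exact/measurable_EFinP.
  have inner w : (\int[distribution P Di']_u (`|V w| * g i u)%:E =
      (V w)%:E * \int[P]_w (g i (D i w))%:E)%E.
    under eq_integral => u _ do rewrite EFinM (ger0_norm (V0 w)).
    rewrite ge0_integralZl_EFin//; last by move=> u _; rewrite lee_fin.
    by rewrite ge0_integral_distribution// => u; rewrite lee_fin.
  under eq_integral => w _ do rewrite inner.
  rewrite ge0_integralZr//; last 3 first.
    - exact/measurable_EFinP.
    - by move=> w _; rewrite lee_fin.
    - by apply: integral_ge0 => u _; rewrite lee_fin.
  by rewrite muleC.
- apply/measurable_EFinP; apply: measurable_funM => //.
  exact: measurableT_comp.
- by move=> x; rewrite lee_fin mulr_ge0.
Qed.

End Independence.

(** * Gradient descent on a subset of the observations *)

Section Inequalities.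
Context {R : realType}.

(** Lagrange's identity: the double sum of the squares of [a i * b j - a j * b i] is twice the
    difference of the two sides. *)
Lemma sum_Cauchy_Schwarz (I : Type) (s : seq I) (P : pred I) (a b : I -> R) :
  (\sum_(i <- s | P i) a i * b i) ^+ 2 <=
  (\sum_(i <- s | P i) a i ^+ 2) * (\sum_(i <- s | P i) b i ^+ 2).
Proof.
have H : 0 <= \sum_(i <- s | P i) \sum_(j <- s | P j) (a i * b j - a j * b i) ^+ 2.
  by apply: sumr_ge0 => i _; apply: sumr_ge0 => j _; exact: sqr_ge0.
set A := \sum_(i <- s | P i) a i ^+ 2; set B := \sum_(i <- s | P i) b i ^+ 2.
set C := \sum_(i <- s | P i) a i * b i.
suff E : \sum_(i <- s | P i) \sum_(j <- s | P j) (a i * b j - a j * b i) ^+ 2 =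
  A * B + B * A - 2 * (C * C) by rewrite E in H; nra.
rewrite /A /B /C !big_distrlr /= mulr_sumr -big_split -sumrB /=.
apply: eq_bigr => i _; rewrite mulr_sumr -big_split -sumrB /=.
by apply: eq_bigr => j _; ring.
Qed.

(** Cauchy-Schwarz with each weight split into two square roots. Iterating it yields the fourth and
    eighth powers below; as the weights are not normalised, the total weight appears with exponents
    3 and 7. *)
Lemma sum_jensen_sqr (I : Type) (s : seq I) (P : pred I) (w a : I -> R) :
  (forall i, P i -> 0 <= w i) ->
  (\sum_(i <- s | P i) w i * a i) ^+ 2 <=
  (\sum_(i <- s | P i) w i) * \sum_(i <- s | P i) w i * a i ^+ 2.
Proof.
move=> w0.
have := sum_Cauchy_Schwarz s P (fun i => Num.sqrt (w i)) (fun i => Num.sqrt (w i) * a i).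
have -> : \sum_(i <- s | P i) Num.sqrt (w i) * (Num.sqrt (w i) * a i) =
    \sum_(i <- s | P i) w i * a i.
  by apply: eq_bigr => i Pi; rewrite mulrA -expr2 sqr_sqrtr ?w0.
have -> : \sum_(i <- s | P i) Num.sqrt (w i) ^+ 2 = \sum_(i <- s | P i) w i.
  by apply: eq_bigr => i Pi; rewrite sqr_sqrtr ?w0.
have -> : \sum_(i <- s | P i) (Num.sqrt (w i) * a i) ^+ 2 =
    \sum_(i <- s | P i) w i * a i ^+ 2 => //.
by apply: eq_bigr => i Pi; rewrite exprMn sqr_sqrtr ?w0.
Qed.

Lemma sum_jensen_pow4 (I : Type) (s : seq I) (P : pred I) (w a : I -> R) :
  (forall i, P i -> 0 <= w i) ->
  (\sum_(i <- s | P i) w i * a i) ^+ 4 <=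
  (\sum_(i <- s | P i) w i) ^+ 3 * \sum_(i <- s | P i) w i * a i ^+ 4.
Proof.
move=> w0.
have W0 : 0 <= \sum_(i <- s | P i) w i by exact: sumr_ge0.
have h1 := sum_jensen_sqr s a w0.
have h2 := sum_jensen_sqr s (fun i => a i ^+ 2) w0.
rewrite (exprM _ 2 2); apply: (@le_trans _ _ (((\sum_(i <- s | P i) w i) *
   \sum_(i <- s | P i) w i * a i ^+ 2) ^+ 2)).
  rewrite ler_sqr ?nnegrE ?sqr_ge0// mulr_ge0// sumr_ge0// => i Pi.
  by rewrite mulr_ge0 ?sqr_ge0 ?w0.
rewrite exprMn (exprSr _ 2) -mulrA ler_wpM2l ?sqr_ge0//.
apply: (le_trans h2); rewrite ler_wpM2l//.
by rewrite le_eqVlt; apply/orP; left; apply/eqP; apply: eq_bigr => i _; rewrite -exprM.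
Qed.

Lemma sum_jensen_pow8 (I : Type) (s : seq I) (P : pred I) (w a : I -> R) :
  (forall i, P i -> 0 <= w i) ->
  (\sum_(i <- s | P i) w i * a i) ^+ 8 <=
  (\sum_(i <- s | P i) w i) ^+ 7 * \sum_(i <- s | P i) w i * a i ^+ 8.
Proof.
move=> w0.
have W0 : 0 <= \sum_(i <- s | P i) w i by exact: sumr_ge0.
have h1 := sum_jensen_pow4 s a w0.
have h2 := sum_jensen_sqr s (fun i => a i ^+ 4) w0.
rewrite (exprM _ 4 2); apply: (@le_trans _ _ (((\sum_(i <- s | P i) w i) ^+ 3 *
   \sum_(i <- s | P i) w i * a i ^+ 4) ^+ 2)).
  rewrite ler_sqr ?nnegrE//; last first.
    rewrite mulr_ge0 ?exprn_ge0// sumr_ge0// => i Pi.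
    by rewrite mulr_ge0 ?w0// (exprM _ 2 2) sqr_ge0.
  by rewrite (exprM _ 2 2) sqr_ge0.
rewrite exprMn -exprM (exprSr _ 6) -mulrA ler_wpM2l ?exprn_ge0//.
apply: (le_trans h2); rewrite ler_wpM2l//.
by rewrite le_eqVlt; apply/orP; left; apply/eqP; apply: eq_bigr => i _; rewrite -exprM.
Qed.

Lemma sum_pow4 (I : finType) (P : pred I) (a : I -> R) :
  (\sum_(i | P i) a i) ^+ 4 <= #|P|%:R ^+ 3 * \sum_(i | P i) a i ^+ 4.
Proof.
have := sum_jensen_pow4 (index_enum I) (P := P) (w := fun=> 1) a (fun i _ => ler01).
rewrite sumr_const; under eq_bigr do rewrite mul1r.
by under [X in _ <= _ * X -> _]eq_bigr do rewrite mul1r.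
Qed.

Lemma pow8_add (a b : R) : (a + b) ^+ 8 <= 128 * (a ^+ 8 + b ^+ 8).
Proof.
have H (x y : R) : (x + y) ^+ 2 <= 2 * (x ^+ 2 + y ^+ 2).
  by have := sqr_ge0 (x - y); nra.
have h1 := H a b; have h2 := H (a ^+ 2) (b ^+ 2); have h3 := H (a ^+ 4) (b ^+ 4).
rewrite -!exprM in h2 h3.
have s1 : 0 <= (a + b) ^+ 2 by exact: sqr_ge0.
have h4 : ((a + b) ^+ 2) ^+ 2 <= 8 * (a ^+ 4 + b ^+ 4).
  apply: (@le_trans _ _ ((2 * (a ^+ 2 + b ^+ 2)) ^+ 2)); last by rewrite exprMn; lra.
  by rewrite ler_sqr ?nnegrE// (le_trans s1).
rewrite (exprM _ 4 2) (exprM _ 2 2).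
have s2 : 0 <= ((a + b) ^+ 2) ^+ 2 by exact: sqr_ge0.
apply: (@le_trans _ _ ((8 * (a ^+ 4 + b ^+ 4)) ^+ 2)); last by rewrite exprMn; lra.
by rewrite ler_sqr ?nnegrE// (le_trans s2).
Qed.

(** Since [1 + delta k * M <= expR (M * delta k)], the growth factors multiply to an exponential of
    the total step size. The number of steps does not enter separately, which keeps all later
    constants uniform in [K]. *)
Lemma discrete_Gronwall (M : R) (delta a c : nat -> R) (K : nat) :
  0 <= M -> (forall k, (k < K)%N -> 0 <= delta k) ->
  (forall k, 0 <= c k) -> 0 <= a 0%N ->
  (forall k, (k < K)%N -> a k.+1 <= (1 + delta k * M) * a k + delta k * c k) ->
  forall k, (k <= K)%N ->
  a k <= expR (M * \sum_(0 <= s < k) delta s) *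
         (a 0%N + \sum_(0 <= s < k) delta s * c s).
Proof.
move=> M0 d0 c0 a0 step; elim => [_|k IH kK].
  by rewrite !big_geq// mulr0 expR0 mul1r addr0.
have {}IH := IH (ltnW kK).
apply: (le_trans (step _ kK)).
have -> : M * \sum_(0 <= s < k.+1) delta s = M * \sum_(0 <= s < k) delta s + M * delta k.
  by rewrite big_nat_recr//= mulrDr.
rewrite expRD big_nat_recr//=.
set E := expR _; set W := \sum_(0 <= i < k) delta i * c i.
have E1 : 1 <= E.
  rewrite -expR0 ler_expR mulr_ge0// big_nat_cond sumr_ge0// => i /andP[/andP[_ ik] _].
  by apply: d0; apply: ltn_trans kK.
have W0 : 0 <= W.
  rewrite /W big_nat_cond sumr_ge0// => i /andP[/andP[_ ik] _]; rewrite mulr_ge0//.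
  by apply: d0; apply: ltn_trans kK.
have dk := d0 _ kK; have ck := c0 k.
have E2 : 1 + delta k * M <= expR (M * delta k) by rewrite mulrC; exact: expR_ge1Dx.
set F := expR (M * delta k) in E2 *.
have dM : 0 <= delta k * M by rewrite mulr_ge0.
have dc : 0 <= delta k * c k by rewrite mulr_ge0.
apply: (@le_trans _ _ (F * (E * (a 0%N + W)) + E * F * (delta k * c k))).
  apply: lerD.
    apply: (@le_trans _ _ ((1 + delta k * M) * (E * (a 0%N + W)))).
      by rewrite ler_wpM2l// addr_ge0.
    by rewrite ler_wpM2r// mulr_ge0 ?addr_ge0// (le_trans _ E1).
  have EF : 1 <= E * F by rewrite -[leLHS]mulr1 ler_pM//; lra.
  by rewrite ler_peMl.
by rewrite le_eqVlt; apply/orP; left; apply/eqP; ring.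
Qed.

End Inequalities.

Section Euclidean.
Context {R : realType}.
Implicit Types d : nat.

Definition dot d (u v : 'cV[R]_d) : R := \sum_i u i 0 * v i 0.

Lemma dotC d (u v : 'cV[R]_d) : dot u v = dot v u.
Proof. by apply: eq_bigr => i _; rewrite mulrC. Qed.

Lemma dotDr d (u v w : 'cV[R]_d) : dot u (v + w) = dot u v + dot u w.
Proof. by rewrite /dot -big_split; apply: eq_bigr => i _; rewrite mxE mulrDr. Qed.

Lemma dotZr d a (u v : 'cV[R]_d) : dot u (a *: v) = a * dot u v.
Proof. by rewrite /dot mulr_sumr; apply: eq_bigr => i _; rewrite mxE mulrCA. Qed.

Lemma dotBr d (u v w : 'cV[R]_d) : dot u (v - w) = dot u v - dot u w.
Proof. by rewrite dotDr -scaleN1r dotZr mulN1r. Qed.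

Lemma dot0r d (u : 'cV[R]_d) : dot u 0 = 0.
Proof. by rewrite /dot big1// => i _; rewrite mxE mulr0. Qed.

Lemma dot_sumr d (I : Type) (s : seq I) (P : pred I) (u : 'cV[R]_d) (v : I -> 'cV[R]_d) :
  dot u (\sum_(i <- s | P i) v i) = \sum_(i <- s | P i) dot u (v i).
Proof.
elim/big_rec2: _ => [|i x y _ <-]; first exact: dot0r.
exact: dotDr.
Qed.

Lemma mulmx_dot d (u v : 'cV[R]_d) : (u^T *m v) 0 0 = dot u v.
Proof. by rewrite mxE; apply: eq_bigr => i _; rewrite mxE. Qed.

Lemma l2norm_ge0 d (v : 'cV[R]_d) : 0 <= l2norm v.
Proof. exact: sqrtr_ge0. Qed.

Lemma sqr_l2norm d (v : 'cV[R]_d) : l2norm v ^+ 2 = dot v v.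
Proof.
rewrite sqr_sqrtr; first by apply: eq_bigr => i _; rewrite expr2.
by apply: sumr_ge0 => i _; exact: sqr_ge0.
Qed.

Lemma dot_Cauchy_Schwarz d (u v : 'cV[R]_d) : `|dot u v| <= l2norm u * l2norm v.
Proof.
rewrite -ler_sqr ?nnegrE ?mulr_ge0 ?l2norm_ge0// real_normK ?num_real// exprMn.
have h w : l2norm w ^+ 2 = \sum_(i < d) w i 0 ^+ 2.
  by rewrite sqr_sqrtr// sumr_ge0// => i _; exact: sqr_ge0.
rewrite !h; exact: sum_Cauchy_Schwarz.
Qed.

Lemma l2norm0 d : l2norm (0 : 'cV[R]_d) = 0.
Proof. by rewrite /l2norm big1 ?sqrtr0// => i _; rewrite mxE expr0n. Qed.

Lemma l2normZ d a (v : 'cV[R]_d) : l2norm (a *: v) = `|a| * l2norm v.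
Proof.
apply/eqP; rewrite -(@eqrXn2 _ 2)// ?mulr_ge0 ?l2norm_ge0//.
by rewrite exprMn !sqr_l2norm dotZr dotC dotZr real_normK ?num_real// mulrA -expr2.
Qed.

Lemma l2normN d (v : 'cV[R]_d) : l2norm (- v) = l2norm v.
Proof. by rewrite -scaleN1r l2normZ normrN1 mul1r. Qed.

Lemma l2normD d (u v : 'cV[R]_d) : l2norm (u + v) <= l2norm u + l2norm v.
Proof.
rewrite -ler_sqr ?nnegrE ?addr_ge0 ?l2norm_ge0//.
rewrite sqrrD !sqr_l2norm dotDr !(dotC (u + v)) !dotDr (dotC v u).
have := dot_Cauchy_Schwarz u v; have := ler_norm (dot u v).
rewrite mulr2n; lra.
Qed.

Lemma l2norm_eq0 d (v : 'cV[R]_d) : l2norm v = 0 -> v = 0.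
Proof.
move=> v0; have : \sum_i v i 0 ^+ 2 = 0.
  transitivity (l2norm v ^+ 2); last by rewrite v0 expr0n.
  by rewrite sqr_l2norm; apply: eq_bigr => i _; rewrite expr2.
move=> /eqP; rewrite psumr_eq0; last by move=> i _; exact: sqr_ge0.
move=> /allP h; apply/matrixP => i j; rewrite ord1 mxE.
by have := h i (mem_index_enum _); rewrite /= sqrf_eq0 => /eqP.
Qed.

End Euclidean.

Section MaskedGD.
Context {R : realType} {n d : nat}.
Variable delta : nat -> R.
Implicit Types (X : 'M[R]_(n, d)) (Y : 'cV[R]_n) (S : {set 'I_n}) (b : 'cV[R]_d).

Definition obs X (i : 'I_n) : 'cV[R]_d := (row i X)^T.

(** Masking observations instead of deleting rows keeps the index type and the factor [n] fixed, so
    that the full, leave-one-out and leave-block-out iterates are values of one function, compared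
    through inclusion of the sets [S]. *)
Fixpoint gdm S X Y b0 k : 'cV[R]_d :=
  if k is k'.+1 then
    let b := gdm S X Y b0 k' in
    b + (delta k' / n%:R) *: \sum_(i in S) (Y i 0 - dot (obs X i) b) *: obs X i
  else b0.

Lemma gradient_rows m (X : 'M[R]_(m, d)) (y : 'cV[R]_m) b :
  X^T *m (y - X *m b) = \sum_i (y i 0 - dot (row i X)^T b) *: (row i X)^T.
Proof.
apply/matrixP => j l; rewrite ord1 mxE summxE; apply: eq_bigr => i _.
rewrite !mxE mulrC; congr ((_ - _) * _); apply: eq_bigr => t _.
by rewrite !mxE.
Qed.

Lemma gd_fullE X Y b0 k : gd_full delta X Y b0 k = gdm [set: 'I_n]%SET X Y b0 k.
Proof.
rewrite /gd_full; elim: k => //= k ->; rewrite gradient_rows.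
by congr (_ + _ *: _); apply: eq_bigl => i; rewrite inE.
Qed.

Lemma gd_looE X Y b0 (i : 'I_n) k : gd_loo delta X Y b0 i k = gdm [set~ i]%SET X Y b0 k.
Proof.
rewrite /gd_loo; elim: k => //= k ->; rewrite gradient_rows.
congr (_ + _ *: _).
rewrite (eq_bigl (fun j => j != i)); last by move=> j; rewrite !inE.
have h : forall j : 'I_n.-1, lift i j != i by move=> j; rewrite eq_sym neq_lift.
rewrite (reindex_omap (lift i) (unlift i)) /=; last first.
  by move=> j; case: unliftP => [l ->|->] //; rewrite eqxx.
apply: eq_big => [j|j _]; first by rewrite h liftK eqxx.
by rewrite mxE /obs; congr ((_ - dot _ _) *: _); apply/matrixP => a c; rewrite !mxE.
Qed.

(* The restriction of [X] to the rows in [S] has operator norm at most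
   [sqrt (M n)]. *)
Definition opn_le M S X : Prop :=
  forall b, \sum_(i in S) dot (obs X i) b ^+ 2 <= M * n%:R * l2norm b ^+ 2.

Lemma opn_leS M S S' X : S' \subset S -> opn_le M S X -> opn_le M S' X.
Proof.
move=> sub h b; apply: le_trans (h b).
rewrite [leRHS](big_setID S') /= (finset.setIidPr sub) lerDl sumr_ge0// => i _.
exact: sqr_ge0.
Qed.

(** A matrix and its transpose have the same operator norm: expand the squared norm of [v] as a sum
    of [a i * dot (obs X i) v], apply Cauchy-Schwarz and the hypothesis at [v] itself, then cancel
    one factor. *)
Lemma opn_comb M S X (a : 'I_n -> R) : 0 <= M -> opn_le M S X ->
  l2norm (\sum_(i in S) a i *: obs X i) ^+ 2 <= M * n%:R * \sum_(i in S) a i ^+ 2.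
Proof.
move=> M0 h; set v := \sum_(i in S) _; set A := \sum_(i in S) _.
have A0 : 0 <= A by apply: sumr_ge0 => i _; exact: sqr_ge0.
have E : l2norm v ^+ 2 = \sum_(i in S) a i * dot (obs X i) v.
  by rewrite sqr_l2norm {2}/v dot_sumr; apply: eq_bigr => i _; rewrite dotZr dotC.
have q0 : 0 <= l2norm v ^+ 2 by exact: sqr_ge0.
have H : (l2norm v ^+ 2) ^+ 2 <= A * (M * n%:R * l2norm v ^+ 2).
  rewrite {1}E; apply: (le_trans (sum_Cauchy_Schwarz _ _ _ _)).
  by rewrite -/A ler_wpM2l//.
have [->|qn0] := eqVneq (l2norm v ^+ 2) 0; first by rewrite !mulr_ge0.
have qp : 0 < l2norm v ^+ 2 by rewrite lt_def qn0.
by rewrite -(ler_pM2r qp) -expr2; apply: (le_trans H); rewrite mulrCA mulrA.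
Qed.

Lemma opn_grad M S X b : 0 <= M -> opn_le M S X ->
  l2norm (\sum_(i in S) dot (obs X i) b *: obs X i) <= M * n%:R * l2norm b.
Proof.
move=> M0 h; rewrite -ler_sqr ?nnegrE ?mulr_ge0 ?l2norm_ge0//.
apply: (le_trans (opn_comb _ M0 h)).
apply: (le_trans (ler_wpM2l (mulr_ge0 M0 (ler0n _ _)) (h b))).
by rewrite le_eqVlt; apply/orP; left; apply/eqP; ring.
Qed.

Section Bounds.
Variables (K : nat) (Delta M : R).
Hypothesis n0 : (0 < n)%N.
Hypothesis M0 : 0 <= M.
Hypothesis delta0 : forall k, (k < K)%N -> 0 <= delta k.
Hypothesis deltaS : forall k, (k <= K)%N -> \sum_(0 <= s < k) delta s <= Delta.

Let nR0 : 0 < n%:R :> R. Proof. by rewrite ltr0n. Qed.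

Let Delta0 : 0 <= Delta.
Proof. by have := deltaS (leq0n K); rewrite big_geq. Qed.

Let sqrt_comb S X (a : 'I_n -> R) : opn_le M S X ->
  l2norm (\sum_(i in S) a i *: obs X i) / n%:R <=
  Num.sqrt (M * n%:R * \sum_(i in S) a i ^+ 2) / n%:R.
Proof.
move=> h; rewrite ler_pM2r ?invr_gt0//.
rewrite -(ger0_norm (l2norm_ge0 _)) -sqrtr_sqr ler_wsqrtr//.
exact: opn_comb.
Qed.

(** Gronwall with the linear part of the gradient as growth and the responses as constant
    forcing. *)
Lemma gdm_norm S X Y b0 k : opn_le M S X -> (k <= K)%N ->
  l2norm (gdm S X Y b0 k) <=
  expR (M * Delta) *
  (l2norm b0 + Delta * (Num.sqrt (M * n%:R * \sum_(i in S) Y i 0 ^+ 2) / n%:R)).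
Proof.
move=> h kK; set c := _ / n%:R.
have c0 : 0 <= c by rewrite divr_ge0 ?sqrtr_ge0.
apply: (le_trans (discrete_Gronwall (a := fun k => l2norm (gdm S X Y b0 k))
  M0 delta0 (fun _ => c0) (l2norm_ge0 _) _ kK)).
  move=> j jK /=.
  set b := gdm S X Y b0 j.
  apply: (le_trans (l2normD _ _)); rewrite l2normZ ger0_norm ?divr_ge0 ?delta0//.
  have -> : \sum_(i in S) (Y i 0 - dot (obs X i) b) *: obs X i =
     \sum_(i in S) Y i 0 *: obs X i - \sum_(i in S) dot (obs X i) b *: obs X i.
    by rewrite -sumrB; apply: eq_bigr => i _; rewrite scalerBl.
  rewrite mulrDl mul1r -addrA lerD2l -!mulrA -mulrDr ler_wpM2l ?delta0//.
  rewrite ler_pdivrMl// mulrDr.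
  apply: (le_trans (l2normD _ _)); rewrite l2normN addrC.
  apply: lerD; first by rewrite mulrA (mulrC n%:R); exact: opn_grad.
  by rewrite -ler_pdivrMl// mulrC; exact: sqrt_comb.
have [s0 sD] : 0 <= \sum_(0 <= s < k) delta s /\ \sum_(0 <= s < k) delta s <= Delta.
  split; last exact: deltaS.
  rewrite big_nat_cond sumr_ge0// => i /andP[/andP[_ ik] _].
  by apply: delta0; apply: leq_trans kK.
apply: ler_pM => //.
- rewrite addr_ge0 ?l2norm_ge0// -mulr_suml mulr_ge0//.
- by rewrite ler_expR ler_wpM2l.
- by rewrite /= lerD2l -mulr_suml ler_wpM2r.
Qed.

Lemma gdm_norm8 S X Y b0 k : opn_le M S X -> (k <= K)%N ->
  l2norm (gdm S X Y b0 k) ^+ 8 <=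
  expR (M * Delta) ^+ 8 * (128 * (l2norm b0 ^+ 8 +
    Delta ^+ 8 * (M ^+ 4 / n%:R * \sum_i Y i 0 ^+ 8))).
Proof.
move=> h kK.
set q := Num.sqrt (M * n%:R * \sum_(i in S) Y i 0 ^+ 2) / n%:R.
have q0 : 0 <= q by rewrite divr_ge0 ?sqrtr_ge0.
have q8 : q ^+ 8 <= M ^+ 4 / n%:R * \sum_i Y i 0 ^+ 8.
  rewrite /q exprMn (exprM _ 2 4) sqr_sqrtr; last first.
    by rewrite !mulr_ge0// sumr_ge0// => i _; exact: sqr_ge0.
  have S4 : (\sum_(i in S) Y i 0 ^+ 2) ^+ 4 <= n%:R ^+ 3 * \sum_i Y i 0 ^+ 8.
    have := sum_pow4 (fun _ : 'I_n => true) (fun i => Y i 0 ^+ 2).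
    rewrite card_ord; under [X in _ <= _ * X -> _]eq_bigr do rewrite -exprM.
    apply: le_trans.
    have SY (A : pred 'I_n) : 0 <= \sum_(i | A i) Y i 0 ^+ 2.
      by apply: sumr_ge0 => i _; exact: sqr_ge0.
    rewrite lerXn2r ?nnegrE//.
    by rewrite [leRHS](bigID (mem S)) /= lerDl.
  have -> : M ^+ 4 / n%:R * \sum_i Y i 0 ^+ 8 =
     (M * n%:R) ^+ 4 * (n%:R ^+ 3 * \sum_i Y i 0 ^+ 8) * n%:R^-1 ^+ 8.
    by field; rewrite gt_eqF.
  rewrite exprMn ler_wpM2r ?exprn_ge0 ?invr_ge0// ler_wpM2l//.
  by rewrite exprn_ge0// mulr_ge0.
apply: (@le_trans _ _ ((expR (M * Delta) * (l2norm b0 + Delta * q)) ^+ 8)).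
  rewrite lerXn2r ?nnegrE ?l2norm_ge0 ?mulr_ge0 ?expR_ge0 ?addr_ge0 ?l2norm_ge0//.
    exact: mulr_ge0.
  exact: gdm_norm.
rewrite exprMn ler_wpM2l ?exprn_ge0 ?expR_ge0//.
apply: (le_trans (pow8_add _ _)); rewrite ler_wpM2l// lerD2l exprMn ler_wpM2l//.
exact: exprn_ge0.
Qed.

(** The difference of the two recursions is driven by the residuals of the observations in
    [S :\: S']. They are evaluated at the iterate on the smaller set [S'], which does not involve
    those observations; under the probability model each residual thus pairs an observation with an
    iterate independent of it, and its moments can be computed. *)
Lemma gdm_diff S S' X Y b0 k : opn_le M S X -> S' \subset S -> (k <= K)%N ->
  l2norm (gdm S X Y b0 k - gdm S' X Y b0 k) <=
  expR (M * Delta) * \sum_(0 <= s < k) delta s *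
    (Num.sqrt (M * n%:R * \sum_(i in S :\: S')
       (Y i 0 - dot (obs X i) (gdm S' X Y b0 s)) ^+ 2) / n%:R).
Proof.
move=> h sub kK; pose c s := Num.sqrt (M * n%:R * \sum_(i in S :\: S')
       (Y i 0 - dot (obs X i) (gdm S' X Y b0 s)) ^+ 2) / n%:R.
have c0 s : 0 <= c s by rewrite divr_ge0 ?sqrtr_ge0.
apply: (le_trans (discrete_Gronwall
  (a := fun k => l2norm (gdm S X Y b0 k - gdm S' X Y b0 k))
  M0 delta0 c0 (l2norm_ge0 _) _ kK)).
  move=> j jK /=.
  set b := gdm S X Y b0 j; set b' := gdm S' X Y b0 j.
  have -> : b + (delta j / n%:R) *: (\sum_(i in S) (Y i 0 - dot (obs X i) b) *: obs X i)
    - (b' + (delta j / n%:R) *: (\sum_(i in S') (Y i 0 - dot (obs X i) b') *: obs X i)) =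
    (b - b') + (delta j / n%:R) *:
      (\sum_(i in S :\: S') (Y i 0 - dot (obs X i) b') *: obs X i -
       \sum_(i in S) dot (obs X i) (b - b') *: obs X i).
    rewrite opprD addrACA -scalerBr; congr (_ + _ *: _).
    have E : \sum_(i in S) (Y i 0 - dot (obs X i) b) *: obs X i =
        \sum_(i in S) (Y i 0 - dot (obs X i) b') *: obs X i -
        \sum_(i in S) dot (obs X i) (b - b') *: obs X i.
      rewrite -sumrB; apply: eq_bigr => i _.
      by rewrite -scalerBl dotBr; congr (_ *: _); ring.
    rewrite E addrAC; congr (_ - _).
    by rewrite (big_setID S') /= (finset.setIidPr sub) addrC addKr.
  apply: (le_trans (l2normD _ _)); rewrite l2normZ ger0_norm ?divr_ge0 ?delta0//.
  rewrite mulrDl mul1r -addrA lerD2l -!mulrA -mulrDr ler_wpM2l ?delta0//.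
  rewrite ler_pdivrMl// mulrDr.
  apply: (le_trans (l2normD _ _)); rewrite l2normN addrC.
  apply: lerD; first by rewrite mulrA (mulrC n%:R); exact: opn_grad.
  rewrite -ler_pdivrMl// mulrC; apply: sqrt_comb.
  by apply: opn_leS h; exact: subsetDl.
rewrite /= subrr l2norm0 add0r ler_wpM2r//.
  rewrite big_nat_cond sumr_ge0// => i /andP[/andP[_ ik] _]; rewrite mulr_ge0//.
  by apply: delta0; apply: leq_trans kK.
by rewrite ler_expR ler_wpM2l// deltaS.
Qed.

(** Jensen with the step sizes as weights: their total is at most [Delta], so the eighth power costs
    [Delta ^+ 7] and no power of the number of steps. *)
Lemma gdm_diff8 S S' X Y b0 k : opn_le M S X -> S' \subset S -> (k <= K)%N ->
  l2norm (gdm S X Y b0 k - gdm S' X Y b0 k) ^+ 8 <=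
  expR (M * Delta) ^+ 8 * (Delta ^+ 7 * (M ^+ 4 / n%:R ^+ 4 * #|S :\: S'|%:R ^+ 3 *
    \sum_(0 <= s < k) delta s * \sum_(i in S :\: S')
       (Y i 0 - dot (obs X i) (gdm S' X Y b0 s)) ^+ 8)).
Proof.
move=> h sub kK; set T := S :\: S'.
pose r s i := Y i 0 - dot (obs X i) (gdm S' X Y b0 s).
pose c s := Num.sqrt (M * n%:R * \sum_(i in T) r s i ^+ 2) / n%:R.
have c0 s : 0 <= c s by rewrite divr_ge0 ?sqrtr_ge0.
have c8 s : c s ^+ 8 <= M ^+ 4 / n%:R ^+ 4 * #|T|%:R ^+ 3 * \sum_(i in T) r s i ^+ 8.
  rewrite /c exprMn (exprM _ 2 4) sqr_sqrtr; last first.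
    by rewrite !mulr_ge0// sumr_ge0// => i _; exact: sqr_ge0.
  have S4 : (\sum_(i in T) r s i ^+ 2) ^+ 4 <= #|T|%:R ^+ 3 * \sum_(i in T) r s i ^+ 8.
    have := sum_pow4 (mem T) (fun i => r s i ^+ 2).
    by under [X in _ <= _ * X -> _]eq_bigr do rewrite -exprM.
  have -> : M ^+ 4 / n%:R ^+ 4 * #|T|%:R ^+ 3 * \sum_(i in T) r s i ^+ 8 =
    (M * n%:R) ^+ 4 * (#|T|%:R ^+ 3 * \sum_(i in T) r s i ^+ 8) * n%:R^-1 ^+ 8.
    by field; rewrite gt_eqF.
  rewrite exprMn ler_wpM2r ?exprn_ge0 ?invr_ge0// ler_wpM2l//.
  by rewrite exprn_ge0// mulr_ge0.
have d0 s : (s < k)%N -> 0 <= delta s by move=> sk; apply: delta0; apply: leq_trans kK.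
pose W := \sum_(0 <= s < k) delta s * c s.
have W0 : 0 <= W.
  by rewrite /W big_nat_cond sumr_ge0// => s /andP[/andP[_ sk] _]; rewrite mulr_ge0 ?d0.
apply: (@le_trans _ _ ((expR (M * Delta) * W) ^+ 8)).
  rewrite lerXn2r ?nnegrE ?l2norm_ge0 ?mulr_ge0 ?expR_ge0//.
  exact: gdm_diff.
rewrite exprMn ler_wpM2l ?exprn_ge0 ?expR_ge0//.
have J : W ^+ 8 <= (\sum_(0 <= s < k) delta s) ^+ 7 * \sum_(0 <= s < k) delta s * c s ^+ 8.
  rewrite /W !big_mkord.
  exact: (sum_jensen_pow8 (index_enum 'I_k) (P := predT) (w := fun s : 'I_k => delta s)
    (fun s : 'I_k => c s) (fun s _ => d0 s (ltn_ord s))).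
apply: (le_trans J).
have sd0 : 0 <= \sum_(0 <= s < k) delta s.
  by rewrite big_nat_cond sumr_ge0// => s /andP[/andP[_ sk] _]; exact: d0.
apply: ler_pM; rewrite ?exprn_ge0//.
- rewrite big_nat_cond sumr_ge0// => s /andP[/andP[_ sk] _].
  by rewrite mulr_ge0 ?d0 ?exprn_ge0.
- by rewrite lerXn2r ?nnegrE// deltaS.
- rewrite mulr_sumr big_nat_cond [leRHS]big_nat_cond ler_sum// => s /andP[/andP[_ sk] _].
  by rewrite [leRHS]mulrCA ler_wpM2l ?d0.
Qed.

End Bounds.
End MaskedGD.

(** * A net of the unit ball *)

Section Net.
Context {R : realType}.

Section Grid.
Variable d : nat.
Let h : R := (2 * Num.sqrt d%:R)^-1.
Let m := (2 * d)%N.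

(* Lattice points of step [h]; a coordinate is stored as absolute value and sign. *)
Definition grid_point (c : {ffun 'I_d -> 'I_m.+1 * bool}) : 'cV[R]_d :=
  \col_j (h * ((-1) ^+ (c j).2 * ((c j).1 : nat)%:R)).

(** This is the condition of lying in the unit ball, in integer coordinates: [h ^ 2 = 1 / (4 d)]. *)
Definition grid_admissible (c : {ffun 'I_d -> 'I_m.+1 * bool}) : bool :=
  (\sum_j ((c j).1 : nat) ^ 2 <= 4 * d)%N.

(* Every admissible point has weight at least one for the product of the weights
   [g], and the total weight is at most [64 ^ d]. *)
Lemma card_grid_admissible : (#|grid_admissible| <= 64 ^ d)%N.
Proof.
(* Admissibility bounds the sum of squares, hence the sum of absolute values, by [4 * d], and
   [16 ^ d = 2 ^ (4 * d)] offsets the halvings. Summing over both signs and all absolute values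
   gives at most [2 * 16 * 2 = 64] per coordinate. *)
pose g (k : 'I_m.+1 * bool) : R := 16 * 2^-1 ^+ (k.1 : nat).
have g0 k : 0 <= g k by rewrite mulr_ge0// exprn_ge0// invr_ge0.
have gS : \sum_k g k <= 64.
  rewrite -(pair_bigA _ (fun (a : 'I_m.+1) (b : bool) => g (a, b))) /=.
  under eq_bigr do rewrite big_bool /g /=.
  have -> : \sum_(i < m.+1) (16 * 2^-1 ^+ i + 16 * 2^-1 ^+ i) =
      32 * \sum_(i < m.+1) (2^-1 : R) ^+ i.
    by rewrite mulr_sumr; apply: eq_bigr => i _; ring.
  suff : \sum_(i < m.+1) (2^-1 : R) ^+ i <= 2 by lra.
  elim: m => [|k IH]; first by rewrite big_ord_recl big_ord0; lra.
  rewrite big_ord_recl /=.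
  have -> : \sum_(i < k.+1) (2^-1 : R) ^+ bump 0 i = 2^-1 * \sum_(i < k.+1) (2^-1 : R) ^+ i.
    by rewrite mulr_sumr; apply: eq_bigr => i _; rewrite -exprS.
  by rewrite expr0; lra.
have cg c : grid_admissible c -> 1 <= \prod_j g (c j).
  move=> adm; rewrite /g big_split /= prodr_const card_ord prodrXr.
  have le4 : (\sum_j ((c j).1 : nat) <= 4 * d)%N.
    apply: leq_trans adm; apply: leq_sum => j _.
    by case: ((c j).1 : nat) => // k; rewrite expnS expn1 leq_pmulr.
  have -> : 16 ^+ d = 2 ^+ (4 * d) :> R by rewrite exprM; congr (_ ^+ d); ring.
  by rewrite exprVn ler_pdivlMr ?exprn_gt0// mul1r ler_weXn2l// ler1n.
rewrite -(ler_nat R) natrX.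
apply: (@le_trans _ _ (\sum_(c : {ffun 'I_d -> 'I_m.+1 * bool}) \prod_j g (c j))).
  rewrite (bigID grid_admissible) /= -[leLHS]addr0 lerD//; last first.
    by apply: sumr_ge0 => c _; exact: prodr_ge0.
  rewrite -sum1_card natr_sum; apply: ler_sum => c adm; exact: cg.
rewrite -(bigA_distr_bigA (fun _ : 'I_d => g)) /=.
rewrite prodr_const card_ord lerXn2r ?nnegrE// sumr_ge0//.
Qed.

Lemma grid_point_norm c : (0 < d)%N -> grid_admissible c -> l2norm (grid_point c) <= 1.
Proof.
move=> d0 adm; rewrite -[leRHS]sqrtr1 ler_wsqrtr//.
have E j : grid_point c j 0 ^+ 2 = (4 * d%:R)^-1 * (((c j).1 : nat) ^ 2)%:R.
  rewrite mxE exprMn exprMn -exprM mulnC exprM sqrrN expr1n expr1n mul1r natrX.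
  by rewrite /h exprVn exprMn sqr_sqrtr// (_ : 2 ^+ 2 = 4 :> R)//; ring.
under eq_bigr do rewrite E.
rewrite -mulr_sumr -natr_sum mulrC ler_pdivrMr ?mulr_gt0 ?ltr0n//.
by rewrite mul1r -natrM ler_nat.
Qed.

(** Coordinates are rounded towards zero: this cannot increase the norm, so the grid point stays
    admissible, and it errs by at most [h] in each coordinate, in total by [h] times the square root
    of [d], which is one half. *)
Lemma grid_approx (w : 'cV[R]_d) : (0 < d)%N -> l2norm w <= 1 ->
  exists2 c, grid_admissible c & l2norm (w - grid_point c) <= 1 / 2.
Proof.
move=> d0 w1.
have sd0 : 0 < Num.sqrt d%:R :> R by rewrite sqrtr_gt0 ltr0n.
have h0 : 0 < h by rewrite invr_gt0 mulr_gt0.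
have w2 : \sum_j w j 0 ^+ 2 <= 1.
  have : l2norm w ^+ 2 <= 1 by rewrite expr_le1 ?l2norm_ge0.
  by rewrite sqr_l2norm; apply: le_trans; rewrite le_eqVlt; apply/orP; left; apply/eqP;
    apply: eq_bigr => j _; rewrite expr2.
pose k j : nat := Num.truncn (`|w j 0| / h).
have kb j : (k j)%:R <= `|w j 0| / h < (k j)%:R + 1.
  by rewrite natr1; apply: truncn_itv; rewrite divr_ge0// ltW.
have h2 : h ^+ 2 = (4 * d%:R)^-1.
  by rewrite /h exprVn exprMn sqr_sqrtr// (_ : 2 ^+ 2 = 4 :> R)//; ring.
have k2 j : (k j)%:R ^+ 2 <= 4 * d%:R * w j 0 ^+ 2 :> R.
  have /andP[kb1 _] := kb j.
  have : (k j)%:R ^+ 2 <= (`|w j 0| / h) ^+ 2 by rewrite ler_sqr ?nnegrE// divr_ge0// ltW.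
  by rewrite exprMn exprVn h2 invrK real_normK ?num_real// mulrC.
have S2 : (\sum_j k j ^ 2 <= 4 * d)%N.
  rewrite -(ler_nat R) natr_sum natrM.
  apply: (@le_trans _ _ (\sum_j 4 * d%:R * w j 0 ^+ 2)).
    by apply: ler_sum => j _; rewrite natrX.
  by rewrite -mulr_sumr ler_piMr// mulr_ge0.
have km j : (k j < m.+1)%N.
  rewrite ltnS /m -leq_sqr.
  have : (k j ^ 2 <= 4 * d)%N.
    by apply: leq_trans S2; rewrite (bigD1 j) //= leq_addr.
  move=> /leq_trans; apply; nia.
pose c := [ffun j => (Ordinal (km j), w j 0 < 0)].
exists c.
  by rewrite /grid_admissible; under eq_bigr do rewrite ffunE.
rewrite (_ : 1 / 2 = Num.sqrt (2^-1 ^+ 2)); last by rewrite sqrtr_sqr ger0_norm; lra.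
rewrite ler_wsqrtr//.
have E j : (w - grid_point c) j 0 ^+ 2 <= h ^+ 2.
  rewrite !mxE ffunE /=.
  have /andP[kb1 kb2] := kb j.
  rewrite ler_pdivlMr// in kb1; rewrite ltr_pdivrMr// in kb2.
  rewrite -(real_normK (num_real (_ - _))) ler_sqr ?nnegrE//; last exact: ltW.
  rewrite ler_norml; case: ltP => w0.
    by rewrite ltr0_norm// in kb1 kb2; rewrite expr1; apply/andP; split; nra.
  by rewrite ger0_norm// in kb1 kb2; rewrite expr0; apply/andP; split; nra.
apply: (@le_trans _ _ (\sum_(j < d) h ^+ 2)); first by apply: ler_sum.
rewrite sumr_const card_ord h2 -[X in X <= _]mulr_natr.
by rewrite le_eqVlt; apply/orP; left; apply/eqP; field; rewrite pnatr_eq0 -lt0n.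
Qed.

End Grid.

Definition net (d : nat) : seq 'cV[R]_d :=
  [seq grid_point c | c <- enum (@grid_admissible d)].

Lemma size_net d : (size (net d) <= 64 ^ d)%N.
Proof. by rewrite size_map -cardE; exact: card_grid_admissible. Qed.

Lemma net_norm d v : (0 < d)%N -> v \in net d -> l2norm v <= 1.
Proof.
by move=> d0 /mapP[c]; rewrite mem_enum => adm ->; exact: grid_point_norm.
Qed.

Lemma net_approx d (w : 'cV[R]_d) : (0 < d)%N -> l2norm w <= 1 ->
  exists2 v, v \in net d & l2norm (w - v) <= 1 / 2.
Proof.
move=> d0 w1; have [c adm cw] := grid_approx d0 w1.
by exists (grid_point c) => //; apply/mapP; exists c; rewrite ?mem_enum.
Qed.

(** The norm of [y] is its inner product with its own direction. Replacing that direction by a net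
    point at distance at most one half loses at most half of the norm. *)
Lemma net_dual n (y : 'cV[R]_n) (tau : R) : (0 < n)%N -> 0 <= tau ->
  (forall u, u \in net n -> dot u y <= tau) -> l2norm y <= 2 * tau.
Proof.
move=> n0 t0 H.
have [y0|y0] := eqVneq (l2norm y) 0; first by rewrite y0 mulr_ge0.
have yp : 0 < l2norm y by rewrite lt_def y0 l2norm_ge0.
pose w := (l2norm y)^-1 *: y.
have w1 : l2norm w <= 1 by rewrite l2normZ ger0_norm ?invr_ge0 ?l2norm_ge0// mulVf.
have [u uN uw] := net_approx n0 w1.
have E1 : dot y w = l2norm y by rewrite dotZr -sqr_l2norm expr2 mulrA mulVf// mul1r.
have E2 : dot y w = dot u y + dot y (w - u) by rewrite dotBr (dotC u); ring.
have := H u uN; have := dot_Cauchy_Schwarz y (w - u); have := ler_norm (dot y (w - u)).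
have : l2norm y * l2norm (w - u) <= l2norm y * (1 / 2) by rewrite ler_wpM2l ?l2norm_ge0.
rewrite E1 in E2; lra.
Qed.

(** The supremum bounds itself: approximation within one half gives [sup E <= tau + sup E / 2]. The
    Frobenius bound comes first because absorbing a supremum presupposes that it is finite. *)
Lemma net_opnorm n d (A : 'M[R]_(n, d)) (tau : R) : (0 < d)%N -> 0 <= tau ->
  (forall v, v \in net d -> l2norm (A *m v) <= tau) ->
  forall w, l2norm (A *m w) <= 2 * tau * l2norm w.
Proof.
move=> d0 t0 H.
pose F := Num.sqrt (\sum_i l2norm (row i A)^T ^+ 2).
have bnd w : l2norm (A *m w) <= F * l2norm w.
  rewrite -ler_sqr ?nnegrE ?mulr_ge0 ?l2norm_ge0 ?sqrtr_ge0// exprMn.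
  rewrite sqr_sqrtr; last by apply: sumr_ge0 => i _; exact: sqr_ge0.
  rewrite sqr_sqrtr; last by apply: sumr_ge0 => i _; exact: sqr_ge0.
  rewrite mulr_suml; apply: ler_sum => i _.
  have -> : (A *m w) i 0 = dot (row i A)^T w.
    by rewrite mxE; apply: eq_bigr => j _; rewrite !mxE.
  rewrite -exprMn -(real_normK (num_real (dot _ _))) ler_sqr ?nnegrE ?mulr_ge0 ?l2norm_ge0//.
  exact: dot_Cauchy_Schwarz.
pose E := [set l2norm (A *m w) | w in [set w | l2norm w <= 1]].
have E0 : E 0 by exists 0; rewrite /= ?l2norm0// mulmx0 l2norm0.
have Eb : has_ubound E.
  exists F => _ [w /= w1 <-]; apply: (le_trans (bnd w)).
  by rewrite ler_piMr// sqrtr_ge0.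
have hs : has_sup E by split => //; exists 0.
have s0 : 0 <= sup E by exact: sup_upper_bound E0.
have ub w : l2norm (A *m w) <= sup E * l2norm w.
  have [w0|w0] := eqVneq (l2norm w) 0.
    by rewrite (l2norm_eq0 w0) mulmx0 !l2norm0 mulr0.
  have wp : 0 < l2norm w by rewrite lt_def w0 l2norm_ge0.
  rewrite -ler_pdivrMr//.
  apply: sup_upper_bound => //; exists ((l2norm w)^-1 *: w) => /=.
    by rewrite l2normZ ger0_norm ?invr_ge0 ?l2norm_ge0// mulVf.
  by rewrite -scalemxAr l2normZ ger0_norm ?invr_ge0 ?l2norm_ge0// mulrC.
have sE : sup E <= tau + sup E / 2.
  apply: ge_sup; first by exists 0.
  move=> _ [w /= w1 <-].
  have [v vN vw] := net_approx d0 w1.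
  rewrite -[w in A *m w](subrK v) addrC mulmxDr; apply: (le_trans (l2normD _ _)).
  apply: lerD; first exact: H.
  by apply: (le_trans (ub _)); rewrite ler_wpM2l//; lra.
move=> w; apply: (le_trans (ub w)); rewrite ler_wpM2r ?l2norm_ge0//; lra.
Qed.

Lemma net_opn_le n d (S : {set 'I_n}) (X : 'M[R]_(n, d)) (C : R) : (0 < d)%N -> 0 <= C ->
  (forall v, v \in net d -> \sum_(i in S) dot (obs X i) v ^+ 2 <= C * n%:R) ->
  opn_le (4 * C) S X.
Proof.
move=> d0 C0 H b.
(* Rows outside [S] are set to zero so that the bound for a full matrix applies; its factor 2
   becomes the factor 4 after squaring. *)
pose A : 'M[R]_(n, d) := \matrix_(i, j) (if i \in S then X i j else 0).
have AE v : l2norm (A *m v) ^+ 2 = \sum_(i in S) dot (obs X i) v ^+ 2.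
  rewrite sqr_sqrtr; last by apply: sumr_ge0 => i _; exact: sqr_ge0.
  rewrite [RHS]big_mkcond; apply: eq_bigr => i _; rewrite mxE.
  case: ifP => iS.
    by congr (_ ^+ 2); apply: eq_bigr => j _; rewrite !mxE iS.
  by rewrite big1 ?expr0n// => j _; rewrite mxE iS mul0r.
have Cn : 0 <= C * n%:R by rewrite mulr_ge0.
have := @net_opnorm n d A (Num.sqrt (C * n%:R)) d0 (sqrtr_ge0 _) _ b.
move=> /(_ _)/wrap[].
  move=> v vN; rewrite -(ger0_norm (l2norm_ge0 _)) -sqrtr_sqr ler_wsqrtr// AE.
  exact: H.
move=> h; rewrite -AE.
apply: (@le_trans _ _ ((2 * Num.sqrt (C * n%:R) * l2norm b) ^+ 2)).
  by rewrite ler_sqr ?nnegrE ?mulr_ge0 ?l2norm_ge0 ?sqrtr_ge0.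
rewrite !exprMn sqr_sqrtr//.
by rewrite le_eqVlt; apply/orP; left; apply/eqP; ring.
Qed.

End Net.

Lemma pow8_ge0 {R : realDomainType} (x : R) : 0 <= x ^+ 8.
Proof. by rewrite (exprM _ 2 4) exprn_ge0// sqr_ge0. Qed.

Lemma normr_pow8 {R : realDomainType} (x : R) : `|x| ^+ 8 = x ^+ 8.
Proof. by rewrite (exprM _ 2 4) real_normK ?num_real// -exprM. Qed.

(** * Measurability of the iterates and Markov's inequality *)

Section Measurability.
Context {R : realType} {disp : measure_display} {T : measurableType disp}.

Lemma measurable_bigsum (I : Type) (s : seq I) (P : pred I) (f : I -> T -> R) :
  (forall i, P i -> measurable_fun setT (f i)) ->
  measurable_fun setT (fun w => \sum_(i <- s | P i) f i w).
Proof.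
move=> mf; elim: s => [|i s IH].
  rewrite (_ : (fun w => _) = cst 0); first exact: measurable_cst.
  by apply/funext => w; rewrite big_nil.
rewrite (_ : (fun w => _) = (fun w => (if P i then f i w else 0) +
    \sum_(i <- s | P i) f i w)).
  apply: measurable_funD => //.
  by case Pi: (P i); [exact: mf | exact: measurable_cst].
by apply/funext => w; rewrite big_cons; case: ifP => // _; rewrite add0r.
Qed.

Lemma measurable_dot d (u v : T -> 'cV[R]_d) :
  (forall j, measurable_fun setT (fun w => u w j 0)) ->
  (forall j, measurable_fun setT (fun w => v w j 0)) ->
  measurable_fun setT (fun w => dot (u w) (v w)).
Proof. by move=> mu mv; apply: measurable_bigsum => j _; exact: measurable_funM. Qed.

Lemma measurable_l2norm d (v : T -> 'cV[R]_d) :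
  (forall j, measurable_fun setT (fun w => v w j 0)) ->
  measurable_fun setT (fun w => l2norm (v w)).
Proof.
move=> mv; rewrite (_ : (fun w => _) = fun w => (dot (v w) (v w)) `^ 2^-1).
  apply: (measurableT_comp (@measurable_powR R 2^-1)).
  exact: measurable_dot.
apply/funext => w; rewrite -sqr_l2norm -powR_mulrn ?l2norm_ge0//.
by rewrite -powRrM mulfV// powRr1// l2norm_ge0.
Qed.

Lemma measurable_gdm n d (delta : nat -> R) (X : T -> 'M[R]_(n, d))
    (Y : T -> 'cV[R]_n) (S : {set 'I_n}) (b0 : 'cV[R]_d) k :
  (forall i j, i \in S -> measurable_fun setT (fun w => X w i j)) ->
  (forall i, i \in S -> measurable_fun setT (fun w => Y w i 0)) ->
  forall j, measurable_fun setT (fun w => gdm delta S (X w) (Y w) b0 k j 0).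
Proof.
move=> mX mY; elim: k => [|k IH] j /=; first exact: measurable_cst.
under eq_fun do rewrite !mxE.
apply: measurable_funD => //; apply: measurable_funM => //.
under eq_fun do rewrite summxE.
apply: measurable_bigsum => i iS.
under eq_fun do rewrite !mxE.
apply: measurable_funM; last exact: mX.
apply: measurable_funB; first exact: mY.
apply: measurable_dot => // l.
by under eq_fun do rewrite !mxE; exact: mX.
Qed.

Lemma measurable_le_set (f g : T -> R) :
  measurable_fun setT f -> measurable_fun setT g -> measurable [set w | f w <= g w].
Proof.
move=> mf mg; have := @measurable_fun_ler _ _ _ setT f g mf mg.
by move=> /(_ measurableT [set true] I); rewrite setTI.
Qed.

Lemma measurable_lt_set (f g : T -> R) :
  measurable_fun setT f -> measurable_fun setT g -> measurable [set w | f w < g w].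
Proof.
move=> mf mg; have := @measurable_fun_ltr _ _ _ setT f g mf mg.
by move=> /(_ measurableT [set true] I); rewrite setTI.
Qed.

Lemma markov_real (P : probability T R) (f : T -> R) (a : R) : 0 < a ->
  measurable_fun setT f -> (forall w, 0 <= f w) ->
  (P [set w | (a <= f w)%R] <= a^-1%:E * \int[P]_w (f w)%:E)%E.
Proof.
move=> a0 mf f0.
have mA : measurable [set w | a <= f w] by apply: measurable_le_set.
have -> : (P [set w | (a <= f w)%R] = \int[P]_w (\1_[set w | (a <= f w)%R] w)%:E)%E.
  by rewrite integral_indic// setIT.
rewrite -ge0_integralZl_EFin//; last 3 first.
- by move=> w _; rewrite lee_fin.
- exact/measurable_EFinP.
- by rewrite invr_ge0 ltW.
apply: ge0_le_integral => //.
- by apply/measurable_EFinP; exact: measurable_indic.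
- by apply/measurable_EFinP; exact: measurable_funM.
- move=> w _; rewrite -EFinM lee_fin indicE.
  have [/set_mem /= h|_] := boolP (w \in [set w | a <= f w]).
    by rewrite ler_pdivlMl// mulr1.
  by rewrite mulr_ge0// invr_ge0 ltW.
Qed.

(** For [t >= 0], raise [t / 8 <= expR (t / 8)] to the eighth power; the two exponentials cover both
    signs of [x]. *)
Lemma pow8_le_expR (x : R) : x ^+ 8 <= 8 ^+ 8 * (expR x + expR (- x)).
Proof.
have H (t : R) : 0 <= t -> t ^+ 8 <= 8 ^+ 8 * expR t.
  move=> t0; have := @expR_ge1Dx R (t / 8) => h.
  have h1 : t <= 8 * expR (t / 8) by lra.
  apply: (@le_trans _ _ ((8 * expR (t / 8)) ^+ 8)).
    by rewrite lerXn2r ?nnegrE// mulr_ge0// expR_ge0.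
  by rewrite exprMn ler_wpM2l ?exprn_ge0// -expRM_natl -mulr_natl mulrCA mulfV ?mulr1// pnatr_eq0.
have [x0|/ltW x0] := leP 0 x.
  by apply: (le_trans (H x x0)); rewrite ler_wpM2l ?exprn_ge0// lerDl expR_ge0.
have := H (- x); rewrite oppr_ge0 -(normr_pow8 (- x)) normrN normr_pow8 => /(_ x0) h.
apply: (le_trans h).
by rewrite ler_wpM2l ?exprn_ge0// lerDr expR_ge0.
Qed.

End Measurability.

(** * Moments of the iterates *)

Section SampleLaw.
Context {R : realType} {d : nat}.
Notation sample := (borelType ('cV[R]_d * R)%type).
Variable Q : probability sample R.
Variable c : R.
Hypothesis c0 : 0 <= c.
Hypothesis Qmgf : forall v : 'cV[R]_d,
  (\int[Q]_e (expR (dot e.1 v))%:E <= (expR (l2norm v + c * l2norm v ^+ 2))%:E)%E.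

Lemma measurable_sample_dot (v : 'cV[R]_d) :
  measurable_fun setT (fun e : sample => dot e.1 v).
Proof. by apply: measurable_dot => // j; exact: measurable_fst_coord. Qed.

Lemma measurable_sample_snd : measurable_fun setT (fun e : sample => e.2).
Proof. exact: (@measurable_snd_real R 'cV[R]_d). Qed.

(** At a unit vector the Laplace bound is [expR (1 + c)]. The factor 2 counts the vector and its
    opposite, and [8 ^+ 8] is the price of comparing an eighth power with exponentials. *)
Definition moment8 : R := 8 ^+ 8 * (2 * expR (1 + c)).

Lemma moment8_ge0 : 0 <= moment8.
Proof. by rewrite !mulr_ge0 ?exprn_ge0// expR_ge0. Qed.

(** Both sides are homogeneous of degree eight in [v], so the Laplace bound is only used at the unit
    vector along [v] and at its opposite. *)
Lemma sample_dot8 (v : 'cV[R]_d) :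
  (\int[Q]_e (dot e.1 v ^+ 8)%:E <= (moment8 * l2norm v ^+ 8)%:E)%E.
Proof.
have [v0|v0] := eqVneq (l2norm v) 0.
  rewrite (l2norm_eq0 v0) l2norm0 expr0n /= mulr0.
  under eq_integral => e _ do rewrite dot0r expr0n /=.
  by rewrite integral0.
have vp : 0 < l2norm v by rewrite lt_def v0 l2norm_ge0.
pose u := (l2norm v)^-1 *: v.
have u1 : l2norm u = 1 by rewrite l2normZ ger0_norm ?invr_ge0 ?l2norm_ge0// mulVf.
have mexp (s : R) : measurable_fun setT (fun e : sample => (expR (dot e.1 (s *: u)))%:E).
  apply/measurable_EFinP; apply: measurableT_comp => //; exact: measurable_sample_dot.
have Qu (s : R) : `|s| = 1 ->
    (\int[Q]_e (expR (dot e.1 (s *: u)))%:E <= (expR (1 + c))%:E)%E.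
  by move=> s1; apply: (le_trans (Qmgf _)); rewrite l2normZ s1 u1 mulr1 expr1n mulr1.
apply: (@le_trans _ _ (\int[Q]_e ((l2norm v ^+ 8 * 8 ^+ 8)%:E *
   ((expR (dot e.1 (1 *: u)))%:E + (expR (dot e.1 (-1 *: u)))%:E)))%E).
  apply: ge0_le_integral => //.
  - by move=> e _; rewrite lee_fin pow8_ge0.
  - apply/measurable_EFinP; apply: measurable_funX; exact: measurable_sample_dot.
  - by apply: emeasurable_funM => //; exact: emeasurable_funD.
  - move=> e _; rewrite -EFinD -EFinM lee_fin -mulrA.
    have -> : dot e.1 v = l2norm v * dot e.1 u by rewrite -dotZr scalerA mulfV// scale1r.
    rewrite exprMn ler_wpM2l ?exprn_ge0 ?l2norm_ge0//.
    by rewrite !dotZr mul1r mulN1r; exact: pow8_le_expR.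
rewrite ge0_integralZl_EFin//; last 3 first.
- by move=> e _; rewrite adde_ge0// lee_fin expR_ge0.
- exact: emeasurable_funD.
- by rewrite mulr_ge0 ?exprn_ge0 ?l2norm_ge0.
rewrite ge0_integralD//.
apply: (@le_trans _ _ ((l2norm v ^+ 8 * 8 ^+ 8)%:E * ((expR (1 + c))%:E + (expR (1 + c))%:E))%E).
  rewrite lee_wpmul2l// ?lee_fin ?mulr_ge0 ?exprn_ge0 ?l2norm_ge0//.
  by apply: leeD; apply: Qu; rewrite ?normrN1 ?normr1.
by rewrite -EFinD -EFinM lee_fin /moment8 le_eqVlt; apply/orP; left; apply/eqP; ring.
Qed.

Lemma sample_tail (v : 'cV[R]_d) (eta : R) : 0 < eta ->
  (Q [set e | (eta <= `|dot e.1 v|)%R] <= (moment8 * (l2norm v / eta) ^+ 8)%:E)%E.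
Proof.
move=> eta0.
have e8 : 0 < eta ^+ 8 by rewrite exprn_gt0.
have -> : [set e : sample | eta <= `|dot e.1 v|] = [set e : sample | eta ^+ 8 <= dot e.1 v ^+ 8].
  apply/seteqP; split => e /=; rewrite -(normr_pow8 (dot _ _)).
    by move=> h; rewrite lerXn2r ?nnegrE// ltW.
  by move=> h; rewrite -(@ler_pXn2r _ 8) ?nnegrE// ltW.
apply: (le_trans (markov_real Q e8 _ _)).
- by apply: measurable_funX; exact: measurable_sample_dot.
- by move=> e; exact: pow8_ge0.
have e8' : 0 <= (eta ^+ 8)^-1 by rewrite invr_ge0 ltW.
apply: (le_trans (lee_wpmul2l _ (sample_dot8 v))); first by rewrite lee_fin.
by rewrite -EFinM lee_fin expr_div_n mulrC -!mulrA.
Qed.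

Lemma sample_resid8 (m8 : R) (v : 'cV[R]_d) :
  (\int[Q]_e (e.2 ^+ 8)%:E <= m8%:E)%E ->
  (\int[Q]_e ((e.2 - dot e.1 v) ^+ 8)%:E <=
    (128 * (m8 + moment8 * l2norm v ^+ 8))%:E)%E.
Proof.
move=> Hm8.
have m1 : measurable_fun setT (fun e : sample => (e.2 ^+ 8)%:E).
  by apply/measurable_EFinP; apply: measurable_funX; exact: measurable_sample_snd.
have m2 : measurable_fun setT (fun e : sample => (dot e.1 v ^+ 8)%:E).
  by apply/measurable_EFinP; apply: measurable_funX; exact: measurable_sample_dot.
have p8 (t : R) : (0 <= (t ^+ 8)%:E)%E.
  by rewrite lee_fin pow8_ge0.
apply: (@le_trans _ _ (\int[Q]_e (128%:E * ((e.2 ^+ 8)%:E + (dot e.1 v ^+ 8)%:E)))%E).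
  apply: ge0_le_integral => //.
  - apply/measurable_EFinP; apply: measurable_funX; apply: measurable_funB.
      exact: measurable_sample_snd.
    exact: measurable_sample_dot.
  - by apply: emeasurable_funM => //; exact: emeasurable_funD.
  - move=> e _; rewrite -EFinD -EFinM lee_fin; apply: (le_trans (pow8_add _ _)).
    by rewrite -(normr_pow8 (- _)) normrN normr_pow8.
rewrite ge0_integralZl_EFin//; last 2 first.
- by move=> e _; rewrite adde_ge0.
- exact: emeasurable_funD.
rewrite ge0_integralD// EFinM lee_wpmul2l ?lee_fin// EFinD.
by apply: leeD => //; exact: sample_dot8.
Qed.

End SampleLaw.

Section IID.
Context {R : realType} {disp : measure_display} {Omega : measurableType disp}.
Variable P : probability Omega R.
Variables (n d : nat).
Notation sample := (borelType ('cV[R]_d * R)%type).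
Variables (x : 'I_n -> Omega -> 'cV[R]_d) (y : 'I_n -> Omega -> R).
Notation D := (fun i w => (x i w, y i w)).
Hypothesis mD : forall i, measurable_fun setT (D i : Omega -> sample).
Hypothesis indepD : mutually_independent P D.
Variable Q : probability sample R.
Hypothesis lawD : forall i (A : set sample), measurable A -> P (D i @^-1` A) = Q A.

Notation others i := (g_sigma_algebraType (other_events D i)).

Lemma obs_design i w : obs (design x w) i = x i w.
Proof. by apply/matrixP => a b; rewrite !mxE ord1. Qed.

Lemma responseE i w : response y w i 0 = y i w.
Proof. by rewrite mxE. Qed.

Lemma measurable_x_gen d' (T : measurableType d') (f : T -> Omega) i j :
  measurable_fun setT (D i \o f : T -> sample) ->
  measurable_fun setT (fun w => x i (f w) j 0).
Proof.
move=> m; apply: (@measurableT_comp _ _ _ _ sample _ (fun e => e.1 j 0) _ (D i \o f)) => //.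
exact: measurable_fst_coord.
Qed.

Lemma measurable_y_gen d' (T : measurableType d') (f : T -> Omega) i :
  measurable_fun setT (D i \o f : T -> sample) ->
  measurable_fun setT (fun w => y i (f w)).
Proof.
move=> m; apply: (@measurableT_comp _ _ _ _ sample _ (fun e => e.2) _ (D i \o f)) => //.
exact: measurable_sample_snd.
Qed.

Lemma measurable_x i j : measurable_fun setT (fun w => x i w j 0).
Proof. exact: (measurable_x_gen (f := id) j (mD i)). Qed.

Lemma measurable_y i : measurable_fun setT (y i).
Proof. exact: (measurable_y_gen (f := id) (mD i)). Qed.

Lemma measurable_others_id i : measurable_fun setT (id : Omega -> others i).
Proof. exact: (measurable_of_other (V := id : Omega -> others i) mD). Qed.

(** The variable independent of observation [i] is the outcome itself, regarded through the
    sigma-algebra of the other observations. Any quantity measurable for that sigma-algebra can thus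
    be frozen without presenting it as a function of a tuple of observations. *)
Lemma sample_fubini i (g : others i * sample -> \bar R) :
  measurable_fun setT g -> (forall z, (0 <= g z)%E) ->
  (\int[P]_w g (w, D i w) = \int[P]_w \int[Q]_e g (w, e))%E.
Proof.
move=> mg g0.
have UV (A : set sample) (B : set (others i)) : measurable A -> measurable B ->
    P (D i @^-1` A `&` (id : Omega -> others i) @^-1` B) =
    (P (D i @^-1` A) * P ((id : Omega -> others i) @^-1` B))%E.
  by move=> mA mB; exact: (other_events_indep mD indepD mA mB).
have mid : measurable_fun setT (id : Omega -> others i) by exact: measurable_others_id.
have H := indep_fubini (mD i) mid (@lawD i) UV mg g0.
exact: H.
Qed.

(** [chi] and [v] only see the observations other than [i], so observation [i] is integrated out
    first, with [v w] held at a fixed vector [b]. *)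
Lemma cond_expectation_le i (chi : Omega -> R) (v : Omega -> 'cV[R]_d)
    (h : 'cV[R]_d -> sample -> R) (H : 'cV[R]_d -> R) :
  measurable_fun setT (chi : others i -> R) -> (forall w, 0 <= chi w) ->
  measurable_fun setT ((fun z => h (v z.1) z.2) : others i * sample -> R) ->
  (forall b e, 0 <= h b e) -> (forall b, 0 <= H b) ->
  measurable_fun setT (fun w => H (v w)) ->
  (forall b, \int[Q]_e (h b e)%:E <= (H b)%:E)%E ->
  (\int[P]_w (chi w * h (v w) (D i w))%:E <= \int[P]_w (chi w * H (v w))%:E)%E.
Proof.
move=> mchi chi0 mh h0 H0 mH QH.
have mchi' : measurable_fun setT chi := measurable_of_other mD mchi.
rewrite (@sample_fubini i (fun z => (chi z.1 * h (v z.1) z.2)%:E)); last 2 first.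
- apply/measurable_EFinP; apply: measurable_funM => //.
  exact: (@measurableT_comp _ _ _ _ (others i)).
- by move=> z; rewrite lee_fin mulr_ge0.
have hm w : measurable_fun setT (h (v w) : sample -> R).
  exact: (measurableT_comp mh (pair1_measurable (w : others i))).
apply: ge0_le_integral => //.
- by move=> w _; apply: integral_ge0 => e _; rewrite lee_fin mulr_ge0.
- have := @measurable_fun_fubini_tonelli_F _ _ (others i) sample R Q
    (fun z => (chi z.1 * h (v z.1) z.2)%:E).
  move=> mF; apply: (measurable_of_other mD); apply: mF.
    apply/measurable_EFinP; apply: measurable_funM => //.
    exact: (@measurableT_comp _ _ _ _ (others i)).
  by move=> z; rewrite lee_fin mulr_ge0.
- by apply/measurable_EFinP; apply: measurable_funM.
- move=> w _; under eq_integral do rewrite /= EFinM.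
  rewrite ge0_integralZl_EFin//; last 2 first.
  - by move=> e _; rewrite lee_fin.
  - exact/measurable_EFinP.
  by rewrite EFinM lee_wpmul2l// lee_fin.
Qed.

Section Moments.
Variables (c m8 : R).
Hypothesis c0 : 0 <= c.
Hypothesis Qmgf : forall v : 'cV[R]_d,
  (\int[Q]_e (expR (dot e.1 v))%:E <= (expR (l2norm v + c * l2norm v ^+ 2))%:E)%E.
Hypothesis Qy8 : (\int[Q]_e (e.2 ^+ 8)%:E <= m8%:E)%E.

Lemma m8_ge0 : 0 <= m8.
Proof.
by rewrite -lee_fin; apply: le_trans Qy8; apply: integral_ge0 => e _; rewrite lee_fin pow8_ge0.
Qed.

Lemma measurable_others_dot i (v : Omega -> 'cV[R]_d) :
  (forall j, measurable_fun setT ((fun w => v w j 0) : others i -> R)) ->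
  measurable_fun setT ((fun z => dot z.2.1 (v z.1)) : others i * sample -> R).
Proof.
move=> mv; apply: measurable_dot => j.
- apply: (@measurableT_comp _ _ _ _ sample _ (fun e => e.1 j 0) _ snd) => //.
  exact: measurable_fst_coord.
- exact: (@measurableT_comp _ _ _ _ (others i) _ (fun w => v w j 0) _ fst).
Qed.

Lemma measurable_others_snd i : measurable_fun setT ((fun z => z.2.2) : others i * sample -> R).
Proof.
apply: (@measurableT_comp _ _ _ _ sample _ (fun e => e.2) _ snd) => //.
exact: measurable_sample_snd.
Qed.

Lemma cond_dot8 i (chi : Omega -> R) (v : Omega -> 'cV[R]_d) :
  measurable_fun setT (chi : others i -> R) -> (forall w, 0 <= chi w) ->
  (forall j, measurable_fun setT ((fun w => v w j 0) : others i -> R)) ->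
  (\int[P]_w (chi w * dot (x i w) (v w) ^+ 8)%:E <=
   (moment8 c)%:E * \int[P]_w (chi w * l2norm (v w) ^+ 8)%:E)%E.
Proof.
move=> mchi chi0 mv.
have mv' j : measurable_fun setT (fun w => v w j 0) := measurable_of_other mD (mv j).
have mn : measurable_fun setT (fun w => l2norm (v w)) by exact: measurable_l2norm.
apply: (le_trans (@cond_expectation_le i chi v (fun b e => dot e.1 b ^+ 8)
   (fun b => moment8 c * l2norm b ^+ 8) mchi chi0 _ _ _ _ _)).
- apply: measurable_funX; exact: measurable_others_dot.
- by move=> b e; exact: pow8_ge0.
- by move=> b; rewrite mulr_ge0 ?moment8_ge0 ?pow8_ge0.
- by apply: measurable_funM => //; exact: measurable_funX.
- by move=> b; exact: sample_dot8.
rewrite -ge0_integralZl_EFin ?moment8_ge0//.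
- rewrite le_eqVlt; apply/orP; left; apply/eqP.
  by apply: eq_integral => w _; rewrite -EFinM mulrCA.
- by move=> w _; rewrite lee_fin mulr_ge0 ?pow8_ge0.
- apply/measurable_EFinP; apply: measurable_funM; last exact: measurable_funX.
  exact: (measurable_of_other mD mchi).
Qed.

Lemma cond_resid8 i (chi : Omega -> R) (v : Omega -> 'cV[R]_d) :
  measurable_fun setT (chi : others i -> R) -> (forall w, 0 <= chi w <= 1) ->
  (forall j, measurable_fun setT ((fun w => v w j 0) : others i -> R)) ->
  (\int[P]_w (chi w * (y i w - dot (x i w) (v w)) ^+ 8)%:E <=
   128%:E * (m8%:E + (moment8 c)%:E * \int[P]_w (chi w * l2norm (v w) ^+ 8)%:E))%E.
Proof.
move=> mchi chi01 mv.
have chi0 w : 0 <= chi w by have /andP[] := chi01 w.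
have mv' j : measurable_fun setT (fun w => v w j 0) := measurable_of_other mD (mv j).
have mn : measurable_fun setT (fun w => l2norm (v w)) by exact: measurable_l2norm.
have mchi' : measurable_fun setT chi := measurable_of_other mD mchi.
apply: (le_trans (@cond_expectation_le i chi v (fun b e => (e.2 - dot e.1 b) ^+ 8)
   (fun b => 128 * (m8 + moment8 c * l2norm b ^+ 8)) mchi chi0 _ _ _ _ _)).
- apply: measurable_funX; apply: measurable_funB; first exact: measurable_others_snd.
  exact: measurable_others_dot.
- by move=> b e; exact: pow8_ge0.
- by move=> b; rewrite mulr_ge0// addr_ge0 ?m8_ge0// mulr_ge0 ?moment8_ge0 ?pow8_ge0.
- apply: measurable_funM => //; apply: measurable_funD => //.
  by apply: measurable_funM => //; exact: measurable_funX.
- by move=> b; exact: sample_resid8.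
have mX : measurable_fun setT (fun w => (chi w * l2norm (v w) ^+ 8)%:E).
  by apply/measurable_EFinP; apply: measurable_funM => //; exact: measurable_funX.
apply: (@le_trans _ _ (\int[P]_w (128%:E * (m8%:E + (moment8 c)%:E *
    (chi w * l2norm (v w) ^+ 8)%:E)))%E).
  apply: ge0_le_integral => //.
  - move=> w _; rewrite lee_fin mulr_ge0// mulr_ge0// addr_ge0 ?m8_ge0//.
    by rewrite mulr_ge0 ?moment8_ge0 ?pow8_ge0.
  - apply/measurable_EFinP; apply: measurable_funM => //; apply: measurable_funM => //.
    by apply: measurable_funD => //; apply: measurable_funM => //; exact: measurable_funX.
  - apply: emeasurable_funM => //; apply: emeasurable_funD => //.
    exact: emeasurable_funM.
  - move=> w _; rewrite (_ : (128%:E * _)%E =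
      (128 * (m8 + moment8 c * (chi w * l2norm (v w) ^+ 8)))%:E)//.
    rewrite lee_fin [leLHS]mulrCA ler_wpM2l// mulrDr.
    rewrite [chi w * (_ * _)]mulrCA lerD2r ler_piMl ?m8_ge0//.
    by have /andP[] := chi01 w.
rewrite ge0_integralZl_EFin//; last 2 first.
- move=> w _; rewrite lee_fin addr_ge0 ?m8_ge0// mulr_ge0 ?moment8_ge0//.
  by rewrite mulr_ge0 ?pow8_ge0.
- by apply: emeasurable_funD => //; exact: emeasurable_funM.
rewrite lee_wpmul2l ?lee_fin// ge0_integralD//; last 3 first.
- by move=> w _; rewrite lee_fin m8_ge0.
- move=> w _; rewrite lee_fin mulr_ge0 ?moment8_ge0//.
  by rewrite mulr_ge0 ?pow8_ge0.
- exact: emeasurable_funM.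
rewrite integral_cst_probability leeD2l// ge0_integralZl_EFin ?moment8_ge0//.
by move=> w _; rewrite lee_fin mulr_ge0 ?pow8_ge0.
Qed.

End Moments.
End IID.

Section ExpectationBound.
Context {R : realType} {disp : measure_display} {Omega : measurableType disp}.
Variable P : probability Omega R.
Implicit Types f g : Omega -> R.

(** For nonnegative [f], a real bound on the extended integral also records that the integral is
    finite, so integrability need not be carried along separately. *)
Definition mean_le f (c : R) : Prop := (\int[P]_w (f w)%:E <= c%:E)%E.

Lemma mean_le_le f g c : measurable_fun setT f -> measurable_fun setT g ->
  (forall w, 0 <= f w <= g w) -> mean_le g c -> mean_le f c.
Proof.
move=> mf mg fg; apply: le_trans; apply: ge0_le_integral => //.
- by move=> w _; rewrite lee_fin; have /andP[] := fg w.
- exact/measurable_EFinP.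
- exact/measurable_EFinP.
- by move=> w _; rewrite lee_fin; have /andP[] := fg w.
Qed.

Lemma mean_le_weak f c c' : c <= c' -> mean_le f c -> mean_le f c'.
Proof. by move=> cc h; apply: le_trans h _; rewrite lee_fin. Qed.

Lemma mean_le_cst c : mean_le (fun=> c) c.
Proof. by rewrite /mean_le integral_cst_probability. Qed.

Lemma mean_leD f g a b : measurable_fun setT f -> measurable_fun setT g ->
  (forall w, 0 <= f w) -> (forall w, 0 <= g w) ->
  mean_le f a -> mean_le g b -> mean_le (fun w => f w + g w) (a + b).
Proof.
move=> mf mg f0 g0 fa gb; rewrite /mean_le; under eq_integral do rewrite EFinD.
rewrite ge0_integralD//.
- by rewrite EFinD leeD.
- by move=> w _; rewrite lee_fin.
- exact/measurable_EFinP.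
- by move=> w _; rewrite lee_fin.
- exact/measurable_EFinP.
Qed.

Lemma mean_leZ f k a : measurable_fun setT f -> (forall w, 0 <= f w) -> 0 <= k ->
  mean_le f a -> mean_le (fun w => k * f w) (k * a).
Proof.
move=> mf f0 k0 fa; rewrite /mean_le; under eq_integral do rewrite EFinM.
rewrite ge0_integralZl_EFin//.
- by rewrite EFinM lee_wpmul2l// lee_fin.
- by move=> w _; rewrite lee_fin.
- exact/measurable_EFinP.
Qed.

Lemma mean_le_sum (I : Type) (s : seq I) (A : pred I) (f : I -> Omega -> R) (a : I -> R) :
  (forall i, A i -> measurable_fun setT (f i)) -> (forall i w, A i -> 0 <= f i w) ->
  (forall i, A i -> mean_le (f i) (a i)) ->
  mean_le (fun w => \sum_(i <- s | A i) f i w) (\sum_(i <- s | A i) a i).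
Proof.
move=> mf f0 fa; elim: s => [|i s IH].
  rewrite big_nil (_ : (fun w => _) = cst 0); first exact: mean_le_cst.
  by apply/funext => w; rewrite big_nil.
rewrite big_cons; case Ai: (A i); last first.
  rewrite (_ : (fun w => _) = fun w => \sum_(i <- s | A i) f i w) //.
  by apply/funext => w; rewrite big_cons Ai.
rewrite (_ : (fun w => _) = fun w => f i w + \sum_(i <- s | A i) f i w); last first.
  by apply/funext => w; rewrite big_cons Ai.
apply: mean_leD => //.
- exact: mf.
- exact: measurable_bigsum.
- by move=> w; exact: f0.
- by move=> w; apply: sumr_ge0 => j; exact: f0.
- exact: fa.
Qed.

Lemma mean_le_markov f c t : 0 < t -> measurable_fun setT f -> (forall w, 0 <= f w) ->
  mean_le f c -> (P [set w | (t <= f w)%R] <= (c / t)%:E)%E.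
Proof.
move=> t0 mf f0 fc; apply: (le_trans (markov_real P t0 mf f0)).
by rewrite mulrC EFinM lee_wpmul2l// lee_fin invr_ge0 ltW.
Qed.

Lemma union_bound (I : eqType) (s : seq I) (A : I -> set Omega) (p : R) :
  (forall i, i \in s -> measurable (A i)) ->
  (forall i, i \in s -> (P (A i) <= p%:E)%E) ->
  measurable [set w | exists2 i, i \in s & A i w] /\
  (P [set w | exists2 i, i \in s & A i w] <= ((size s)%:R * p)%:E)%E.
Proof.
elim: s => [|i s IH] mA PA.
  rewrite (_ : [set w | _] = set0); last by apply/seteqP; split => w // [].
  by split => //; rewrite measure0 mul0r.
have [mS PS] := IH (fun j js => mA j (mem_behead (s := i :: s) js))
   (fun j js => PA j (mem_behead (s := i :: s) js)).
have mi := mA i (mem_head i s).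
have -> : [set w | exists2 j, j \in i :: s & A j w] =
    A i `|` [set w | exists2 j, j \in s & A j w].
  apply/seteqP; split => w /=.
    move=> [j]; rewrite inE => /predU1P[->|js] Aj; [by left|right; by exists j].
  case => [Ai|[j js Aj]]; first by exists i; rewrite ?mem_head.
  by exists j => //; rewrite inE js orbT.
split; first exact: measurableU.
apply: (le_trans (measureU2 _ mi mS)); rewrite /= -natr1 mulrDl mul1r addrC EFinD.
by apply: leeD => //; exact: PA (mem_head _ _).
Qed.

End ExpectationBound.

Lemma lee_prod_nneg {R : realType} (I : finType) (f g : I -> \bar R) :
  (forall i, 0 <= f i <= g i)%E -> (\prod_i f i <= \prod_i g i)%E.
Proof.
move=> h; suff : (0 <= \prod_i f i /\ \prod_i f i <= \prod_i g i)%E by case.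
apply: (big_ind2 (fun a b => (0 <= a)%E /\ (a <= b)%E)) => //.
- move=> a a' b b' [a0 aa] [b0 bb]; split; first exact: mule_ge0.
  exact: lee_pmul.
- by move=> i _; have /andP[] := h i.
Qed.

(** * The operator norm of the random design *)

Section GoodDesign.
Context {R : realType} {disp : measure_display} {Omega : measurableType disp}.
Variable P : probability Omega R.
Variables (n d : nat).
Notation sample := (borelType ('cV[R]_d * R)%type).
Variables (x : 'I_n -> Omega -> 'cV[R]_d) (y : 'I_n -> Omega -> R).
Notation D := (fun i w => (x i w, y i w)).
Hypothesis mD : forall i, measurable_fun setT (D i : Omega -> sample).
Hypothesis indepD : mutually_independent P D.
Variable Q : probability sample R.
Hypothesis lawD : forall i (A : set sample), measurable A -> P (D i @^-1` A) = Q A.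
Notation others i := (g_sigma_algebraType (other_events D i)).
Variable c : R.
Hypothesis c0 : 0 <= c.
Hypothesis Qmgf : forall v : 'cV[R]_d,
  (\int[Q]_e (expR (dot e.1 v))%:E <= (expR (l2norm v + c * l2norm v ^+ 2))%:E)%E.
Hypothesis n0 : (0 < n)%N.
Hypothesis d0 : (0 < d)%N.

(** A finite conjunction over the net instead of a bound over all vectors: measurability is then
    immediate, and it holds for any sigma-algebra that makes the observations in [S] measurable. *)
Definition good_design (C : R) (S : {set 'I_n}) : set Omega :=
  [set w | all (fun v => \sum_(i in S) dot (x i w) v ^+ 2 <= C * n%:R) (@net R d)].

Lemma good_design_opn C S w : 0 <= C -> good_design C S w ->
  opn_le (4 * C) S (design x w).
Proof.
move=> C0 /allP h; apply: net_opn_le => // v vN.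
by under eq_bigr do rewrite obs_design; exact: h.
Qed.

Lemma good_designS C (S S' : {set 'I_n}) : S' \subset S ->
  good_design C S `<=` good_design C S'.
Proof.
move=> sub w /allP h; apply/allP => v vN; apply: le_trans (h v vN).
rewrite [leRHS](big_setID S') /= (finset.setIidPr sub) lerDl sumr_ge0// => i _.
exact: sqr_ge0.
Qed.

Lemma measurable_good_design d' (T : measurableType d') (f : T -> Omega) (C : R)
    (S : {set 'I_n}) :
  (forall i, i \in S -> measurable_fun setT (D i \o f : T -> sample)) ->
  measurable [set t | good_design C S (f t)].
Proof.
move=> mf; rewrite /good_design /=; elim: (@net R d) => [|v s IH].
  by rewrite (_ : [set t | _] = setT) //; apply/seteqP; split.
rewrite (_ : [set t | _] = [set t | \sum_(i in S) dot (x i (f t)) v ^+ 2 <= C * n%:R] `&`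
   [set t | all (fun v => \sum_(i in S) dot (x i (f t)) v ^+ 2 <= C * n%:R) s]).
  apply: measurableI => //; apply: measurable_le_set => //.
  apply: measurable_bigsum => i iS; apply: measurable_funX.
  apply: measurable_dot => // j.
  exact: (measurable_x_gen j (mf i iS)).
by apply/seteqP; split => t /= => [/andP[]|[-> ->]].
Qed.

Lemma mgf_row i (v : 'cV[R]_d) :
  (\int[P]_w (expR (dot (x i w) v))%:E <= (expR (l2norm v + c * l2norm v ^+ 2))%:E)%E.
Proof.
have m : measurable_fun setT (fun e : sample => expR (dot e.1 v)).
  by apply: measurableT_comp => //; exact: measurable_sample_dot.
have -> : (\int[P]_w (expR (dot (x i w) v))%:E = \int[P]_w (1 * expR (dot (x i w) v))%:E)%E.
  by apply: eq_integral => w _; rewrite mul1r.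
apply: (le_trans (@cond_expectation_le _ _ _ P n d x y mD indepD Q lawD i (fun=> 1) (fun=> v)
  (fun b e => expR (dot e.1 v)) (fun=> expR (l2norm v + c * l2norm v ^+ 2)) _ _ _ _ _ _ _)) => //.
- apply: measurableT_comp => //.
  exact: (measurable_others_dot (i := i) (v := fun=> v)).
- by under eq_integral do rewrite mul1r; rewrite integral_cst_probability.
Qed.

(** Independence factors the exponential over the rows. The scale is the square root of [n]: as the
    sum of the [|u i|] is at most that root on the unit ball, the linear terms add up to at most [n]
    and the quadratic ones to at most [c * n]. *)
Lemma mgf_bilinear (u : 'cV[R]_n) (v : 'cV[R]_d) : l2norm u <= 1 -> l2norm v <= 1 ->
  (\int[P]_w (expR (Num.sqrt n%:R * \sum_i u i 0 * dot (x i w) v))%:E <=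
   (expR ((1 + c) * n%:R))%:E)%E.
Proof.
move=> u1 v1; set r := Num.sqrt n%:R.
have r0 : 0 <= r by exact: sqrtr_ge0.
have r2 : r * r = n%:R by rewrite -expr2 sqr_sqrtr.
have E w : expR (r * \sum_i u i 0 * dot (x i w) v) =
    \prod_i expR (dot (x i w) ((r * u i 0) *: v)).
  rewrite -expR_sum mulr_sumr; congr expR; apply: eq_bigr => i _.
  by rewrite dotZr mulrA.
under eq_integral do rewrite E.
have := @indep_integral_prod _ _ _ P 'I_n ('cV[R]_d * R)%type D
  (fun i e => expR (dot e.1 ((r * u i 0) *: v))) mD indepD.
move=> ->; last 2 first.
- by move=> i; apply: measurableT_comp => //; exact: measurable_sample_dot.
- by move=> i e; exact: expR_ge0.
apply: (@le_trans _ _ (\prod_i (expR (r * `|u i 0| + c * n%:R * u i 0 ^+ 2))%:E)%E).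
  apply: lee_prod_nneg => i; apply/andP; split.
    by apply: integral_ge0 => w _; rewrite lee_fin expR_ge0.
  apply: (le_trans (mgf_row i _)); rewrite lee_fin ler_expR l2normZ normrM (ger0_norm r0).
  have l0 := l2norm_ge0 v.
  have ru : 0 <= r * `|u i 0| by rewrite mulr_ge0.
  apply: lerD; first by rewrite ler_piMr.
  have v2 : l2norm v ^+ 2 <= 1 by rewrite expr_le1.
  rewrite -!mulrA ler_wpM2l// !exprMn real_normK ?num_real// expr2 r2 mulrA.
  by apply: ler_piMr => //; rewrite mulr_ge0// sqr_ge0.
rewrite prodEFin lee_fin -expR_sum ler_expR big_split /= -!mulr_sumr.
have u2 : \sum_i u i 0 ^+ 2 <= 1.
  have : l2norm u ^+ 2 <= 1 by rewrite expr_le1 ?l2norm_ge0.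
  by rewrite sqr_sqrtr// sumr_ge0// => i _; exact: sqr_ge0.
have ua : \sum_i `|u i 0| <= r.
  rewrite -(@ler_pXn2r _ 2) ?nnegrE ?sumr_ge0//.
  have := sum_Cauchy_Schwarz (index_enum 'I_n) predT (fun i => `|u i 0|) (fun=> 1).
  under eq_bigr do rewrite mulr1.
  under [X in _ <= _ * X -> _]eq_bigr do rewrite expr1n.
  rewrite [X in _ <= _ * X -> _]sumr_const card_ord => h.
  rewrite [leRHS]expr2 r2; apply: (le_trans h); rewrite ler_piMl//.
  by under eq_bigr do rewrite real_normK ?num_real//.
rewrite mulrDl mul1r; apply: lerD; first by rewrite -r2 ler_wpM2l.
by rewrite ler_piMr// mulr_ge0.
Qed.

(** A Chernoff bound for each pair of net points at level [tau] times the square root of [n], and a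
    union over at most [64 ^ (n + d)] pairs. Duality over the net in dimension [n] loses a factor 2,
    whence [4 * tau ^+ 2]. *)
Lemma good_design_prob (tau : R) : 0 <= tau ->
  (P (~` good_design (4 * tau ^+ 2) [set: 'I_n]%SET) <=
    ((64 ^ (n + d))%:R * expR ((1 + c - tau) * n%:R))%:E)%E.
Proof.
move=> tau0; set r : R := Num.sqrt n%:R.
have r2 : r * r = n%:R by rewrite -expr2 sqr_sqrtr.
have r0 : 0 < r by rewrite sqrtr_gt0 ltr0n.
pose f (u : 'cV[R]_n) (v : 'cV[R]_d) w := expR (r * \sum_i u i 0 * dot (x i w) v).
have mf u v : measurable_fun setT (f u v).
  apply: measurableT_comp => //; apply: measurable_funM => //.
  apply: measurable_bigsum => i _; apply: measurable_funM => //.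
  by apply: measurable_dot => // j; exact: (measurable_x mD).
pose A (uv : 'cV[R]_n * 'cV[R]_d) := [set w | expR (tau * n%:R) <= f uv.1 uv.2 w].
have mA uv : measurable (A uv) by apply: measurable_le_set.
pose s := [seq (u, v) | u <- @net R n, v <- @net R d].
have PA uv : uv \in s -> (P (A uv) <= (expR ((1 + c - tau) * n%:R))%:E)%E.
  move=> /allpairsP [[u v] /= [uN vN ->]].
  have := @mean_le_markov _ _ _ P (f u v) (expR ((1 + c) * n%:R)) (expR (tau * n%:R))
    (expR_gt0 _) (mf u v) (fun w => expR_ge0 _).
  rewrite -expRN -expRD -mulrBl => h; apply: (le_trans (h _)) => //.
  apply: mgf_bilinear; exact: net_norm.
have [mU PU] := union_bound (fun uv _ => mA uv) PA.
have mG : measurable (good_design (4 * tau ^+ 2) [set: 'I_n]%SET).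
  exact: (measurable_good_design (f := id) (4 * tau ^+ 2) (fun i _ => mD i)).
apply: (@le_trans _ _ (P [set w | exists2 i, i \in s & A i w])).
  apply: le_measure; rewrite ?inE//; first exact: measurableC.
  move=> w /= /negP; rewrite -has_predC => /hasP [v vN /=]; rewrite -ltNge => h.
  apply: contrapT => h2.
  pose q : 'cV[R]_n := \col_i dot (x i w) v.
  have : l2norm q <= 2 * (tau * r).
    apply: net_dual => //; first by rewrite mulr_ge0// ltW.
    move=> u uN; rewrite leNgt; apply/negP => h3; apply: h2; exists (u, v).
      by apply/allpairsP; exists (u, v).
    rewrite /A /f /= ler_expR -r2 mulrCA ler_pM2l// ltW//.
    apply: (lt_le_trans h3); rewrite le_eqVlt; apply/orP; left; apply/eqP.
    by apply: eq_bigr => i _; rewrite mxE.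
  move=> h3; move: h; rewrite ltNge => /negP; apply.
  have -> : \sum_(i in [set: 'I_n]%SET) dot (x i w) v ^+ 2 = l2norm q ^+ 2.
    rewrite sqr_sqrtr; last by apply: sumr_ge0 => i _; exact: sqr_ge0.
    by apply: eq_big => i; rewrite ?inE// mxE.
  apply: (@le_trans _ _ ((2 * (tau * r)) ^+ 2)).
    by rewrite ler_sqr ?nnegrE ?l2norm_ge0// !mulr_ge0// ltW.
  by rewrite le_eqVlt; apply/orP; left; apply/eqP; rewrite -r2; ring.
apply: (le_trans PU); rewrite lee_fin ler_wpM2r ?expR_ge0// ler_nat.
by rewrite size_allpairs expnD leq_mul// size_net.
Qed.

End GoodDesign.

(** * Eighth moments of the iterates and of their displacements *)

Section IterateMoments.
Context {R : realType} {disp : measure_display} {Omega : measurableType disp}.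
Variable P : probability Omega R.
Variables (n d : nat).
Notation sample := (borelType ('cV[R]_d * R)%type).
Variables (x : 'I_n -> Omega -> 'cV[R]_d) (y : 'I_n -> Omega -> R).
Notation D := (fun i w => (x i w, y i w)).
Hypothesis mD : forall i, measurable_fun setT (D i : Omega -> sample).
Hypothesis indepD : mutually_independent P D.
Variable Q : probability sample R.
Hypothesis lawD : forall i (A : set sample), measurable A -> P (D i @^-1` A) = Q A.
Notation others i := (g_sigma_algebraType (other_events D i)).
Variables (c m8 : R).
Hypothesis c0 : 0 <= c.
Hypothesis Qmgf : forall v : 'cV[R]_d,
  (\int[Q]_e (expR (dot e.1 v))%:E <= (expR (l2norm v + c * l2norm v ^+ 2))%:E)%E.
Hypothesis Qy8 : (\int[Q]_e (e.2 ^+ 8)%:E <= m8%:E)%E.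
Hypothesis n0 : (0 < n)%N.
Hypothesis d0 : (0 < d)%N.
Variables (delta : nat -> R) (b0 : 'cV[R]_d) (K : nat) (Delta B0 C : R).
Hypothesis C0 : 0 <= C.
Hypothesis delta0 : forall k, (k < K)%N -> 0 <= delta k.
Hypothesis deltaS : forall k, (k <= K)%N -> \sum_(0 <= s < k) delta s <= Delta.
Hypothesis b0B : l2norm b0 <= B0.

Definition iter_on (S : {set 'I_n}) k w := gdm delta S (design x w) (response y w) b0 k.
(** This truncation is a function of the observations in [S], hence a frozen factor whenever an
    observation outside [S] is integrated out. *)
Definition good_ind (S : {set 'I_n}) w : R := \1_(good_design x C S) w.

Let M := 4 * C.
Let M0 : 0 <= M. Proof. by rewrite mulr_ge0. Qed.
Let Delta0 : 0 <= Delta.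
Proof. by have := deltaS (leq0n K); rewrite big_nil. Qed.
Let B00 : 0 <= B0. Proof. by apply: le_trans b0B; exact: l2norm_ge0. Qed.
Let m80 : 0 <= m8. Proof. exact: (m8_ge0 Qy8). Qed.

(** None of the three constants contains [n], the dimension or the number of steps, which makes the
    moment bounds uniform along the asymptotic regime. *)
Definition iter_cst : R :=
  expR (M * Delta) ^+ 8 * (128 * (B0 ^+ 8 + Delta ^+ 8 * (M ^+ 4 * m8))).
Definition resid_cst : R := 128 * (m8 + moment8 c * iter_cst).
Definition diff_cst : R :=
  expR (M * Delta) ^+ 8 * (Delta ^+ 7 * (M ^+ 4 * (Delta * resid_cst))).

Lemma iter_cst_ge0 : 0 <= iter_cst.
Proof.
by rewrite mulr_ge0 ?exprn_ge0 ?expR_ge0// mulr_ge0// addr_ge0 ?mulr_ge0 ?exprn_ge0.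
Qed.

Lemma resid_cst_ge0 : 0 <= resid_cst.
Proof. by rewrite mulr_ge0// addr_ge0// mulr_ge0 ?moment8_ge0 ?iter_cst_ge0. Qed.

Lemma diff_cst_ge0 : 0 <= diff_cst.
Proof.
have r0 := resid_cst_ge0; have e0 := expR_ge0 (M * Delta).
by rewrite mulr_ge0 ?exprn_ge0// mulr_ge0 ?exprn_ge0// mulr_ge0 ?exprn_ge0// mulr_ge0.
Qed.

Lemma good_ind_bounds S w : 0 <= good_ind S w <= 1.
Proof. by rewrite /good_ind indicE; case: (_ \in _); rewrite /= ?lexx ler01. Qed.

Lemma good_ind_ge0 S w : 0 <= good_ind S w.
Proof. by have /andP[] := good_ind_bounds S w. Qed.

(* Hence the indicator for the larger of two sets of observations controls the
   iterates on both. *)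
Lemma good_indS (S S' : {set 'I_n}) w : S' \subset S -> good_ind S w <= good_ind S' w.
Proof.
move=> sub; rewrite /good_ind !indicE; case: (boolP (w \in good_design x C S)) => [|_] /=.
  by rewrite inE => /(good_designS sub) h; rewrite (mem_set h).
by case: (_ \in _).
Qed.

Lemma good_ind_le (S : {set 'I_n}) w (a b : R) :
  (opn_le M S (design x w) -> a <= b) -> good_ind S w * a <= good_ind S w * b.
Proof.
move=> h; rewrite /good_ind indicE; case: (boolP (w \in _)) => [|_]; last by rewrite !mul0r.
by move=> /set_mem g; rewrite !mul1r; exact: h (good_design_opn d0 C0 g).
Qed.

Lemma measurable_good_ind_gen d' (T : measurableType d') (f : T -> Omega) (S : {set 'I_n}) :
  (forall i, i \in S -> measurable_fun setT (D i \o f : T -> sample)) ->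
  measurable_fun setT (fun t => good_ind S (f t)).
Proof.
move=> mf; rewrite (_ : (fun t => _) = \1_[set t | good_design x C S (f t)]).
  by apply: measurable_indic; exact: (@measurable_good_design _ _ _ _ _ x y).
by apply/funext => t; rewrite /good_ind !indicE; congr (_%:R); apply/idP/idP; rewrite !inE.
Qed.

Lemma measurable_iter_gen d' (T : measurableType d') (f : T -> Omega) (S : {set 'I_n}) k j :
  (forall i, i \in S -> measurable_fun setT (D i \o f : T -> sample)) ->
  measurable_fun setT (fun t => iter_on S k (f t) j 0).
Proof.
move=> mf; apply: measurable_gdm => [i j' iS|i iS].
  rewrite (_ : (fun t => _) = fun t => x i (f t) j' 0); last first.
    by apply/funext => t; rewrite !mxE.
  exact: (measurable_x_gen j' (mf i iS)).
rewrite (_ : (fun t => _) = fun t => y i (f t)); last by apply/funext => t; rewrite mxE.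
exact: (measurable_y_gen (mf i iS)).
Qed.

Lemma measurable_good_ind S : measurable_fun setT (good_ind S).
Proof. exact: (measurable_good_ind_gen (f := id) (fun i _ => mD i)). Qed.

Lemma measurable_iter S k j : measurable_fun setT (fun w => iter_on S k w j 0).
Proof. exact: (measurable_iter_gen (f := id) k j (fun i _ => mD i)). Qed.

Lemma other_coord (S : {set 'I_n}) i j : i \notin S -> j \in S ->
  measurable_fun setT (D j : others i -> sample).
Proof. by move=> iS jS; apply: measurable_other; apply: contraNneq iS => <-. Qed.

Lemma measurable_good_ind_others (S : {set 'I_n}) i : i \notin S ->
  measurable_fun setT (good_ind S : others i -> R).
Proof.
move=> iS; exact: (measurable_good_ind_gen (T := others i) (f := id)
  (fun j jS => other_coord iS jS)).
Qed.

Lemma measurable_iter_others (S : {set 'I_n}) i k j : i \notin S ->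
  measurable_fun setT ((fun w => iter_on S k w j 0) : others i -> R).
Proof.
move=> iS; exact: (measurable_iter_gen (T := others i) (f := id) k j
  (fun j jS => other_coord iS jS)).
Qed.

Lemma measurable_resid S i k :
  measurable_fun setT (fun w => y i w - dot (x i w) (iter_on S k w)).
Proof.
apply: measurable_funB; first exact: (measurable_y mD).
by apply: measurable_dot => j; [exact: (measurable_x mD)|exact: measurable_iter].
Qed.

Lemma mean_response8 i : mean_le P (fun w => y i w ^+ 8) m8.
Proof.
rewrite /mean_le (@sample_fubini _ _ _ P n d x y mD indepD Q lawD i (fun z => (z.2.2 ^+ 8)%:E)).
- set I := (\int[Q]_e (e.2 ^+ 8)%:E)%E; have Qy8' : (I <= m8%:E)%E := Qy8.
  have I0 : (0 <= I)%E by apply: integral_ge0 => e _; rewrite lee_fin pow8_ge0.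
  have -> : I = (fine I)%:E by rewrite fineK// ge0_fin_numE// (le_lt_trans Qy8')// ltry.
  by rewrite integral_cst_probability fineK// ge0_fin_numE// (le_lt_trans Qy8')// ltry.
- by apply/measurable_EFinP; apply: measurable_funX; exact: measurable_others_snd.
- by move=> z; rewrite lee_fin pow8_ge0.
Qed.

(** On the good design the deterministic bound involves the responses only through the average of
    their eighth powers, whose mean is at most [m8]. *)
Lemma iter_moment S k : (k <= K)%N ->
  mean_le P (fun w => good_ind S w * l2norm (iter_on S k w) ^+ 8) iter_cst.
Proof.
move=> kK.
have mn : measurable_fun setT (fun w => l2norm (iter_on S k w)).
  by apply: measurable_l2norm => j; exact: measurable_iter.
have my i : measurable_fun setT (fun w => y i w ^+ 8).
  by apply: measurable_funX; exact: (measurable_y mD).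
have n0' : n%:R != 0 :> R by rewrite pnatr_eq0 -lt0n.
have E0 : 0 <= expR (M * Delta) ^+ 8 by rewrite exprn_ge0 ?expR_ge0.
have D0 := exprn_ge0 8 Delta0.
have Mn0 : 0 <= M ^+ 4 / n%:R by rewrite divr_ge0 ?exprn_ge0.
have s0 w : 0 <= \sum_i y i w ^+ 8 by apply: sumr_ge0 => i _; exact: pow8_ge0.
have ms : measurable_fun setT (fun w => \sum_i y i w ^+ 8) by apply: measurable_bigsum.
apply: (@mean_le_le _ _ _ P _ (fun w => expR (M * Delta) ^+ 8 * (128 * (B0 ^+ 8 +
    Delta ^+ 8 * (M ^+ 4 / n%:R * \sum_i y i w ^+ 8))))).
- by apply: measurable_funM; [exact: measurable_good_ind|exact: measurable_funX].
- apply: measurable_funM => //; apply: measurable_funM => //; apply: measurable_funD => //.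
  by apply: measurable_funM => //; apply: measurable_funM.
- move=> w; rewrite mulr_ge0 ?good_ind_ge0 ?pow8_ge0//=.
  have h : 0 <= expR (M * Delta) ^+ 8 * (128 * (B0 ^+ 8 +
    Delta ^+ 8 * (M ^+ 4 / n%:R * \sum_i y i w ^+ 8))).
    by rewrite mulr_ge0// mulr_ge0// addr_ge0 ?pow8_ge0// mulr_ge0// mulr_ge0.
  apply: (@le_trans _ _ (good_ind S w * (expR (M * Delta) ^+ 8 * (128 * (B0 ^+ 8 +
    Delta ^+ 8 * (M ^+ 4 / n%:R * \sum_i y i w ^+ 8)))))); last first.
    by rewrite ler_piMl//; have /andP[] := good_ind_bounds S w.
  apply: good_ind_le => hM.
  have := @gdm_norm8 R n d delta K Delta M n0 M0 delta0 deltaS S (design x w)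
    (response y w) b0 k hM kK.
  move=> hh; apply: (le_trans hh); rewrite ler_wpM2l// ler_wpM2l// lerD//.
    by rewrite lerXn2r ?nnegrE ?l2norm_ge0.
  rewrite le_eqVlt; apply/orP; left; apply/eqP; congr (_ * (_ * _)).
  by apply: eq_bigr => i _; rewrite responseE.
have -> : iter_cst = expR (M * Delta) ^+ 8 * (128 * (B0 ^+ 8 + Delta ^+ 8 *
    (M ^+ 4 / n%:R * \sum_(i < n) m8))).
  by rewrite sumr_const card_ord -mulr_natl /iter_cst; field.
have hs : mean_le P (fun w => \sum_i y i w ^+ 8) (\sum_(i < n) m8).
  by apply: mean_le_sum => // [i w _|i _]; [exact: pow8_ge0|exact: mean_response8].
have m1 : measurable_fun setT (fun w => M ^+ 4 / n%:R * \sum_i y i w ^+ 8).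
  exact: measurable_funM.
have m2 : measurable_fun setT (fun w => Delta ^+ 8 * (M ^+ 4 / n%:R * \sum_i y i w ^+ 8)).
  exact: measurable_funM.
have m3 : measurable_fun setT
    (fun w => B0 ^+ 8 + Delta ^+ 8 * (M ^+ 4 / n%:R * \sum_i y i w ^+ 8)).
  exact: measurable_funD.
have p1 w : 0 <= M ^+ 4 / n%:R * \sum_i y i w ^+ 8 by rewrite mulr_ge0.
have p2 w : 0 <= Delta ^+ 8 * (M ^+ 4 / n%:R * \sum_i y i w ^+ 8) by rewrite mulr_ge0.
have p3 w : 0 <= B0 ^+ 8 + Delta ^+ 8 * (M ^+ 4 / n%:R * \sum_i y i w ^+ 8).
  by rewrite addr_ge0 ?pow8_ge0.
apply: mean_leZ => //; [exact: measurable_funM|by move=> w; rewrite mulr_ge0|].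
apply: mean_leZ => //; apply: mean_leD => //; first by move=> w; exact: pow8_ge0.
  exact: mean_le_cst.
by apply: mean_leZ => //; apply: mean_leZ.
Qed.

Lemma resid_moment (S : {set 'I_n}) i k : i \notin S -> (k <= K)%N ->
  mean_le P (fun w => good_ind S w * (y i w - dot (x i w) (iter_on S k w)) ^+ 8) resid_cst.
Proof.
move=> iS kK.
have := @cond_resid8 _ _ _ P n d x y mD indepD Q lawD c m8 Qmgf Qy8 i (good_ind S)
  (iter_on S k) (measurable_good_ind_others iS) (good_ind_bounds S)
  (fun j => measurable_iter_others k j iS).
move=> h; apply: (le_trans h).
have := iter_moment S kK; rewrite /mean_le => h2.
rewrite /resid_cst [leRHS]EFinM; apply: lee_wpmul2l => //.
rewrite [leRHS]EFinD; apply: leeD2l => //; rewrite [leRHS]EFinM; apply: lee_wpmul2l => //.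
by rewrite lee_fin moment8_ge0.
Qed.

(** With [t] removed observations, the deterministic bound contributes [t ^ 3 / n ^ 4] times a sum
    of [t] residual powers. The indicator for [S] is relaxed to the one for [S'], which ignores the
    removed observations, so each term has mean at most [resid_cst]. *)
Lemma diff_moment (S S' : {set 'I_n}) k : S' \subset S -> (k <= K)%N ->
  mean_le P (fun w => good_ind S w * l2norm (iter_on S k w - iter_on S' k w) ^+ 8)
    (diff_cst * (#|S :\: S'|%:R / n%:R) ^+ 4).
Proof.
move=> sub kK.
have mn : measurable_fun setT (fun w => l2norm (iter_on S k w - iter_on S' k w)).
  apply: measurable_l2norm => j.
  rewrite (_ : (fun w => _) = fun w => iter_on S k w j 0 - iter_on S' k w j 0); last first.
    by apply/funext => w; rewrite !mxE.
  by apply: measurable_funB; exact: measurable_iter.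
pose t : R := #|S :\: S'|%:R.
have n0' : n%:R != 0 :> R by rewrite pnatr_eq0 -lt0n.
have E0 : 0 <= expR (M * Delta) ^+ 8 by rewrite exprn_ge0 ?expR_ge0.
have D0 := exprn_ge0 7 Delta0.
have Mn0 : 0 <= M ^+ 4 / n%:R ^+ 4 * t ^+ 3.
  by rewrite mulr_ge0 ?exprn_ge0// divr_ge0 ?exprn_ge0.
pose r s i w := good_ind S' w * (y i w - dot (x i w) (iter_on S' s w)) ^+ 8.
have mr s i : measurable_fun setT (r s i).
  by apply: measurable_funM; [exact: measurable_good_ind|apply: measurable_funX;
    exact: measurable_resid].
have r0 s i w : 0 <= r s i w by rewrite mulr_ge0 ?good_ind_ge0 ?pow8_ge0.
have mrs s : measurable_fun setT (fun w => \sum_(i in S :\: S') r s i w).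
  exact: measurable_bigsum.
have rs0 s w : 0 <= \sum_(i in S :\: S') r s i w by apply: sumr_ge0.
(* The condition [s < K] holds automatically; written as a filter, it supplies the sign of [delta s]
   to the lemmas on filtered sums. *)
pose F w := \sum_(0 <= s < k | (s < K)%N) delta s * \sum_(i in S :\: S') r s i w.
have mF : measurable_fun setT F.
  by apply: measurable_bigsum => s sk; exact: measurable_funM.
have F0 w : 0 <= F w by apply: sumr_ge0 => s sk; rewrite mulr_ge0 ?delta0.
have FE (g : nat -> R) : \sum_(0 <= s < k) g s = \sum_(0 <= s < k | (s < K)%N) g s.
  rewrite [LHS]big_nat_cond [RHS]big_nat_cond; apply: eq_bigl => s.
  rewrite /= andbT; case: (s < k)%N / idP => sk //.
  by rewrite (leq_trans sk kK).
have m1 : measurable_fun setT (fun w => M ^+ 4 / n%:R ^+ 4 * t ^+ 3 * F w).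
  exact: measurable_funM.
have p1 w : 0 <= M ^+ 4 / n%:R ^+ 4 * t ^+ 3 * F w by rewrite mulr_ge0.
have m2 : measurable_fun setT (fun w => Delta ^+ 7 * (M ^+ 4 / n%:R ^+ 4 * t ^+ 3 * F w)).
  exact: measurable_funM.
have p2 w : 0 <= Delta ^+ 7 * (M ^+ 4 / n%:R ^+ 4 * t ^+ 3 * F w) by rewrite mulr_ge0.
apply: (@mean_le_le _ _ _ P _ (fun w => expR (M * Delta) ^+ 8 *
  (Delta ^+ 7 * (M ^+ 4 / n%:R ^+ 4 * t ^+ 3 * F w)))).
- by apply: measurable_funM; [exact: measurable_good_ind|exact: measurable_funX].
- exact: measurable_funM.
- move=> w; rewrite mulr_ge0 ?good_ind_ge0 ?pow8_ge0//=.
  pose G := \sum_(0 <= s < k) delta s * \sum_(i in S :\: S')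
    (y i w - dot (x i w) (iter_on S' s w)) ^+ 8.
  apply: (@le_trans _ _ (good_ind S w * (expR (M * Delta) ^+ 8 * (Delta ^+ 7 *
      (M ^+ 4 / n%:R ^+ 4 * t ^+ 3 * G))))).
    apply: good_ind_le => hM.
    have := @gdm_diff8 R n d delta K Delta M n0 M0 delta0 deltaS S S' (design x w)
      (response y w) b0 k hM sub kK.
    move=> hh; apply: (le_trans hh); rewrite le_eqVlt; apply/orP; left; apply/eqP.
    congr (_ * (_ * (_ * _))); apply: eq_bigr => s _; congr (_ * _).
    by apply: eq_bigr => i _; rewrite responseE obs_design.
  rewrite mulrCA ler_wpM2l// mulrCA ler_wpM2l// mulrCA ler_wpM2l//.
  rewrite /G /F FE mulr_sumr; apply: ler_sum => s sK.
  rewrite mulrCA ler_wpM2l ?delta0// mulr_sumr; apply: ler_sum => i _.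
  by rewrite ler_wpM2r ?pow8_ge0// good_indS.
apply: (@mean_le_weak _ _ _ P _ (expR (M * Delta) ^+ 8 *
  (Delta ^+ 7 * (M ^+ 4 / n%:R ^+ 4 * t ^+ 3 * (Delta * (t * resid_cst)))))).
  by rewrite le_eqVlt; apply/orP; left; apply/eqP; rewrite /diff_cst -/t; field.
apply: mean_leZ => //; apply: mean_leZ => //; apply: mean_leZ => //.
have t0 : 0 <= t by [].
have res0 := resid_cst_ge0.
apply: (@mean_le_weak _ _ _ P _ (\sum_(0 <= s < k | (s < K)%N) delta s * (t * resid_cst))).
  by rewrite -FE -mulr_suml; apply: ler_wpM2r; [exact: mulr_ge0|exact: (deltaS kK)].
apply: mean_le_sum.
- by move=> s sK; exact: measurable_funM.
- by move=> s w sK; rewrite mulr_ge0 ?delta0.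
- move=> s sK; apply: mean_leZ => //; first exact: delta0.
  have -> : t * resid_cst = \sum_(i in S :\: S') resid_cst.
    by rewrite sumr_const -mulr_natl.
  apply: mean_le_sum => // i; rewrite !inE => /andP[iS' _].
  by apply: resid_moment => //; exact: ltnW.
Qed.

(** Observation [i] lies outside both sets and is independent of the displacement, so its
    directional moment applies. Cauchy-Schwarz would instead bring in the norm of [x i], which grows
    with the dimension. *)
Lemma cross_moment (S S' : {set 'I_n}) i k : S' \subset S -> i \notin S -> (k <= K)%N ->
  mean_le P (fun w => good_ind S w * dot (x i w) (iter_on S k w - iter_on S' k w) ^+ 8)
    (moment8 c * (diff_cst * (#|S :\: S'|%:R / n%:R) ^+ 4)).
Proof.
move=> sub iS kK.
have iS' : i \notin S' by apply: contra iS; move/fintype.subsetP: sub; apply.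
have := @cond_dot8 _ _ _ P n d x y mD indepD Q lawD c Qmgf i (good_ind S)
  (fun w => iter_on S k w - iter_on S' k w) (measurable_good_ind_others iS) (good_ind_ge0 S).
move=> h; rewrite /mean_le; apply: le_trans; first apply: h.
  move=> j.
  rewrite (_ : (fun w => _) = fun w => iter_on S k w j 0 - iter_on S' k w j 0); last first.
    by apply/funext => w; rewrite !mxE.
  apply: measurable_funB; exact: measurable_iter_others.
rewrite [leRHS]EFinM; apply: lee_wpmul2l; first by rewrite lee_fin moment8_ge0.
exact: diff_moment.
Qed.

End IterateMoments.

(** [expR (- x) >= 1 - x] bounds [expR x] by the inverse of [1 - x], and [(1 - x) (1 + x + 2 x^2) =
    1 + x^2 (1 - 2 x)] is at least 1 for [x <= 1 / 2]. *)
Lemma expR_le_quadratic {R : realType} (x : R) : `|x| <= 1 / 2 ->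
  expR x <= 1 + x + 2 * x ^+ 2.
Proof.
rewrite ler_norml => /andP[xl xu].
have h := @expR_ge1Dx R (- x); have e0 := expR_gt0 x.
have : expR x * expR (- x) = 1 by rewrite -expRD subrr expR0.
nra.
Qed.

(** The linear terms of the two quadratic bounds cancel under the weights [p] and [1 - p], leaving
    [1 + 2 l^2]. The constant 2 exceeds the sharp 1/8 and only affects the rate in the exponent. *)
Lemma centered_bernoulli_mgf {R : realType} (p l : R) : 0 <= p <= 1 -> `|l| <= 1 / 2 ->
  p * expR (l * (1 - p)) + (1 - p) * expR (l * (0 - p)) <= expR (2 * l ^+ 2).
Proof.
move=> /andP[p0 p1] hl.
have H q : `|q| <= 1 -> expR (l * q) <= 1 + l * q + 2 * l ^+ 2.
  move=> q1; have lq : `|l * q| <= 1 / 2.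
    by rewrite normrM -[leRHS]mulr1 ler_pM.
  apply: (le_trans (expR_le_quadratic lq)); rewrite lerD2l ler_wpM2l// exprMn.
  by rewrite ler_piMr ?sqr_ge0// -[q ^+ 2]real_normK ?num_real// expr_le1.
have h1 : expR (l * (1 - p)) <= 1 + l * (1 - p) + 2 * l ^+ 2.
  by apply: H; rewrite ler_norml; apply/andP; split; lra.
have h2 : expR (l * (0 - p)) <= 1 + l * (0 - p) + 2 * l ^+ 2.
  by apply: H; rewrite ler_norml; apply/andP; split; lra.
have := @expR_ge1Dx R (2 * l ^+ 2); nra.
Qed.

(** * Concentration within a block *)

Section ResidualLaw.
Context {R : realType} {d : nat}.
Notation sample := (borelType ('cV[R]_d * R)%type).
Variable Q : probability sample R.

Definition resid_cdf (b : 'cV[R]_d) (t : R) : R :=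
  fine (Q [set e | e.2 - dot e.1 b <= t]).

Lemma measurable_resid_joint d' (T : measurableType d') (v : T -> 'cV[R]_d) :
  (forall j, measurable_fun setT (fun z => v z j 0)) ->
  measurable_fun setT ((fun z => z.2.2 - dot z.2.1 (v z.1)) : T * sample -> R).
Proof.
move=> mv; apply: measurable_funB.
  apply: (@measurableT_comp _ _ _ _ sample _ (fun e => e.2) _ snd) => //.
  exact: measurable_sample_snd.
apply: measurable_dot => j.
- apply: (@measurableT_comp _ _ _ _ sample _ (fun e => e.1 j 0) _ snd) => //.
  exact: measurable_fst_coord.
- exact: (@measurableT_comp _ _ _ _ T _ (fun w => v w j 0) _ fst).
Qed.

Lemma measurable_resid_le (b : 'cV[R]_d) t :
  measurable ([set e | e.2 - dot e.1 b <= t] : set sample).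
Proof.
apply: measurable_le_set => //; apply: measurable_funB; first exact: measurable_sample_snd.
exact: measurable_sample_dot.
Qed.

Lemma resid_cdfE (b : 'cV[R]_d) t : Q [set e | e.2 - dot e.1 b <= t] = (resid_cdf b t)%:E.
Proof. by rewrite fineK// fin_num_measure//; exact: measurable_resid_le. Qed.

Lemma resid_cdf_bounds (b : 'cV[R]_d) t : 0 <= resid_cdf b t <= 1.
Proof.
rewrite -!lee_fin -resid_cdfE measure_ge0 probability_le1//.
exact: measurable_resid_le.
Qed.

Lemma measurable_resid_cdf d' (T : measurableType d') (v : T -> 'cV[R]_d) t :
  (forall j, measurable_fun setT (fun z => v z j 0)) ->
  measurable_fun setT (fun z => resid_cdf (v z) t).
Proof.
move=> mv; pose A : set (T * sample) := [set z | z.2.2 - dot z.2.1 (v z.1) <= t].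
have mA : measurable A.
  by apply: measurable_le_set => //; exact: measurable_resid_joint.
rewrite (_ : (fun z => _) = fun z => fine (Q (xsection A z))).
  apply: measurableT_comp => //.
  exact: (measurable_fun_xsection Q mA).
apply/funext => z; rewrite /resid_cdf; congr (fine (Q _)).
by apply/seteqP; split => e; rewrite /xsection /= inE.
Qed.

Lemma resid_mgf (b : 'cV[R]_d) (t l : R) : `|l| <= 1 / 2 ->
  (\int[Q]_e (expR (l * ((e.2 - dot e.1 b <= t)%R%:R - resid_cdf b t)))%:E <=
   (expR (2 * l ^+ 2))%:E)%E.
Proof.
move=> hl; set p := resid_cdf b t; set A : set sample := [set e | e.2 - dot e.1 b <= t].
have mA : measurable A by exact: measurable_resid_le.
have mI : measurable_fun setT (\1_A : sample -> R) by exact: measurable_indic.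
have mI' : measurable_fun setT (\1_(~` A) : sample -> R).
  by apply: measurable_indic; exact: measurableC.
have /andP[p0 p1] : 0 <= p <= 1 by exact: resid_cdf_bounds.
have -> : (\int[Q]_e (expR (l * ((e.2 - dot e.1 b <= t)%R%:R - p)))%:E =
   \int[Q]_e ((expR (l * (1 - p)))%:E * (\1_A e)%:E +
              (expR (l * (0 - p)))%:E * (\1_(~` A) e)%:E))%E.
  apply: eq_integral => e _; rewrite -!EFinM -EFinD; congr (_%:E).
  rewrite !indicE in_setC; case: (boolP (e.2 - dot e.1 b <= t)) => h.
    by rewrite (mem_set (h : A e)) /= mulr1 mulr0 addr0.
  rewrite (_ : (e \in A) = false) /= ?mulr1 ?mulr0 ?add0r//.
  by apply/negbTE; apply/negP => /set_mem; rewrite /A /= (negbTE h).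
have i0 (B : set sample) e : 0 <= \1_B e :> R by rewrite indicE ler0n.
have f0 (a : R) (B : set sample) e : setT e -> (0 <= (expR a)%:E * (\1_B e)%:E)%E.
  by move=> _; rewrite -EFinM lee_fin mulr_ge0 ?expR_ge0.
have mf (a : R) (B : set sample) : measurable_fun setT (\1_B : sample -> R) ->
    measurable_fun setT (fun e : sample => (expR a)%:E * (\1_B e)%:E)%E.
  by move=> mB; apply: emeasurable_funM => //; exact/measurable_EFinP.
rewrite (ge0_integralD _ _ (f0 _ A) (mf _ _ mI) (f0 _ (~` A)) (mf _ _ mI'))//.
rewrite !ge0_integralZl_EFin ?expR_ge0//; try (by move=> e _; rewrite lee_fin);
  try exact/measurable_EFinP.
have QA : Q A = p%:E by exact: resid_cdfE.
have QA' : Q (~` A) = (1 - p)%:E by rewrite probability_setC// QA.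
rewrite !integral_indic//; last exact: measurableC.
apply: (@le_trans _ _ ((expR (l * (1 - p)))%:E * p%:E + (expR (l * (0 - p)))%:E * (1 - p)%:E)%E).
  by rewrite !setIT le_eqVlt; apply/orP; left; apply/eqP; congr (_ * _ + _ * _)%E.
rewrite -!EFinM -EFinD lee_fin mulrC [X in _ + X]mulrC.
by apply: centered_bernoulli_mgf => //; rewrite p0.
Qed.

End ResidualLaw.

Section Hoeffding.
Context {R : realType} {disp : measure_display} {Omega : measurableType disp}.
Variable P : probability Omega R.
Variables (n d : nat).
Notation sample := (borelType ('cV[R]_d * R)%type).
Variables (x : 'I_n -> Omega -> 'cV[R]_d) (y : 'I_n -> Omega -> R).
Notation D := (fun i w => (x i w, y i w)).
Hypothesis mD : forall i, measurable_fun setT (D i : Omega -> sample).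
Hypothesis indepD : mutually_independent P D.
Variable Q : probability sample R.
Hypothesis lawD : forall i (A : set sample), measurable A -> P (D i @^-1` A) = Q A.
Notation others i := (g_sigma_algebraType (other_events D i)).

Definition resid_dev (v : Omega -> 'cV[R]_d) (t : R) i w : R :=
  (y i w - dot (x i w) (v w) <= t)%R%:R - resid_cdf Q (v w) t.

Lemma measurable_resid_dev d' (T : measurableType d') (f : T -> Omega)
    (v : Omega -> 'cV[R]_d) (t : R) i :
  measurable_fun setT (D i \o f : T -> sample) ->
  (forall j, measurable_fun setT (fun z => v (f z) j 0)) ->
  measurable_fun setT (fun z => resid_dev v t i (f z)).
Proof.
move=> mDi mv; apply: measurable_funB; last exact: measurable_resid_cdf.
pose A : set T := [set z | y i (f z) - dot (x i (f z)) (v (f z)) <= t].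
have mA : measurable A.
  apply: measurable_le_set => //; apply: measurable_funB; first exact: (measurable_y_gen mDi).
  by apply: measurable_dot => // j; exact: (measurable_x_gen j mDi).
rewrite (_ : (fun z => _) = (\1_A : T -> R)); first exact: measurable_indic.
by apply/funext => z; rewrite indicE; congr (_%:R); congr nat_of_bool; apply/idP/idP; rewrite inE.
Qed.

(* Integrating out one observation at a time only uses that it is independent of
   all the others. *)
Lemma resid_dev_mgf (A : seq 'I_n) (v : Omega -> 'cV[R]_d) (t l : R) : uniq A -> `|l| <= 1 / 2 ->
  (forall i, i \in A -> forall j, measurable_fun setT ((fun w => v w j 0) : others i -> R)) ->
  (\int[P]_w (expR (l * \sum_(i <- A) resid_dev v t i w))%:E <=
   (expR (2 * l ^+ 2 * (size A)%:R))%:E)%E.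
Proof.
move=> uA hl; elim: A uA => [_ _|i A IH /= /andP[iA uA] mv].
  under eq_integral do rewrite big_nil mulr0 expR0.
  by rewrite integral_cst_probability mulr0 expR0.
have mvA j : j \in A -> forall k, measurable_fun setT ((fun w => v w k 0) : others j -> R).
  by move=> jA; apply: mv; rewrite inE jA orbT.
have mvi := mv i (mem_head _ _).
have {}IH := IH uA mvA.
pose E w := expR (l * \sum_(j <- A) resid_dev v t j w).
have mE : measurable_fun setT (E : others i -> R).
  apply: measurableT_comp => //; apply: measurable_funM => //.
  rewrite (_ : (fun w => _) = fun w => \sum_(j <- A | j != i) resid_dev v t j w); last first.
    apply/funext => w; rewrite [LHS]big_seq_cond [RHS]big_seq_cond; apply: eq_bigl => j /=.
    by case: (boolP (j \in A)) => //= jA; apply/esym; apply: contraNneq iA => <-.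
  apply: measurable_bigsum => j ji.
  apply: (@measurable_resid_dev _ (others i) id) => //.
  exact: measurable_other.
have mE' : measurable_fun setT E := measurable_of_other mD mE.
have E0 w : 0 <= E w by exact: expR_ge0.
pose g (z : others i * sample) := (E z.1 *
  expR (l * ((z.2.2 - dot z.2.1 (v z.1) <= t)%R%:R - resid_cdf Q (v z.1) t)))%:E.
have mh : measurable_fun setT (fun z : others i * sample =>
    expR (l * ((z.2.2 - dot z.2.1 (v z.1) <= t)%R%:R - resid_cdf Q (v z.1) t))).
  apply: measurableT_comp => //; apply: measurable_funM => //; apply: measurable_funB.
    pose B : set (others i * sample) := [set z | z.2.2 - dot z.2.1 (v z.1) <= t].
    have mB : measurable B.
      by apply: measurable_le_set => //; exact: measurable_resid_joint.
    rewrite (_ : (fun z => _) = (\1_B : others i * sample -> R)); first exact: measurable_indic.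
    by apply/funext => z; rewrite indicE; congr (_%:R); congr nat_of_bool; apply/idP/idP; rewrite inE.
  apply: measurable_resid_cdf => j.
  exact: (@measurableT_comp _ _ _ _ (others i) _ (fun w => v w j 0) _ fst).
have mg : measurable_fun setT g.
  apply/measurable_EFinP; apply: measurable_funM => //.
  exact: (@measurableT_comp _ _ _ _ (others i) _ E _ fst).
have g0 z : (0 <= g z)%E by rewrite lee_fin mulr_ge0 ?expR_ge0.
have -> : (\int[P]_w (expR (l * \sum_(j <- i :: A) resid_dev v t j w))%:E =
    \int[P]_w g (w, D i w))%E.
  apply: eq_integral => w _; rewrite big_cons mulrDr expRD mulrC.
  by rewrite /g.
rewrite (sample_fubini mD indepD lawD mg g0).
have mI : measurable_fun (setT : set Omega) (fun w : Omega => (\int[Q]_e g (w, e))%E).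
  have := @measurable_fun_fubini_tonelli_F _ _ (others i) sample R Q g mg g0.
  by move=> mF; apply: (measurable_of_other mD); exact: mF.
apply: (@le_trans _ _ (\int[P]_w ((expR (2 * l ^+ 2))%:E * (E w)%:E))%E).
  apply: ge0_le_integral => //.
  - by move=> w _; apply: integral_ge0.
  - by apply: emeasurable_funM => //; exact/measurable_EFinP.
  - move=> w _; rewrite /g; under eq_integral do rewrite /= EFinM.
    rewrite ge0_integralZl_EFin//; last first.
      apply/measurable_EFinP.
      exact: (measurableT_comp mh (pair1_measurable (w : others i))).
    by rewrite muleC lee_wpmul2r ?lee_fin//; exact: resid_mgf.
rewrite ge0_integralZl_EFin ?expR_ge0//; last 2 first.
- by move=> w _; rewrite lee_fin.
- exact/measurable_EFinP.
have -> : 2 * l ^+ 2 * (size A).+1%:R = 2 * l ^+ 2 + 2 * l ^+ 2 * (size A)%:R.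
  by rewrite -[(size A).+1%:R]natr1; ring.
rewrite expRD [leRHS]EFinM.
by apply: lee_wpmul2l => //; rewrite lee_fin expR_ge0.
Qed.

(** The choice [|l| = eps / 4] minimises [2 l^2 m - l eps m] and gives [- eps^2 m / 8]; the bound
    [eps <= 2] keeps [|l|] within the range of the Laplace bound. The size of [A] is only bounded by
    [m] because the last block may be incomplete. *)
Lemma resid_dev_tail (A : seq 'I_n) (m : nat) (v : Omega -> 'cV[R]_d) (t eps : R) : uniq A -> (size A <= m)%N ->
  0 <= eps <= 2 ->
  (forall i, i \in A -> forall j, measurable_fun setT ((fun w => v w j 0) : others i -> R)) ->
  (forall j, measurable_fun setT (fun w => v w j 0)) ->
  (P [set w | (eps * m%:R <= `|\sum_(i <- A) resid_dev v t i w|)%R] <=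
    (2 * expR (- (eps ^+ 2 * m%:R / 8)))%:E)%E.
Proof.
move=> uA Am /andP[e0 e2] mv mv'.
pose S w := \sum_(i <- A) resid_dev v t i w.
have mS : measurable_fun setT S.
  apply: measurable_bigsum => i _; apply: (@measurable_resid_dev _ Omega id) => //.
  exact: mD.
have H (l : R) : `|l| = eps / 4 ->
    (P [set w | (expR (eps / 4 * (eps * m%:R)) <= expR (l * S w))%R] <=
     (expR (- (eps ^+ 2 * m%:R / 8)))%:E)%E.
  move=> hl.
  have l1 : `|l| <= 1 / 2 by rewrite hl; lra.
  have l2 : l ^+ 2 = eps ^+ 2 / 16 by rewrite -(real_normK (num_real l)) hl expr_div_n; congr (_ / _); ring.
  have hm : mean_le P (fun w => expR (l * S w)) (expR (2 * l ^+ 2 * m%:R)).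
    apply: le_trans; first exact: (resid_dev_mgf t uA l1 mv).
    rewrite lee_fin ler_expR; apply: ler_wpM2l; last by rewrite ler_nat.
    by rewrite mulr_ge0// sqr_ge0.
  have mE : measurable_fun setT (fun w => expR (l * S w)).
    by apply: measurableT_comp => //; exact: measurable_funM.
  apply: (le_trans (mean_le_markov (expR_gt0 _) mE (fun w => expR_ge0 _) hm)).
  rewrite lee_fin -expRN -expRD ler_expR le_eqVlt; apply/orP; left; apply/eqP.
  by rewrite l2; field.
have mH (l : R) : measurable [set w | expR (eps / 4 * (eps * m%:R)) <= expR (l * S w)].
  apply: measurable_le_set => //; apply: measurableT_comp => //; exact: measurable_funM.
apply: (@le_trans _ _ (P ([set w | (expR (eps / 4 * (eps * m%:R)) <= expR (eps / 4 * S w))%R] `|`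
   [set w | (expR (eps / 4 * (eps * m%:R)) <= expR (- (eps / 4) * S w))%R]))).
  apply: le_measure; rewrite ?inE.
  - by apply: measurable_le_set => //; apply: measurableT_comp.
  - by apply: measurableU; exact: mH.
  - move=> w /=; rewrite !ler_expR => h.
    have e4 : 0 <= eps / 4 by lra.
    case: (lerP 0 (S w)) h => s0 h; [left|right].
      by rewrite ler_wpM2l// -[leRHS](ger0_norm s0).
    by rewrite mulNr -mulrN ler_wpM2l// -(ltr0_norm s0).
apply: (le_trans (measureU2 _ (mH _) (mH _))).
rewrite mulrDl mul1r EFinD; apply: leeD; apply: H; rewrite ?normrN ger0_norm//; lra.
Qed.

End Hoeffding.

(** * Empirical distribution functions and quantiles *)

Section EmpiricalQuantile.
Context {R : realType}.
Implicit Types (s : seq R) (q t : R) (F G : R -> R).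

Definition ecdf s t : R := (count (fun r => r <= t) s)%:R / (size s)%:R.

(** These bounds on the index [j], counted from 0, summarise the ceiling. At [q = 0] the truncated
    predecessor returns 0 and they still hold. *)
Lemma quantile_rank s q : (0 < size s)%N -> 0 <= q <= 1 ->
  let j := (`|Num.ceil ((size s)%:R * q)|%N).-1 in
  [/\ (j < size s)%N, (size s)%:R * q <= j.+1%:R & j%:R <= (size s)%:R * q].
Proof.
move=> s0 /andP[q0 q1] j.
have s0' : 0 < (size s)%:R :> R by rewrite ltr0n.
have nq0 : 0 <= (size s)%:R * q by rewrite mulr_ge0.
have c0 : (0 <= Num.ceil ((size s)%:R * q))%R by rewrite -(ceil0 R); exact: le_ceil.
have cE : (`|Num.ceil ((size s)%:R * q)|%N)%:R = (Num.ceil ((size s)%:R * q))%:~R :> R.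
  by rewrite natr_absz ger0_norm.
have cge := ceil_ge ((size s)%:R * q).
have clt : (Num.ceil ((size s)%:R * q))%:~R < (size s)%:R * q + 1.
  by have := ceilB1_lt ((size s)%:R * q); rewrite intrD ltrBlDr.
rewrite -cE in cge clt.
have [jE|jE] : (`|Num.ceil ((size s)%:R * q)|%N = 0%N) \/ (`|Num.ceil ((size s)%:R * q)|%N = j.+1).
  by rewrite /j; case: (`|_|%N) => [|m]; [left|right].
  have j0 : j = 0%N by rewrite /j jE.
  by rewrite j0; split => //; rewrite jE in cge; apply: (le_trans cge).
rewrite jE in cge clt; split => //.
  have : j.+1%:R < (size s)%:R + 1 :> R.
    by apply: (lt_le_trans clt); rewrite lerD2r ler_piMr// ltW.
  by rewrite natr1 ltr_nat ltnS.
by move: clt; rewrite -natr1 ltrD2r => /ltW.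
Qed.

(** The first [j + 1] entries of the sorted list are all counted; ties can only add to them. *)
Lemma count_sort_ge s j : (j < size s)%N ->
  (j < count (fun r => r <= nth 0 (sort <=%R s) j)%R s)%N.
Proof.
move=> js; set u := sort <=%R s; set a := (fun r => _).
have pu : perm_eq u s by rewrite /u perm_sort.
have su : size u = size s by rewrite size_sort.
have so : sorted <=%R u by apply: sort_sorted; exact: le_total.
rewrite -(permP pu) -(cat_take_drop j.+1 u) count_cat.
have -> : count a (take j.+1 u) = j.+1.
  have -> : count a (take j.+1 u) = size (take j.+1 u).
    apply/eqP; rewrite -all_count; apply/(all_nthP 0) => i.
    rewrite size_take su => hi.
    have ij : (i < j.+1)%N by move: hi; case: ifP => //; lia.
    rewrite nth_take// /a; apply: (sorted_leq_nth le_trans le_refl) => //; rewrite inE su//; lia.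
  by rewrite size_take su; case: ifP => //; lia.
by rewrite addSn ltnS leq_addr.
Qed.

Lemma count_sort_le s j t : (j < size s)%N -> t < nth 0 (sort <=%R s) j ->
  (count (fun r => r <= t)%R s <= j)%N.
Proof.
move=> js; set u := sort <=%R s => tu; set a := (fun r => _).
have pu : perm_eq u s by rewrite /u perm_sort.
have su : size u = size s by rewrite size_sort.
have so : sorted <=%R u by apply: sort_sorted; exact: le_total.
rewrite -(permP pu) -(cat_take_drop j u) count_cat.
have -> : count a (drop j u) = 0%N.
  apply/eqP; rewrite -leqn0 leqNgt -has_count; apply/hasPn => r /(nthP 0) [i].
  rewrite size_drop su => hi <-; rewrite nth_drop /a -ltNge; apply: (lt_le_trans tu).
  apply: (sorted_leq_nth le_trans le_refl) => //; rewrite ?inE ?su//; lia.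
by rewrite addn0; apply: (leq_trans (count_size _ _)); rewrite size_take; case: ifP => //; lia.
Qed.

Lemma ecdf_quantile_ge s q : (0 < size s)%N -> 0 <= q <= 1 -> q <= ecdf s (quantile s q).
Proof.
move=> s0 q01; have [js jq _] := quantile_rank s0 q01.
rewrite /ecdf ler_pdivlMr ?ltr0n// mulrC; apply: (le_trans jq).
by rewrite ler_nat; exact: count_sort_ge.
Qed.

Lemma ecdf_quantile_le s q t : (0 < size s)%N -> 0 <= q <= 1 -> t < quantile s q ->
  ecdf s t <= q.
Proof.
move=> s0 q01 tq; have [js _ jq] := quantile_rank s0 q01.
rewrite /ecdf ler_pdivrMr ?ltr0n// mulrC; apply: le_trans jq.
by rewrite ler_nat; exact: count_sort_le.
Qed.

Lemma quantile_le s q1 q2 : (0 < size s)%N -> 0 <= q1 -> q1 <= q2 -> q2 <= 1 ->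
  quantile s q1 <= quantile s q2.
Proof.
move=> s0 q10 q12 q21.
have h1 : 0 <= q1 <= 1 by rewrite q10 (le_trans q12).
have h2 : 0 <= q2 <= 1 by rewrite (le_trans q10).
have [j1s _ _] := quantile_rank s0 h1; have [j2s _ _] := quantile_rank s0 h2.
have so : sorted <=%R (sort <=%R s) by apply: sort_sorted; exact: le_total.
apply: (sorted_leq_nth le_trans le_refl) => //; rewrite ?inE ?size_sort//.
have c0 q : 0 <= q -> (0 <= Num.ceil ((size s)%:R * q))%R.
  by move=> q0; rewrite -(ceil0 R); apply: le_ceil; rewrite mulr_ge0.
have : (Num.ceil ((size s)%:R * q1) <= Num.ceil ((size s)%:R * q2))%R.
  by apply: le_ceil; rewrite ler_wpM2l.
have := c0 q1 q10; have := c0 q2 (le_trans q10 q12); lia.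
Qed.

(** The empirical function is at least [q] at the quantile and at most [q] strictly to its left, but
    may jump in between. Stepping left by [eta] avoids the jump, at the cost [kappa * eta] for the
    Lipschitz function [F]. *)
Lemma cdf_quantile s F q rho kappa eta : (0 < size s)%N -> 0 <= q <= 1 -> 0 < eta ->
  (forall t, `|ecdf s t - F t| <= rho) ->
  (forall t u, t <= u -> 0 <= F u - F t <= kappa * (u - t)) ->
  `|F (quantile s q) - q| <= rho + kappa * eta.
Proof.
move=> s0 q01 e0 hF lF; set a := quantile s q.
have ha : a - eta <= a by rewrite gerBl ltW.
have /andP[f0 f1] := lF _ _ ha; rewrite opprB addrCA subrr addr0 in f1.
have q1 := ecdf_quantile_ge s0 q01; have q2 : ecdf s (a - eta) <= q.
  by apply: ecdf_quantile_le => //; rewrite gtrBl.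
have := hF a; have := hF (a - eta); rewrite -/a in q1.
rewrite !ler_norml => /andP[a1 a2] /andP[b1 b2]; apply/andP; split; lra.
Qed.

(** Polya's argument: between two consecutive grid points the monotone [G] is squeezed by its values
    there, and [F] varies by at most [kappa * eta]. Outside the range of the grid, monotonicity
    leaves an error of at most the tail mass [e]. *)
Lemma grid_uniform F G (N eta rho kappa e : R) (A : nat) : 0 < eta -> 0 <= e ->
  (forall t u, t <= u -> G t <= G u) -> (forall t, 0 <= G t <= 1) ->
  (forall t u, t <= u -> 0 <= F u - F t <= kappa * (u - t)) -> (forall t, 0 <= F t <= 1) ->
  (forall a, (a <= A)%N -> `|G (- N + a%:R * eta) - F (- N + a%:R * eta)| <= rho) ->
  2 * N <= A%:R * eta -> F (- N) <= e -> 1 - e <= F N ->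
  forall t, `|G t - F t| <= rho + kappa * eta + e.
Proof.
move=> eta0 e0 mG G01 lF F01 hA NA FN FN' t.
have k0 : 0 <= kappa * eta.
  by have /andP[h1 h2] := lF 0 eta (ltW eta0); rewrite subr0 in h2; exact: le_trans h2.
have rho0 : 0 <= rho by apply: le_trans (hA 0%N (leq0n A)); exact: normr_ge0.
have /andP[g0 g1] := G01 t; have /andP[f0 f1] := F01 t.
case: (ltrP t (- N)) => [tN|Nt].
  have := hA 0%N (leq0n A); rewrite mul0r addr0.
  have := mG _ _ (ltW tN); have /andP[h _] := lF _ _ (ltW tN).
  rewrite !ler_norml => h1 /andP[h2 h3]; apply/andP; split; lra.
case: (lerP (- N + A%:R * eta) t) => [At|tA].
  have := hA A (leqnn A); have := mG _ _ At; have /andP[h _] := lF _ _ At.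
  have NN : N <= - N + A%:R * eta by lra.
  have /andP[h' _] := lF _ _ NN.
  rewrite !ler_norml => h1 /andP[h2 h3]; apply/andP; split; lra.
have u0 : 0 <= (t + N) / eta by rewrite divr_ge0 ?(ltW eta0)//; lra.
have /andP[ua ub] := truncn_itv u0; set a := Num.truncn _ in ua ub.
rewrite ler_pdivlMr// in ua; rewrite ltr_pdivrMr// in ub.
have aA : (a < A)%N.
  by rewrite -(ltr_nat R) -(ltr_pM2r eta0); apply: (le_lt_trans ua); lra.
have ta : - N + a%:R * eta <= t by lra.
have tb : t <= - N + a.+1%:R * eta by lra.
have := hA a (ltnW aA); have := hA a.+1 aA.
have := mG _ _ ta; have := mG _ _ tb.
have tt : - N + a%:R * eta <= - N + a.+1%:R * eta by lra.
have /andP[h1 _] := lF _ _ ta; have /andP[h2 _] := lF _ _ tb; have /andP[_ h3] := lF _ _ tt.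
have h4 : kappa * (- N + a.+1%:R * eta - (- N + a%:R * eta)) = kappa * eta.
  by rewrite -natr1; ring.
rewrite h4 in h3.
rewrite !ler_norml => h5 h6 /andP[h7 h8] /andP[h9 h10]; apply/andP; split; lra.
Qed.

(** The last block may be incomplete and blocks with large [l] are empty, so [l] may range over all
    numbers below [n] whatever the value of [b]. *)
Definition block (n b l : nat) : {set 'I_n} := [set i : 'I_n | (i %/ b == l)%N]%SET.

Lemma card_block n b l : (0 < b)%N -> (#|block n b l| <= b)%N.
Proof.
move=> b0.
have -> : #|block n b l| = size [seq val i | i <- enum (block n b l)].
  by rewrite size_map -cardE.
rewrite -[leqRHS](size_iota (l * b)); apply: uniq_leq_size.
  by rewrite map_inj_uniq ?enum_uniq//; exact: val_inj.
move=> j /mapP [i]; rewrite mem_enum inE => /eqP il ->.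
by rewrite mem_iota /= -il; have := divn_eq i b; have := ltn_pmod i b0; lia.
Qed.

(** At most [n %/ b + 1] blocks are nonempty, and [(n %/ b + 1) * b] is at most [2 * n] because
    [b <= n]. *)
Lemma sum_blocks (n b : nat) (z : 'I_n -> R) (e : R) : (0 < b <= n)%N -> 0 <= e ->
  (forall l, (l < n)%N -> `|\sum_(i in block n b l) z i| <= e * b%:R) ->
  `|\sum_i z i| <= 2 * e * n%:R.
Proof.
move=> /andP[b0 bn] e0 h.
have E : \sum_i z i = \sum_(l < (n %/ b).+1) \sum_(i in block n b l) z i.
  have p (i : 'I_n) : (i %/ b < (n %/ b).+1)%N by rewrite ltnS leq_div2r// ltnW.
  rewrite (partition_big (fun i : 'I_n => Ordinal (p i)) predT)//=.
  by apply: eq_bigr => l _; apply: eq_bigl => i; rewrite inE -val_eqE.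
rewrite E; apply: (le_trans (ler_norm_sum _ _ _)).
apply: (@le_trans _ _ (\sum_(l < (n %/ b).+1) e * b%:R)).
  apply: ler_sum => l _; case: (ltnP l n) => [|nl]; first exact: h.
  rewrite big1 ?normr0 ?mulr_ge0// => i; rewrite inE => /eqP il.
  by have := leq_div i b; have := ltn_ord i; lia.
rewrite sumr_const card_ord -[leLHS]mulr_natr -mulrA -natrM.
rewrite [2 * e]mulrC -mulrA -natrM; apply: ler_wpM2l => //; rewrite ler_nat.
have := leq_trunc_div n b; lia.
Qed.

Lemma ecdfE n (r : 'I_n -> R) t :
  ecdf [seq r i | i : 'I_n] t = n%:R^-1 * \sum_(i < n) (r i <= t)%R%:R.
Proof.
rewrite /ecdf size_map size_enum_ord mulrC; congr (_ * _).
rewrite count_map -sum1_count natr_sum [LHS]big_mkcond /= big_enum /=.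
by apply: eq_bigr => i _; case: (_ <= _).
Qed.

(* Replacing the leave-one-out residuals [r] by the leave-block-out residuals
   [r'] makes the indicators within a block conditionally independent. *)
Lemma ecdf_cdf_close n b (r r' : 'I_n -> R) (Fl : nat -> R -> R) F (N eta rho kappa e : R)
    (A : nat) : (0 < b <= n)%N -> 0 < eta -> 0 <= e ->
  (forall t u, t <= u -> 0 <= F u - F t <= kappa * (u - t)) -> (forall t, 0 <= F t <= 1) ->
  (forall i, `|r i - r' i| <= eta) ->
  (forall l t, (l < n)%N -> `|Fl l t - F t| <= rho) ->
  (forall a l, (a <= A)%N -> (l < n)%N ->
    `|\sum_(i in block n b l) ((r' i <= - N + a%:R * eta)%R%:R - Fl l (- N + a%:R * eta))|
      <= e * b%:R) ->
  2 * N <= A%:R * eta -> F (- N) <= e -> 1 - e <= F N ->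
  forall t, `|ecdf [seq r i | i : 'I_n] t - F t| <= rho + 2 * kappa * eta + 3 * e.
Proof.
move=> bn eta0 e0 lF F01 rr hFl hB NA FN FN'.
have n0 : (0 < n)%N by move: bn => /andP[]; lia.
have n0' : 0 < n%:R :> R by rewrite ltr0n.
pose G t := n%:R^-1 * \sum_(i < n) (r' i <= t)%R%:R : R.
have ind (a c : bool) : (a -> c) -> a%:R <= c%:R :> R by move=> ac; rewrite ler_nat; case: a c ac => [] [] // /(_ isT).
have hG a : (a <= A)%N -> `|G (- N + a%:R * eta) - F (- N + a%:R * eta)| <= rho + 2 * e.
  move=> aA; set t := - N + a%:R * eta.
  have h1 : `|\sum_i ((r' i <= t)%R%:R - Fl (i %/ b)%N t)| <= 2 * e * n%:R.
    apply: (@sum_blocks n b _ e bn e0) => l ln; have := hB a l aA ln.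
    rewrite (eq_bigr (fun i => (r' i <= t)%R%:R - Fl (i %/ b)%N t))// => i.
    by rewrite inE => /eqP ->.
  have h2 : `|\sum_(i < n) (Fl (i %/ b)%N t - F t)| <= rho * n%:R.
    apply: (le_trans (ler_norm_sum _ _ _)).
    apply: (@le_trans _ _ (\sum_(i < n) rho)); last by rewrite sumr_const card_ord mulr_natr.
    by apply: ler_sum => i _; apply: hFl; exact: leq_ltn_trans (leq_div i b) (ltn_ord i).
  have -> : G t - F t = n%:R^-1 * (\sum_i ((r' i <= t)%R%:R - Fl (i %/ b)%N t) +
      \sum_(i < n) (Fl (i %/ b)%N t - F t)).
    rewrite -big_split /= (eq_bigr (fun i => (r' i <= t)%R%:R - F t)); last first.
      by move=> i _; rewrite addrA subrK.
    by rewrite sumrB sumr_const card_ord mulrBr /G -[F t *+ n]mulr_natl mulKf ?gt_eqF.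
  rewrite normrM gtr0_norm ?invr_gt0// mulrC ler_pdivrMr//.
  by apply: (le_trans (ler_normD _ _)); rewrite mulrDl addrC lerD.
have mG t u : t <= u -> G t <= G u.
  move=> tu; rewrite ler_wpM2l ?invr_ge0// ler_sum// => i _.
  by apply: ind => h; exact: le_trans h tu.
have G01 t : 0 <= G t <= 1.
  apply/andP; split; first by rewrite mulr_ge0 ?invr_ge0 ?sumr_ge0.
  rewrite /G mulrC ler_pdivrMr// mul1r; apply: (@le_trans _ _ (\sum_(i < n) 1)).
    by apply: ler_sum => i _; case: (r' i <= t); rewrite ?lexx ?ler01.
  by rewrite sumr_const card_ord.
have hu := grid_uniform eta0 e0 mG G01 lF F01 hG NA FN FN'.
move=> t; rewrite ecdfE.
(* Perturbing the residuals by at most [eta] shifts their empirical function horizontally by at most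
   [eta]; moving [F] along costs the second [kappa * eta]. *)
have u1 : n%:R^-1 * \sum_(i < n) (r i <= t)%R%:R <= G (t + eta).
  rewrite ler_wpM2l ?invr_ge0// ler_sum// => i _; apply: ind => h.
  by have := rr i; rewrite ler_norml => /andP[]; lra.
have u2 : G (t - eta) <= n%:R^-1 * \sum_(i < n) (r i <= t)%R%:R.
  rewrite ler_wpM2l ?invr_ge0// ler_sum// => i _; apply: ind => h.
  by have := rr i; rewrite ler_norml => /andP[]; lra.
have t1 : t <= t + eta by lra.
have t2 : t - eta <= t by lra.
have /andP[_ f1] := lF _ _ t1; have /andP[_ f2] := lF _ _ t2.
have e1 : kappa * (t + eta - t) = kappa * eta by ring.
have e2 : kappa * (t - (t - eta)) = kappa * eta by ring.
rewrite e1 in f1; rewrite e2 in f2.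
have := hu (t + eta); have := hu (t - eta).
rewrite !ler_norml => /andP[h1 h2] /andP[h3 h4]; apply/andP; split; lra.
Qed.

End EmpiricalQuantile.

(** * Regularity and tails of the residual distribution function *)

Section ResidualCdf.
Context {R : realType} {d : nat}.
Notation sample := (borelType ('cV[R]_d * R)%type).
Variable Q : probability sample R.
Variables (c m8 kappa : R).
Hypothesis c0 : 0 <= c.
Hypothesis Qmgf : forall v : 'cV[R]_d,
  (\int[Q]_e (expR (dot e.1 v))%:E <= (expR (l2norm v + c * l2norm v ^+ 2))%:E)%E.
Hypothesis Qy8 : (\int[Q]_e (e.2 ^+ 8)%:E <= m8%:E)%E.
Hypothesis Qlip : forall (b : 'cV[R]_d) (t u : R), t <= u ->
  resid_cdf Q b u - resid_cdf Q b t <= kappa * (u - t).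

Lemma measurable_sample_resid (b : 'cV[R]_d) :
  measurable_fun setT (fun e : sample => e.2 - dot e.1 b).
Proof.
by apply: measurable_funB; [exact: measurable_sample_snd|exact: measurable_sample_dot].
Qed.

Lemma resid_cdf_lip (b : 'cV[R]_d) (t u : R) : t <= u ->
  0 <= resid_cdf Q b u - resid_cdf Q b t <= kappa * (u - t).
Proof.
move=> tu; rewrite Qlip// andbT subr_ge0 -lee_fin -!resid_cdfE.
apply: le_measure; rewrite ?inE; try exact: measurable_resid_le.
by move=> e /= h; exact: le_trans tu.
Qed.

(** Both residuals are taken on the same sample: either they differ by less than [eta], which costs
    a shift of the threshold, or the inner product with [b' - b] is large, which the eighth moment
    makes unlikely. *)
Lemma resid_cdf_shift_le (b b' : 'cV[R]_d) (t eta : R) : 0 < eta ->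
  resid_cdf Q b' t <= resid_cdf Q b t + kappa * eta + moment8 c * (l2norm (b' - b) / eta) ^+ 8.
Proof.
move=> eta0.
have te : t <= t + eta by lra.
have /andP[_] := resid_cdf_lip b te; rewrite (_ : t + eta - t = eta); last by ring.
move=> h1.
have h2 : resid_cdf Q b' t <=
    resid_cdf Q b (t + eta) + moment8 c * (l2norm (b' - b) / eta) ^+ 8.
  rewrite -lee_fin EFinD -!resid_cdfE.
  have mA := measurable_resid_le b (t + eta).
  have mB : measurable ([set e | eta <= `|dot e.1 (b' - b)|] : set sample).
    apply: measurable_le_set => //; apply: measurableT_comp => //.
    exact: measurable_sample_dot.
  apply: (@le_trans _ _ (Q ([set e | e.2 - dot e.1 b <= t + eta] `|`
      [set e | eta <= `|dot e.1 (b' - b)|]))).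
    apply: le_measure; rewrite ?inE; [exact: measurable_resid_le|exact: measurableU|].
    move=> e /= h; case: (lerP eta `|dot e.1 (b' - b)|) => h3; [by right|left].
    by move: h3; rewrite dotBr ltr_norml => /andP[]; lra.
  apply: (le_trans (measureU2 _ mA mB)); apply: leeD => //.
  exact: sample_tail.
lra.
Qed.

Lemma resid_cdf_shift (b b' : 'cV[R]_d) (t eta : R) : 0 < eta ->
  `|resid_cdf Q b' t - resid_cdf Q b t| <=
    kappa * eta + moment8 c * (l2norm (b' - b) / eta) ^+ 8.
Proof.
move=> eta0; have h1 := resid_cdf_shift_le b b' t eta0.
have := resid_cdf_shift_le b' b t eta0.
rewrite -(l2normN (b - b')) opprB => h2.
by rewrite ler_norml; apply/andP; split; lra.
Qed.

Lemma resid_tail (b : 'cV[R]_d) (N : R) : 0 < N ->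
  (Q [set e | (N <= `|e.2 - dot e.1 b|)%R] <=
    (128 * (m8 + moment8 c * l2norm b ^+ 8) / N ^+ 8)%:E)%E.
Proof.
move=> N0; have N8 : 0 < N ^+ 8 by rewrite exprn_gt0.
have m := measurable_sample_resid b.
have -> : [set e : sample | N <= `|e.2 - dot e.1 b|] =
    [set e : sample | N ^+ 8 <= (e.2 - dot e.1 b) ^+ 8].
  apply/seteqP; split => e /=; rewrite -[(_ - _) ^+ 8]normr_pow8.
    by move=> h; rewrite lerXn2r ?nnegrE// ltW.
  by rewrite ler_pXn2r ?nnegrE// ltW.
apply: (@mean_le_markov _ _ _ Q) => //.
- exact: measurable_funX.
- by move=> e; exact: pow8_ge0.
- exact: sample_resid8.
Qed.

Lemma resid_cdf_tails (b : 'cV[R]_d) (N e : R) : 0 < N ->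
  128 * (m8 + moment8 c * l2norm b ^+ 8) / N ^+ 8 <= e ->
  resid_cdf Q b (- N) <= e /\ 1 - e <= resid_cdf Q b N.
Proof.
move=> N0 he; have m := measurable_sample_resid b.
have mT : measurable ([set e | N <= `|e.2 - dot e.1 b|] : set sample).
  by apply: measurable_le_set => //; exact: measurableT_comp.
have QT : (Q [set e | (N <= `|e.2 - dot e.1 b|)%R] <= e%:E)%E.
  by apply: (le_trans (resid_tail b N0)); rewrite lee_fin.
split.
  rewrite -lee_fin -resid_cdfE; apply: le_trans QT.
  apply: le_measure; rewrite ?inE//; first exact: measurable_resid_le.
  by move=> s /= h; rewrite ler_normr; apply/orP; right; lra.
rewrite lerBlDr -lerBlDl -lee_fin; apply: le_trans QT.
rewrite EFinB -resid_cdfE -probability_setC; last exact: measurable_resid_le.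
apply: le_measure; rewrite ?inE//; first by apply: measurableC; exact: measurable_resid_le.
by move=> s /= /negP; rewrite -ltNge => /ltW h; rewrite ler_normr h.
Qed.

(** A closed interval has mass [F t] minus the left limit of [F] at [s]; that limit is squeezed
    between [F (s - eta)] and [F s]. *)
Lemma resid_interval (b : 'cV[R]_d) (s t eta : R) : s <= t -> 0 < eta ->
  `|fine (Q [set e | s <= e.2 - dot e.1 b <= t]) - (resid_cdf Q b t - resid_cdf Q b s)|
    <= kappa * eta.
Proof.
move=> st eta0; have m := measurable_sample_resid b.
have se : s - eta <= s by lra.
have /andP[h0 h1] := resid_cdf_lip b se.
rewrite (_ : s - (s - eta) = eta) in h1; last by ring.
pose I : set sample := [set e | s <= e.2 - dot e.1 b <= t].
pose L : set sample := [set e | e.2 - dot e.1 b < s].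
have mL : measurable L by exact: measurable_lt_set.
have mI : measurable I.
  rewrite (_ : I = [set e | s <= e.2 - dot e.1 b] `&` [set e | e.2 - dot e.1 b <= t]).
    by apply: measurableI; exact: measurable_le_set.
  by apply/seteqP; split => e; rewrite /I /=; [move=> /andP[]|move=> [-> ->]].
have QI : Q I = (fine (Q I))%:E by rewrite fineK// fin_num_measure.
have QL : Q L = (fine (Q L))%:E by rewrite fineK// fin_num_measure.
have E : resid_cdf Q b t = fine (Q L) + fine (Q I).
  apply: EFin_inj; rewrite EFinD -QI -QL -resid_cdfE.
  rewrite -measureU//; last first.
    rewrite -subset0 => e [] /= h1' /andP[h2 _].
    by move: h1'; rewrite /L /= ltNge h2.
  congr (Q _); apply/seteqP; split => e /=.
    move=> h; case: (ltP (e.2 - dot e.1 b) s) => h'; [by left|right].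
    by rewrite /I /= h' h.
  by case => [/ltW h|/andP[_]//]; exact: le_trans st.
have L1 : fine (Q L) <= resid_cdf Q b s.
  rewrite -lee_fin -QL -resid_cdfE; apply: le_measure; rewrite ?inE//.
    exact: measurable_resid_le.
  by move=> e /= /ltW.
have L2 : resid_cdf Q b (s - eta) <= fine (Q L).
  rewrite -lee_fin -QL -resid_cdfE; apply: le_measure; rewrite ?inE//.
    exact: measurable_resid_le.
  by move=> e /= h; rewrite /L /=; lra.
rewrite -/I E ler_norml; apply/andP; split; lra.
Qed.

End ResidualCdf.

(** * The exceptional event *)

Section BadEvent.
Context {R : realType} {disp : measure_display} {Omega : measurableType disp}.
Variable P : probability Omega R.
Variables (n d : nat).
Notation sample := (borelType ('cV[R]_d * R)%type).
Variables (x : 'I_n -> Omega -> 'cV[R]_d) (y : 'I_n -> Omega -> R).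
Notation D := (fun i w => (x i w, y i w)).
Hypothesis mD : forall i, measurable_fun setT (D i : Omega -> sample).
Hypothesis indepD : mutually_independent P D.
Variable Q : probability sample R.
Hypothesis lawD : forall i (A : set sample), measurable A -> P (D i @^-1` A) = Q A.
Variables (c m8 kappa : R).
Hypothesis c0 : 0 <= c.
Hypothesis Qmgf : forall v : 'cV[R]_d,
  (\int[Q]_e (expR (dot e.1 v))%:E <= (expR (l2norm v + c * l2norm v ^+ 2))%:E)%E.
Hypothesis Qy8 : (\int[Q]_e (e.2 ^+ 8)%:E <= m8%:E)%E.
Hypothesis Qlip : forall (b : 'cV[R]_d) (t u : R), t <= u ->
  resid_cdf Q b u - resid_cdf Q b t <= kappa * (u - t).
Hypothesis n0 : (0 < n)%N.
Hypothesis d0 : (0 < d)%N.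
Variables (delta : nat -> R) (b0 : 'cV[R]_d) (K : nat) (Delta B0 tau : R).
Hypothesis tau0 : 0 <= tau.
Hypothesis delta0 : forall k, (k < K)%N -> 0 <= delta k.
Hypothesis deltaS : forall k, (k <= K)%N -> \sum_(0 <= s < k) delta s <= Delta.
Hypothesis b0B : l2norm b0 <= B0.
Variables (bsz A : nat) (eta theta e : R).
Hypothesis bszn : (0 < bsz <= n)%N.
Hypothesis eta0 : 0 < eta.
Hypothesis theta0 : 0 < theta.
Hypothesis e02 : 0 < e <= 2.

Let C := 4 * tau ^+ 2.
Let C0 : 0 <= C. Proof. by rewrite mulr_ge0// exprn_ge0. Qed.
Let e0 : 0 <= e. Proof. by have /andP[/ltW] := e02. Qed.

Notation full := [set: 'I_n]%SET.
Notation beta S k := (iter_on x y delta b0 S k).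
Notation chi S := (good_ind x C S).
Notation B l := (block n bsz l).
Notation grid a := (- n%:R + a%:R * eta : R).
Notation C1 := (iter_cst m8 Delta B0 C).
Notation C3 := (diff_cst c m8 Delta B0 C).

(** A leave-one-out residual moves by at least [eta] when the rest of its block is removed too.
    Stating this as an eighth power times the indicator of the good design lets Markov's inequality
    apply as is. *)
Definition bad_cross (ki : nat * 'I_n) : set Omega :=
  [set w | eta ^+ 8 <= chi [set~ ki.2]%SET w * dot (x ki.2 w)
    (beta [set~ ki.2]%SET ki.1 w - beta (~: B (ki.2 %/ bsz))%SET ki.1 w) ^+ 8].
Definition bad_diff (kl : nat * nat) : set Omega :=
  [set w | theta ^+ 8 <= chi full w *
    l2norm (beta full kl.1 w - beta (~: B kl.2)%SET kl.1 w) ^+ 8].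
(** No indicator of the good design here: the summands are bounded, so Hoeffding holds without
    truncation. *)
Definition bad_block (kla : nat * nat * nat) : set Omega :=
  [set w | e * bsz%:R <= `|\sum_(i <- enum (B kla.1.2))
    resid_dev x y Q (beta (~: B kla.1.2)%SET kla.1.1) (grid kla.2) i w|].
(** The iterate is allowed a norm up to the square root of [n]. The grid of thresholds extends to
    [n], so the residual tail beyond it is still of order [n ^ 4 / n ^ 8]. *)
Definition bad_norm (k : nat) : set Omega :=
  [set w | n%:R ^+ 4 <= chi full w * l2norm (beta full k w) ^+ 8].

Definition crosses := [seq (k, i) | k <- iota 0 K.+1, i <- enum 'I_n].
Definition diffs := [seq (k, l) | k <- iota 0 K.+1, l <- iota 0 n].
Definition blocks := [seq (kl, a) | kl <- diffs, a <- iota 0 A.+1].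

Definition bad : set Omega :=
  ~` good_design x C full `|`
  ([set w | exists2 i, i \in crosses & bad_cross i w] `|`
  ([set w | exists2 i, i \in diffs & bad_diff i w] `|`
  ([set w | exists2 i, i \in blocks & bad_block i w] `|`
   [set w | exists2 i, i \in iota 0 K.+1 & bad_norm i w]))).

Lemma measurable_diff (S S' : {set 'I_n}) k j :
  measurable_fun setT (fun w => (beta S k w - beta S' k w) j 0).
Proof.
rewrite (_ : (fun w => _) = fun w => beta S k w j 0 - beta S' k w j 0); last first.
  by apply/funext => w; rewrite !mxE.
by apply: measurable_funB; exact: (measurable_iter mD).
Qed.

Lemma measurable_bad_cross ki : measurable (bad_cross ki).
Proof.
apply: measurable_le_set => //; apply: measurable_funM; first exact: (measurable_good_ind mD).
apply: measurable_funX; apply: measurable_dot => j; first exact: (measurable_x mD).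
exact: measurable_diff.
Qed.

Lemma measurable_bad_diff kl : measurable (bad_diff kl).
Proof.
apply: measurable_le_set => //; apply: measurable_funM; first exact: (measurable_good_ind mD).
by apply: measurable_funX; apply: measurable_l2norm => j; exact: measurable_diff.
Qed.

Lemma measurable_bad_block kla : measurable (bad_block kla).
Proof.
apply: measurable_le_set => //; apply: measurableT_comp => //.
apply: measurable_bigsum => i _; apply: (@measurable_resid_dev _ _ _ _ _ _ _ _ _ Omega id).
  exact: mD.
by move=> j; exact: (measurable_iter mD).
Qed.

Lemma measurable_bad_norm k : measurable (bad_norm k).
Proof.
apply: measurable_le_set => //; apply: measurable_funM; first exact: (measurable_good_ind mD).
by apply: measurable_funX; apply: measurable_l2norm => j; exact: (measurable_iter mD).
Qed.

Let C30 : 0 <= C3. Proof. exact: (diff_cst_ge0 c Qy8 C0 deltaS b0B). Qed.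

Lemma card_ratio (S S' : {set 'I_n}) l : S :\: S' \subset B l ->
  (#|S :\: S'|%:R / n%:R : R) ^+ 4 <= (bsz%:R / n%:R) ^+ 4.
Proof.
move=> sub; have /andP[b0' _] := bszn.
rewrite lerXn2r ?nnegrE ?divr_ge0// ler_wpM2r ?invr_ge0// ler_nat.
exact: leq_trans (subset_leq_card sub) (card_block n l b0').
Qed.

Lemma bad_cross_prob ki : ki \in crosses ->
  (P (bad_cross ki) <= (moment8 c * (C3 * (bsz%:R / n%:R) ^+ 4) / eta ^+ 8)%:E)%E.
Proof.
move=> /allpairsP [[k i] [kK _ ->]]; rewrite /fst /snd in kK *.
have {}kK : (k <= K)%N by move: kK; rewrite mem_iota add0n ltnS.
pose S := [set~ i]%SET; pose S' := (~: B (i %/ bsz))%SET.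
have iB : i \in B (i %/ bsz) by rewrite inE.
have sub : S' \subset S by rewrite finset.setCS finset.sub1set.
have iS : i \notin S by rewrite !inE eqxx.
have hm : mean_le P (fun w => chi S w * dot (x i w) (beta S k w - beta S' k w) ^+ 8)
    (moment8 c * (C3 * (bsz%:R / n%:R) ^+ 4)).
  apply: mean_le_weak (cross_moment mD indepD lawD Qmgf Qy8 n0 d0 C0 delta0 deltaS b0B sub iS kK).
  rewrite ler_wpM2l ?moment8_ge0// ler_wpM2l//; apply: (@card_ratio _ _ (i %/ bsz)).
  by apply/fintype.subsetP => j; rewrite !inE negbK => /andP[].
apply: (mean_le_markov _ _ _ hm); first by rewrite exprn_gt0.
  apply: measurable_funM; first exact: (measurable_good_ind mD).
  apply: measurable_funX; apply: measurable_dot => j; first exact: (measurable_x mD).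
  exact: measurable_diff.
by move=> w; rewrite mulr_ge0 ?good_ind_ge0 ?pow8_ge0.
Qed.

Lemma bad_diff_prob kl : kl \in diffs ->
  (P (bad_diff kl) <= (C3 * (bsz%:R / n%:R) ^+ 4 / theta ^+ 8)%:E)%E.
Proof.
move=> /allpairsP [[k l] [kK _ ->]]; rewrite /fst /snd in kK *.
have {}kK : (k <= K)%N by move: kK; rewrite mem_iota add0n ltnS.
have sub : (~: B l)%SET \subset full by apply: finset.subsetT.
have hm : mean_le P (fun w => chi full w * l2norm (beta full k w - beta (~: B l)%SET k w) ^+ 8)
    (C3 * (bsz%:R / n%:R) ^+ 4).
  apply: mean_le_weak (diff_moment mD indepD lawD Qmgf Qy8 n0 d0 C0 delta0 deltaS b0B sub kK).
  rewrite ler_wpM2l//; apply: (@card_ratio _ _ l).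
  by apply/fintype.subsetP => j; rewrite !inE negbK => /andP[].
apply: (mean_le_markov _ _ _ hm); first by rewrite exprn_gt0.
  apply: measurable_funM; first exact: (measurable_good_ind mD).
  by apply: measurable_funX; apply: measurable_l2norm => j; exact: measurable_diff.
by move=> w; rewrite mulr_ge0 ?good_ind_ge0 ?pow8_ge0.
Qed.

Lemma bad_block_prob kla :
  (P (bad_block kla) <= (2 * expR (- (e ^+ 2 * bsz%:R / 8)))%:E)%E.
Proof.
have /andP[b0' _] := bszn.
apply: (resid_dev_tail mD indepD lawD).
- exact: enum_uniq.
- by rewrite -cardE; exact: card_block.
- by rewrite e0; have /andP[] := e02.
- move=> i; rewrite mem_enum => iB j; apply: measurable_iter_others.
  by rewrite finset.in_setC negbK.
- by move=> j; exact: (measurable_iter mD).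
Qed.

Lemma bad_norm_prob k : k \in iota 0 K.+1 -> (P (bad_norm k) <= (C1 / n%:R ^+ 4)%:E)%E.
Proof.
rewrite mem_iota add0n ltnS => kK.
apply: (mean_le_markov _ _ _ (iter_moment mD indepD lawD Qy8 n0 d0 C0 delta0 deltaS b0B _ kK)).
- by rewrite exprn_gt0// ltr0n.
- apply: measurable_funM; first exact: (measurable_good_ind mD).
  by apply: measurable_funX; apply: measurable_l2norm => j; exact: (measurable_iter mD).
- by move=> w; rewrite mulr_ge0 ?good_ind_ge0 ?pow8_ge0.
Qed.

Definition bad_bound : R :=
  (64 ^ (n + d))%:R * expR ((1 + c - tau) * n%:R) +
  ((K.+1 * n)%:R * (moment8 c * (C3 * (bsz%:R / n%:R) ^+ 4) / eta ^+ 8) +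
  ((K.+1 * n)%:R * (C3 * (bsz%:R / n%:R) ^+ 4 / theta ^+ 8) +
  ((K.+1 * n * A.+1)%:R * (2 * expR (- (e ^+ 2 * bsz%:R / 8))) +
   K.+1%:R * (C1 / n%:R ^+ 4)))).

Lemma bad_prob : measurable bad /\ (P bad <= bad_bound%:E)%E.
Proof.
have [m1 p1] := union_bound (fun ki _ => measurable_bad_cross ki) bad_cross_prob.
have [m2 p2] := union_bound (fun ki _ => measurable_bad_diff ki) bad_diff_prob.
have [m3 p3] := union_bound (s := blocks) (fun ki _ => measurable_bad_block ki)
  (fun ki _ => bad_block_prob ki).
have [m4 p4] := union_bound (fun ki _ => measurable_bad_norm ki) bad_norm_prob.
have m0 : measurable (~` good_design x C full).
  apply: measurableC; exact: (measurable_good_design (f := id) C (fun i _ => mD i)).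
have p0 := good_design_prob mD indepD lawD c0 Qmgf n0 d0 tau0.
rewrite size_allpairs size_iota size_enum_ord in p1.
rewrite size_allpairs !size_iota in p2.
rewrite !size_allpairs !size_iota in p3.
rewrite size_iota in p4.
have m34 := measurableU _ _ m3 m4; have m234 := measurableU _ _ m2 m34.
have m1234 := measurableU _ _ m1 m234.
split; first exact: measurableU.
rewrite /bad_bound !EFinD.
apply: (le_trans (measureU2 _ m0 m1234)); apply: leeD => //.
apply: (le_trans (measureU2 _ m1 m234)); apply: leeD => //.
apply: (le_trans (measureU2 _ m2 m34)); apply: leeD => //.
by apply: (le_trans (measureU2 _ m3 m4)); apply: leeD.
Qed.

Hypothesis tail_small : 128 * (m8 + moment8 c * n%:R ^+ 4) / n%:R ^+ 8 <= e.
Hypothesis grid_large : 2 * n%:R <= A%:R * eta.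

Definition loo_resid k w : seq R :=
  [seq y i w - dot (x i w) (beta [set~ i]%SET k w) | i : 'I_n].

(** Deterministic outside [bad]. With [T = moment8 c * (theta / eta) ^+ 8], the empirical function
    is within [3 kappa eta + T + 3 e] of [F]; each of the two quantiles adds one [kappa eta], and
    passing from the closed interval to a difference of values of [F] adds the ninth. *)
Lemma good_coverage w k (q1 q2 : R) : ~ bad w -> (k <= K)%N ->
  0 <= q1 -> q1 <= q2 -> q2 <= 1 ->
  `|fine (Q [set u | quantile (loo_resid k w) q1 <= u.2 - dot u.1 (beta full k w) <=
    quantile (loo_resid k w) q2])
    - (q2 - q1)| <= 9 * kappa * eta + 2 * (moment8 c * (theta / eta) ^+ 8) + 6 * e.
Proof.
move=> nbad kK q10 q12 q21; set s := loo_resid k w.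
have gd : good_design x C full w by apply: contrapT => h; apply: nbad; left.
(* The good event for all observations implies it for every subset, so every truncation is inactive
   at [w]. *)
have chi1 S : chi S w = 1.
  rewrite /good_ind indicE mem_set//; apply: (good_designS _ gd); exact: finset.subsetT.
have kI : k \in iota 0 K.+1 by rewrite mem_iota add0n ltnS.
have hcross i : `|dot (x i w) (beta [set~ i]%SET k w - beta (~: B (i %/ bsz))%SET k w)| <= eta.
  rewrite leNgt; apply/negP => h; apply: nbad; right; left; exists (k, i).
    by apply: allpairs_f => //; rewrite mem_enum.
  rewrite /bad_cross /= chi1 mul1r -[leRHS]normr_pow8.
  by rewrite lerXn2r ?nnegrE ?(ltW h)// ltW.
have hdiff l : (l < n)%N -> l2norm (beta full k w - beta (~: B l)%SET k w) <= theta.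
  move=> ln; rewrite leNgt; apply/negP => h; apply: nbad; right; right; left; exists (k, l).
    by apply: allpairs_f => //; rewrite mem_iota.
  rewrite /bad_diff /= chi1 mul1r.
  by rewrite lerXn2r ?nnegrE ?(ltW h) ?l2norm_ge0// ltW.
have hblock l a : (l < n)%N -> (a <= A)%N -> `|\sum_(i in B l)
    resid_dev x y Q (beta (~: B l)%SET k) (grid a) i w| <= e * bsz%:R.
  move=> ln aA; rewrite leNgt; apply/negP => h; apply: nbad; right; right; right; left.
  exists (k, l, a).
    by apply: allpairs_f; [apply: allpairs_f => //; rewrite mem_iota|rewrite mem_iota add0n ltnS].
  by rewrite /bad_block /= big_enum /= ltW.
have hnorm : l2norm (beta full k w) ^+ 8 <= n%:R ^+ 4.
  rewrite leNgt; apply/negP => h; apply: nbad; right; right; right; right; exists k => //.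
  by rewrite /bad_norm /= chi1 mul1r ltW.
have n0' : 0 < n%:R :> R by rewrite ltr0n.
pose F := resid_cdf Q (beta full k w).
have lF t u : t <= u -> 0 <= F u - F t <= kappa * (u - t) by exact: resid_cdf_lip.
have F01 t : 0 <= F t <= 1 by exact: resid_cdf_bounds.
have k0 : 0 <= kappa * eta.
  have := lF 0 eta (ltW eta0); rewrite subr0 => /andP[h1 h2]; exact: le_trans h2.
have [t1 t2] : F (- n%:R) <= e /\ 1 - e <= F n%:R.
  apply: (resid_cdf_tails Qmgf Qy8) => //; apply: le_trans tail_small.
  rewrite ler_wpM2r ?invr_ge0 ?exprn_ge0// ler_wpM2l// lerD2l ler_wpM2l//.
  exact: moment8_ge0.
(* The distance between the residual distribution functions at the leave-block-out and at the full
   iterate. *)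
pose rho := kappa * eta + moment8 c * (theta / eta) ^+ 8.
have close := @ecdf_cdf_close R n bsz
  (fun i => y i w - dot (x i w) (beta [set~ i]%SET k w))
  (fun i => y i w - dot (x i w) (beta (~: B (i %/ bsz))%SET k w))
  (fun l t => resid_cdf Q (beta (~: B l)%SET k w) t) F n%:R eta rho kappa e A
  bszn eta0 e0 lF F01.
have {}close : forall t, `|ecdf s t - F t| <= rho + 2 * kappa * eta + 3 * e.
  apply: close => //.
  - move=> i; rewrite opprB addrCA addrA (_ : _ + _ = - dot (x i w)
      (beta [set~ i]%SET k w - beta (~: B (i %/ bsz))%SET k w)); first by rewrite normrN.
    by rewrite dotBr; ring.
  - move=> l t ln; apply: (le_trans (resid_cdf_shift Qmgf Qlip _ _ _ eta0)).
    rewrite lerD2l ler_wpM2l ?moment8_ge0//.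
    rewrite lerXn2r ?nnegrE ?divr_ge0 ?l2norm_ge0 ?(ltW eta0) ?(ltW theta0)//.
    by rewrite ler_wpM2r ?invr_ge0 ?(ltW eta0)// -l2normN opprB hdiff.
  - move=> a l aA ln; have := hblock l a ln aA.
    rewrite (eq_bigr (fun i => (y i w - dot (x i w) (beta (~: B (i %/ bsz))%SET k w)
      <= grid a)%R%:R - resid_cdf Q (beta (~: B l)%SET k w) (grid a)))// => i.
    by rewrite inE /resid_dev => /eqP ->.
have s0 : (0 < size s)%N by rewrite size_map size_enum_ord.
have q1i : 0 <= q1 <= 1 by rewrite q10 (le_trans q12).
have q2i : 0 <= q2 <= 1 by rewrite (le_trans q10).
have := cdf_quantile s0 q1i eta0 close lF; have := cdf_quantile s0 q2i eta0 close lF.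
have := resid_interval Qlip (beta full k w) (quantile_le s0 q10 q12 q21) eta0.
rewrite -/F /rho !ler_norml => /andP[h1 h2] /andP[h3 h4] /andP[h5 h6].
by apply/andP; split; lra.
Qed.

End BadEvent.

(** * Summable rates for the exceptional event *)

Section Asymptotics.
Context {R : realType}.

Lemma expR_ge_pow (u : R) k : 0 <= u -> (0 < k)%N -> (u / k%:R) ^+ k <= expR u.
Proof.
move=> u0 k0; have k0' : k%:R != 0 :> R by rewrite pnatr_eq0 -lt0n.
have -> : expR u = expR (u / k%:R) ^+ k by rewrite -expRM_natr divfK.
rewrite lerXn2r ?nnegrE ?expR_ge0 ?divr_ge0//.
by apply: le_trans (expR_ge1Dx (u / k%:R)); rewrite lerDr.
Qed.

Lemma expRN_le_pow (u : R) k : 0 < u -> (0 < k)%N -> expR (- u) <= (k%:R / u) ^+ k.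
Proof.
move=> u0 k0; have k0' : 0 < k%:R :> R by rewrite ltr0n.
rewrite expRN -[leRHS]invrK lef_pV2 ?posrE ?expR_gt0 ?invr_gt0 ?exprn_gt0 ?divr_gt0//.
by rewrite -exprVn invf_div expR_ge_pow// ltW.
Qed.

(** Telescoping: the term of index [m + 2] is at most the difference of [2] over the square roots of
    [m + 1] and [m + 2]. The term of index 0 vanishes because [0^-1 = 0]. *)
Lemma sum_inv_pow32 (n : nat) :
  \sum_(0 <= m < n) (m%:R * Num.sqrt m%:R)^-1 <= 3 :> R.
Proof.
have H m : \sum_(0 <= i < m.+2) (i%:R * Num.sqrt i%:R)^-1 <= 3 - 2 / Num.sqrt m.+1%:R :> R.
  elim: m => [|m IH].
    by rewrite !big_nat_recr//= big_nil mul0r invr0 !add0r sqrtr1; lra.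
  rewrite big_nat_recr//=; set a : R := Num.sqrt m.+1%:R in IH *.
  set b : R := Num.sqrt m.+2%:R.
  have a0 : 0 < a by rewrite sqrtr_gt0.
  have b0 : 0 < b by rewrite sqrtr_gt0.
  have b2 : b * b = m.+2%:R by rewrite -expr2 sqr_sqrtr.
  have a2 : a * a = m.+1%:R by rewrite -expr2 sqr_sqrtr.
  have ab : b * b = a * a + 1 by rewrite a2 b2 natr1.
  have ab' : a <= b by nra.
  apply: (le_trans (lerD IH (lexx _))).
  suff : (m.+2%:R * b)^-1 <= 2 / a - 2 / b.
    by move: (_^-1) (2 / a) (2 / b) => u v v'; lra.
  have -> : 2 / a - 2 / b = 2 / (a * b * (a + b)).
    have -> : 2 / a - 2 / b = 2 * (b - a) / (a * b) by field; rewrite !gt_eqF.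
    have -> : 2 * (b - a) / (a * b) = 2 * ((b - a) * (a + b)) / (a * b * (a + b)).
      by field; rewrite !gt_eqF// addr_gt0.
    have -> : (b - a) * (a + b) = 1 by rewrite (_ : _ * _ = b * b - a * a); [rewrite ab; ring|ring].
    by rewrite mulr1.
  rewrite -b2 ler_pdivlMr ?mulr_gt0 ?addr_gt0// mulrC ler_pdivrMr ?mulr_gt0//; nra.
case: n => [|[|n]]; first by rewrite big_nil.
  by rewrite big_nat1 mul0r invr0.
apply: (le_trans (H n)); rewrite gerBl divr_ge0//; exact: sqrtr_ge0.
Qed.

(** Since [N] is at most [(2 b)^8], decay of order [8 m] in [b] is decay of order [m] in [N]; an
    exponential provides it for every [m]. *)
Lemma expR_block_decay (e : R) (m : nat) : 0 < e -> (0 < m)%N ->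
  exists2 q : R, 0 <= q & forall b N : R, 0 < b -> 0 < N -> N <= (2 * b) ^+ 8 ->
    expR (- (e ^+ 2 * b / 8)) <= q / N ^+ m.
Proof.
move=> e0 m0; set k := (8 * m)%N; have k0 : (0 < k)%N by rewrite muln_gt0.
have e2 : 0 < e ^+ 2 by rewrite exprn_gt0.
have q0 : 0 <= 16 * k%:R / e ^+ 2 by rewrite divr_ge0 ?(ltW e2)// mulr_ge0.
exists ((16 * k%:R / e ^+ 2) ^+ k); first exact: exprn_ge0.
move=> b N b0 N0 Nb.
have u0 : 0 < e ^+ 2 * b / 8 by rewrite divr_gt0// mulr_gt0.
apply: (le_trans (expRN_le_pow u0 k0)).
have -> : k%:R / (e ^+ 2 * b / 8) = (16 * k%:R / e ^+ 2) / (2 * b).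
  by field; rewrite !gt_eqF.
have b2 : 0 < 2 * b by rewrite mulr_gt0.
rewrite expr_div_n ler_wpM2l ?exprn_ge0// lef_pV2 ?posrE ?exprn_gt0//.
by rewrite /k exprM lerXn2r ?nnegrE ?(ltW N0)// exprn_ge0// ltW.
Qed.

(* [tau] is chosen for [expR (- tau * n)] to beat the [64 ^ (n + d)] pairs of net
   points. *)
Lemma bad_bound_le (c m8 Delta B0 zeta eta theta e : R) :
  0 <= c -> 0 <= zeta -> 0 < eta -> 0 < theta -> 0 < e ->
  exists2 Cst : R, 0 <= Cst & forall n d K b A, (0 < n)%N -> d%:R <= (1 + zeta) * n%:R ->
    (K <= n)%N -> (0 < b)%N -> (b ^ 8 <= n <= b.+1 ^ 8)%N -> A%:R <= 2 * n%:R / eta + 1 ->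
    bad_bound n d c m8 K Delta B0 (6 * (2 + zeta) + 2 + c) b A eta theta e <=
      Cst / (n%:R * Num.sqrt n%:R).
Proof.
move=> c0 z0 eta0 theta0 e0; set tau := 6 * (2 + zeta) + 2 + c.
pose C1 := iter_cst m8 Delta B0 (4 * tau ^+ 2).
pose C3 := diff_cst c m8 Delta B0 (4 * tau ^+ 2).
(* The triples of a step, a block and a grid point number about [n^3], so order 5 leaves
   [n^(-2)]. *)
have [q q0 hq] := expR_block_decay e0 (isT : (0 < 5)%N).
have eta8 : 0 < eta ^+ 8 by rewrite exprn_gt0.
have theta8 : 0 < theta ^+ 8 by rewrite exprn_gt0.
have m0 := moment8_ge0 c.
pose D1 : R := 4.
(* Absolute values stand in for signs: nothing here says that [m8], [Delta] or [B0] is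
   nonnegative. *)
pose D2 := 2 * (moment8 c * `|C3| / eta ^+ 8).
pose D3 := 2 * (`|C3| / theta ^+ 8).
pose D4 := 4 * (2 / eta + 2) * q.
pose D5 := 2 * `|C1|.
have D20 : 0 <= D2 by rewrite mulr_ge0// divr_ge0 ?mulr_ge0// ltW.
have D30 : 0 <= D3 by rewrite mulr_ge0// divr_ge0// ltW.
have e20 : 0 <= 2 / eta + 2 by rewrite addr_ge0// divr_ge0// ltW.
have D40 : 0 <= D4 by rewrite mulr_ge0// mulr_ge0.
have D50 : 0 <= D5 by rewrite mulr_ge0.
exists (D1 + (D2 + (D3 + (D4 + D5)))); first by rewrite !addr_ge0.
move=> n d K b A n0 dn Kn b0 /andP[bn nb] An.
set N : R := n%:R in dn An *; set s := Num.sqrt N; set bR : R := b%:R.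
have N1 : 1 <= N by rewrite ler1n.
have N0 : 0 < N by apply: lt_le_trans N1.
have s0 : 0 < s by rewrite sqrtr_gt0.
have s2 : s * s = N by rewrite -expr2 sqr_sqrtr// ltW.
have s1 : 1 <= s by nra.
have b1 : 1 <= bR by rewrite ler1n.
have bR0 : 0 < bR by apply: lt_le_trans b1.
have Ns0 : 0 < N * s by rewrite mulr_gt0.
have N2g : (N ^+ 2)^-1 <= (N * s)^-1.
  by rewrite lef_pV2 ?posrE ?exprn_gt0// expr2 ler_pM2l//; nra.
have b4 : bR ^+ 4 <= s.
  rewrite -(@ler_pXn2r _ 2) ?nnegrE ?exprn_ge0 ?(ltW s0) ?(ltW bR0)//.
  by rewrite -exprM [leRHS]expr2 s2 -natrX ler_nat.
have b8 : N <= (2 * bR) ^+ 8.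
  have -> : 2 * bR = (2 * b)%:R by rewrite natrM.
  rewrite -natrX ler_nat; apply: (leq_trans nb).
  have b2 : (b.+1 <= 2 * b)%N by rewrite mul2n -addnn -addn1 leq_add2l.
  by rewrite leq_exp2r.
(* The constraint that fixes the block size: [n^2] pairs against [(b / n)^4] leave [b^4 / n^2], and
   [b^4] is at most the square root of [n]. *)
have bN : N ^+ 2 * (bR / N) ^+ 4 <= (N * s)^-1.
  have -> : N ^+ 2 * (bR / N) ^+ 4 = bR ^+ 4 / N ^+ 2 by field; rewrite gt_eqF.
  have -> : (N * s)^-1 = s / N ^+ 2 by rewrite -s2; field; rewrite gt_eqF.
  by rewrite ler_wpM2r// invr_ge0 exprn_ge0// ltW.
have K2 : K.+1%:R <= 2 * N.
  have KN : K%:R <= N by rewrite ler_nat.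
  by rewrite -[K.+1%:R]natr1; lra.
(* As [64 <= expR 6] and [n + d <= (2 + zeta) n], the pairs of net points cost at most
   [6 (2 + zeta) n] in the exponent. The remaining [2 + c] in [tau] covers [1 + c] and leaves
   [- n]. *)
have t1 : (64 ^ (n + d))%:R * expR ((1 + c - tau) * N) <= D1 / (N * s).
  apply: (@le_trans _ _ (expR (- N))).
    have h64 : 64%:R <= expR 6 :> R.
      have -> : 6 = 6%:R * 1 :> R by rewrite mulr1.
      rewrite expRM_natl (_ : 64%:R = 2 ^+ 6 :> R); last by rewrite -natrX.
      rewrite lerXn2r ?nnegrE ?expR_ge0//.
      by have := @expR_ge1Dx R 1; rewrite (_ : 1 + 1 = 2)//; lra.
    rewrite natrX; apply: (@le_trans _ _ (expR 6 ^+ (n + d) * expR ((1 + c - tau) * N))).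
      by rewrite ler_wpM2r ?expR_ge0// lerXn2r ?nnegrE ?expR_ge0.
    rewrite -expRM_natl -expRD ler_expR natrD -/N /tau; nra.
  have h := expRN_le_pow N0 (isT : (0 < 2)%N).
  apply: (le_trans h); rewrite expr_div_n /D1.
  by rewrite (_ : 2%:R ^+ 2 = 4 :> R) ?ler_wpM2l// -natrX.
have Kn2 : (K.+1 * n)%:R <= 2 * N ^+ 2.
  by rewrite natrM expr2 mulrA ler_wpM2r// ltW.
have t2 : (K.+1 * n)%:R * (moment8 c * (C3 * (bR / N) ^+ 4) / eta ^+ 8) <= D2 / (N * s).
  apply: (@le_trans _ _ (2 * N ^+ 2 * (moment8 c * (`|C3| * (bR / N) ^+ 4) / eta ^+ 8))).
    have p0 : 0 <= (bR / N) ^+ 4 by rewrite exprn_ge0// divr_ge0// ltW.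
    apply: (@le_trans _ _ ((K.+1 * n)%:R * (moment8 c * (`|C3| * (bR / N) ^+ 4) / eta ^+ 8))).
      rewrite ler_wpM2l// ler_wpM2r ?invr_ge0 ?(ltW eta8)// ler_wpM2l// ler_wpM2r//.
      exact: ler_norm.
    by rewrite ler_wpM2r// divr_ge0 ?(ltW eta8)// mulr_ge0// mulr_ge0.
  have -> : 2 * N ^+ 2 * (moment8 c * (`|C3| * (bR / N) ^+ 4) / eta ^+ 8) =
     D2 * (N ^+ 2 * (bR / N) ^+ 4).
    by rewrite /D2; field; rewrite !gt_eqF.
  by rewrite ler_wpM2l.
have t3 : (K.+1 * n)%:R * (C3 * (bR / N) ^+ 4 / theta ^+ 8) <= D3 / (N * s).
  have p0 : 0 <= (bR / N) ^+ 4 by rewrite exprn_ge0// divr_ge0// ltW.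
  apply: (@le_trans _ _ (2 * N ^+ 2 * (`|C3| * (bR / N) ^+ 4 / theta ^+ 8))).
    apply: (@le_trans _ _ ((K.+1 * n)%:R * (`|C3| * (bR / N) ^+ 4 / theta ^+ 8))).
      rewrite ler_wpM2l// ler_wpM2r ?invr_ge0 ?(ltW theta8)// ler_wpM2r//.
      exact: ler_norm.
    by rewrite ler_wpM2r// divr_ge0 ?(ltW theta8)// mulr_ge0.
  have -> : 2 * N ^+ 2 * (`|C3| * (bR / N) ^+ 4 / theta ^+ 8) =
     D3 * (N ^+ 2 * (bR / N) ^+ 4).
    by rewrite /D3; field; rewrite !gt_eqF.
  by rewrite ler_wpM2l.
have t4 : (K.+1 * n * A.+1)%:R * (2 * expR (- (e ^+ 2 * bR / 8))) <= D4 / (N * s).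
  have h : expR (- (e ^+ 2 * bR / 8)) <= q / N ^+ 5 by exact: hq.
  have hA : A.+1%:R <= N * (2 / eta + 2).
    rewrite -[A.+1%:R]natr1; apply: (le_trans (lerD An (lexx 1))).
    have : 0 <= eta^-1 by rewrite invr_ge0 ltW.
    rewrite (_ : N * (2 / eta + 2) = 2 * N / eta + 2 * N); last by ring.
    lra.
  apply: (@le_trans _ _ (2 * N ^+ 2 * (N * (2 / eta + 2)) * (2 * (q / N ^+ 5)))).
    have E0 := expR_ge0 (- (e ^+ 2 * bR / 8)).
    apply: ler_pM => //.
      by rewrite natrM ler_pM.
    by rewrite ler_wpM2l.
  have -> : 2 * N ^+ 2 * (N * (2 / eta + 2)) * (2 * (q / N ^+ 5)) = D4 * (N ^+ 2)^-1.
    by rewrite /D4; field; rewrite !gt_eqF.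
  by rewrite ler_wpM2l.
have t5 : K.+1%:R * (C1 / N ^+ 4) <= D5 / (N * s).
  apply: (@le_trans _ _ (2 * N * (`|C1| / N ^+ 4))).
    have N4 : 0 < N ^+ 4 by rewrite exprn_gt0.
    apply: (@le_trans _ _ (K.+1%:R * (`|C1| / N ^+ 4))).
      by rewrite ler_wpM2l// ler_wpM2r ?invr_ge0 ?(ltW N4)// ler_norm.
    by rewrite ler_wpM2r// divr_ge0// ltW.
  have -> : 2 * N * (`|C1| / N ^+ 4) = D5 * (N ^+ 3)^-1 by rewrite /D5; field; rewrite gt_eqF.
  rewrite ler_wpM2l//; apply: le_trans N2g.
  by rewrite lef_pV2 ?posrE ?exprn_gt0// ler_weXn2l.
rewrite /bad_bound -/N -/bR -/C1 -/C3.
have -> : (D1 + (D2 + (D3 + (D4 + D5)))) / (N * s) = D1 / (N * s) + (D2 / (N * s) +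
    (D3 / (N * s) + (D4 / (N * s) + D5 / (N * s)))).
  by rewrite [LHS]mulrDl; congr (_ + _); rewrite [LHS]mulrDl; congr (_ + _);
    rewrite [LHS]mulrDl; congr (_ + _); rewrite [LHS]mulrDl.
by apply: lerD => //; apply: lerD => //; apply: lerD => //; apply: lerD.
Qed.

Lemma block_size_exists n : (0 < n)%N ->
  exists2 b, (0 < b)%N & (b ^ 8 <= n <= b.+1 ^ 8)%N.
Proof.
elim: n => // -[_ _|n /(_ isT) [b b0 /andP[h1 h2]] _]; first by exists 1%N.
move: h2; rewrite leq_eqVlt => /orP[/eqP h2|h2].
  exists b.+1 => //; apply/andP; split; first by rewrite -h2 leqnSn.
  by rewrite h2 ltn_exp2r.
by exists b => //; rewrite (leq_trans h1).
Qed.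

End Asymptotics.

Section BorelCantelli.
Context {R : realType} {disp : measure_display} {Omega : measurableType disp}.
Variable P : probability Omega R.

Lemma ae_eventually_not (F : nat -> set Omega) (Cst : R) : 0 <= Cst ->
  (forall n, measurable (F n)) ->
  (forall n, (P (F n) <= (Cst / (n%:R * Num.sqrt n%:R))%:E)%E) ->
  {ae P, forall w, \forall n \near \oo, ~ F n w}.
Proof.
move=> C0 mF PF.
have PL : P (lim_sup_set F) = 0%E.
  apply: lim_sup_set_cvg0 => //; apply: (@le_lt_trans _ _ (3 * Cst)%:E); last exact: ltry.
  apply: lime_le; first by apply: is_cvg_nneseries => n _ _; exact: measure_ge0.
  apply: nearW => n.
  apply: (@le_trans _ _ (\sum_(0 <= m < n) (Cst / (m%:R * Num.sqrt m%:R))%:E)%E).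
    by apply: lee_sum => i _; exact: PF.
  by rewrite sumEFin lee_fin -mulr_sumr mulrC ler_wpM2r// sum_inv_pow32.
have mL : measurable (lim_sup_set F).
  apply: bigcapT_measurable => n; apply: bigcup_measurable => k _; exact: mF.
exists (lim_sup_set F); split => // w /= h n _.
apply: contrapT => h2; apply: h; exists n => // k /= nk Fk; apply: h2.
by exists k.
Qed.

End BorelCantelli.

(** * Versions of conditional probabilities *)

Section ConditionalProbability.
Context {R : realType} {disp : measure_display} {Omega : measurableType disp}.
Variable P : probability Omega R.

(** The event [h < g] belongs to the sigma-algebra of [V], so both versions have the same integral
    over it; a positive difference with integral zero forces a null event. *)
Lemma cond_prob_lt_null (T : ptopologicalType) (V : Omega -> T) (E : set Omega)
    (g h : Omega -> R) :
  measurable_fun setT (V : Omega -> borelType T) ->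
  cond_prob P V E g -> cond_prob P V E h -> {ae P, forall w, g w <= h w}.
Proof.
move=> mV [sg ig Ig] [sh ih Ih].
have ms A : sigma_of V A -> measurable A.
  by move=> [B bB <-]; rewrite setTI; exact: (measurable_preimage mV bB).
pose TV := g_sigma_algebraType (sigma_of V).
have sa : sigma_algebra setT (sigma_of V).
  by apply: sigma_algebra_preimage; exact: smallest_sigma_algebra.
have mTV (f : Omega -> R) : (forall B, borel B -> sigma_of V (f @^-1` B)) ->
    measurable_fun setT (f : TV -> R).
  move=> sf _ B mB; rewrite setTI; apply: sub_gen_smallest; apply: sf.
  have cid : continuous (id : R -> R) by move=> x; exact: cvg_id.
  by have := @continuous_measurable_borel R R id cid measurableT B mB; rewrite setTI.
have mg := mTV g sg; have mh := mTV h sh.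
pose A : set Omega := [set w | h w < g w].
have sA : sigma_of V A.
  have mA : measurable (A : set TV) by exact: (@measurable_lt_set _ _ TV).
  by apply: (mA (sigma_of V)); split.
have mA := ms A sA.
have mf (f : Omega -> R) : measurable_fun setT (f : TV -> R) -> measurable_fun setT f.
  move=> mf _ B mB; rewrite setTI; apply: ms.
  have := mf measurableT B mB; rewrite setTI => mfB.
  by apply: (mfB (sigma_of V)); split.
have mg' := mf g mg; have mh' := mf h mh.
have igA : P.-integrable A (EFin \o g) by exact: (integrableS measurableT).
have ihA : P.-integrable A (EFin \o h) by exact: (integrableS measurableT).
have I0 : (\int[P]_(w in A) ((EFin \o g) w - (EFin \o h) w) = 0)%E.
  rewrite integralB//; have fg := integrable_fin_num mA igA.
  have E' : (\int[P]_(w in A) (EFin \o h) w = \int[P]_(w in A) (EFin \o g) w)%E.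
    exact: etrans (Ih A sA) (esym (Ig A sA)).
  by rewrite E' subee.
have mgh : measurable_fun A (fun w => ((EFin \o g) w - (EFin \o h) w)%E).
  by apply: emeasurable_funB; exact: (measurable_int P).
have ae0 : ae_eq P A (fun w => ((EFin \o g) w - (EFin \o h) w)%E) (cst 0%E).
  apply/(ae_eq_integral_abs P mA mgh); rewrite -[RHS]I0; apply: eq_integral => w.
  move=> /set_mem hg; have hg' : h w < g w := hg.
  by rewrite gee0_abs//; rewrite -EFinB lee_fin subr_ge0 ltW.
apply: filterS ae0 => w /= h0; rewrite leNgt; apply/negP => hg.
have := h0 hg; rewrite -EFinB => -[] /eqP; rewrite subr_eq0 => /eqP e.
by move: hg; rewrite e ltxx.
Qed.

Lemma cond_prob_unique (T : ptopologicalType) (V : Omega -> T) (E : set Omega)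
    (g h : Omega -> R) :
  measurable_fun setT (V : Omega -> borelType T) ->
  cond_prob P V E g -> cond_prob P V E h -> {ae P, forall w, g w = h w}.
Proof.
move=> mV cg ch; have := cond_prob_lt_null mV cg ch.
have := cond_prob_lt_null mV ch cg.
by apply: filterS2 => w h1 h2; apply/le_anti; rewrite h1 h2.
Qed.

(** Independence allows freezing [V]: the mass under [Q] of the section of [S] at [V w] is an
    explicit version of the conditional probability. *)
Lemma cond_prob_indep (T : ptopologicalType) d1 (T1 : measurableType d1)
    (V : Omega -> T) (U : Omega -> T1) (Q : probability T1 R) (S : set (borelType T * T1)) :
  measurable_fun setT (V : Omega -> borelType T) -> measurable_fun setT U ->
  (forall A, measurable A -> P (U @^-1` A) = Q A) ->
  (forall A (B : set (borelType T)), measurable A -> measurable B ->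
    P (U @^-1` A `&` V @^-1` B) = (P (U @^-1` A) * P (V @^-1` B))%E) ->
  measurable S ->
  cond_prob P V [set w | S (V w, U w)] (fun w => fine (Q [set u | S (V w, u)])).
Proof.
move=> mV mU UQ UV mS.
have xE (v : borelType T) : xsection S v = [set u | S (v, u)].
  by apply/seteqP; split => u; rewrite /xsection /= inE.
have mQ : measurable_fun setT (fun v : borelType T => fine (Q [set u | S (v, u)])).
  rewrite (_ : (fun v => _) = fun v => fine (Q (xsection S v))); last first.
    by apply/funext => v; rewrite xE.
  by apply: measurableT_comp => //; exact: (measurable_fun_xsection Q mS).
have mxS v : measurable [set u | S (v, u)] by rewrite -xE; exact: measurable_xsection.
have fQ v : (fine (Q [set u | S (v, u)]))%:E = Q [set u | S (v, u)].
  by rewrite fineK// fin_num_measure.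
have mh : measurable_fun setT (fun w => fine (Q [set u | S (V w, u)])).
  exact: (measurableT_comp mQ mV).
split.
- move=> B bB; exists ((fun v : borelType T => fine (Q [set u | S (v, u)])) @^-1` B).
    have mB : measurable (B : set R).
      have : borel B := bB; apply: smallest_sub => //; first exact: sigma_algebra_measurable.
      exact: open_measurable.
    by have := mQ measurableT B mB; rewrite setTI.
  by rewrite setTI.
- have b1 w : `|fine (Q [set u | S (V w, u)])| <= 1.
    by rewrite ger0_norm ?fine_ge0// -lee_fin fQ probability_le1.
  exact: bounded_integrable mh b1.
- move=> A [B bB <-]; rewrite setTI.
  have mB : measurable (B : set (borelType T)) by [].
  (* Intersecting [S] with a constraint on its first coordinate reduces the integral over an event
     of [V] to the formula for the probability of a set. *)
  have mS' : measurable ([set z : borelType T * T1 | B z.1] `&` S).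
    apply: measurableI => //; rewrite (_ : [set z | _] = B `*` setT).
      exact: measurableX.
    by apply/seteqP; split => z /=; [|move=> []].
  have := indep_fubini_set mU mV UQ UV mS'; rewrite /= => H.
  rewrite (_ : V @^-1` B `&` [set w | S (V w, U w)] =
    [set w | ([set z : borelType T * T1 | B z.1] `&` S) (V w, U w)])//.
  apply/esym; apply: (etrans H).
  rewrite [RHS]integral_mkcond; apply: eq_integral => w _.
  rewrite patchE; case: (boolP (w \in V @^-1` B)) => [|h].
    rewrite inE /= => h; rewrite fQ; congr (Q _).
    by apply/seteqP; split => u /=; [move=> []|].
  rewrite (_ : [set u | _] = set0) ?measure0//.
  by apply/seteqP; split => u //= -[h' _]; move/negP: h; apply; rewrite inE.
Qed.

(** The quantile exceeds [t] exactly when at most [j] of the values are at most [t], with [j] the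
    rank counted from 0. This is a condition on a sum of indicators, so sorting itself never has to
    be shown measurable. *)
Lemma measurable_quantile n (r : 'I_n -> Omega -> R) q : (0 < n)%N -> 0 <= q <= 1 ->
  (forall i, measurable_fun setT (r i)) ->
  measurable_fun setT (fun w => quantile [seq r i w | i : 'I_n] q).
Proof.
move=> n0 q01 mr.
have sz w : size [seq r i w | i : 'I_n] = n by rewrite size_map size_enum_ord.
set j := (`|Num.ceil (n%:R * q)|%N).-1.
have jn : (j < n)%N.
  pose w0 (i : 'I_n) : R := 0.
  have sz0 : size [seq w0 i | i : 'I_n] = n by rewrite size_map size_enum_ord.
  have := @quantile_rank R [seq w0 i | i : 'I_n] q; rewrite sz0 => H.
  by have [] := H n0 q01.
apply: (measurability _ (RGenOInfty.measurableE R)) => _ [_ [t ->] <-].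
rewrite setTI (_ : _ @^-1` _ =
    [set w | \sum_(i < n) \1_[set w | r i w <= t] w <= j%:R :> R]); last first.
  apply/seteqP; split => w /=; rewrite in_itv /= andbT.
    rewrite /quantile sz -/j => tq.
    have jw : (j < size [seq r i w | i : 'I_n])%N by rewrite sz.
    have := count_sort_le jw tq.
    rewrite -(ler_nat R) => /(le_trans _); apply.
    rewrite count_map -sum1_count natr_sum [leRHS]big_mkcond /= big_enum /=.
    apply: ler_sum => i _; rewrite indicE.
    by case: (boolP (r i w <= t)) => h; [rewrite mem_set|rewrite memNset//=; apply/negP].
  move=> h; rewrite ltNge; apply/negP => qt; move: h; apply/negP; rewrite -ltNge.
  have jw : (j < size [seq r i w | i : 'I_n])%N by rewrite sz.
  have := count_sort_ge jw; rewrite -(ltr_nat R) => /lt_le_trans; apply.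
  rewrite count_map -sum1_count natr_sum [leLHS]big_mkcond /= big_enum /=.
  apply: ler_sum => i _; rewrite indicE.
  case: ifPn => // h; rewrite mem_set//=; apply: (le_trans h).
  by move: qt; rewrite /quantile sz.
apply: measurable_le_set => //; apply: measurable_bigsum => i _.
by apply: measurable_indic; exact: measurable_le_set.
Qed.

End ConditionalProbability.

(** * The regression model *)

Section OperatorNorm.
Context {R : realType}.

Lemma dot_mulmx m d (A : 'M[R]_(m, d)) (u : 'cV[R]_d) (v : 'cV[R]_m) :
  dot (A *m u) v = dot u (A^T *m v).
Proof. by rewrite -!mulmx_dot trmx_mul mulmxA. Qed.

(** The Frobenius bound, by Cauchy-Schwarz row by row. It shows that the set in [opnorm] is bounded
    above, so that its supremum is an upper bound. *)
Lemma opnorm_bounded m d (A : 'M[R]_(m, d)) (v : 'cV[R]_d) :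
  l2norm (A *m v) <= Num.sqrt (\sum_i l2norm (row i A)^T ^+ 2) * l2norm v.
Proof.
have s0 : 0 <= \sum_i l2norm (row i A)^T ^+ 2 by apply: sumr_ge0 => i _; exact: sqr_ge0.
rewrite -(@ler_pXn2r _ 2) ?nnegrE ?mulr_ge0 ?l2norm_ge0 ?sqrtr_ge0//.
rewrite exprMn [X in _ <= X * _]sqr_sqrtr//.
have -> : l2norm (A *m v) ^+ 2 = \sum_i (A *m v) i 0 ^+ 2.
  by rewrite sqr_sqrtr//; apply: sumr_ge0 => i _; exact: sqr_ge0.
rewrite mulr_suml; apply: ler_sum => i _.
have -> : (A *m v) i 0 = dot (row i A)^T v.
  by rewrite mxE /dot; apply: eq_bigr => j _; rewrite !mxE.
rewrite -exprMn -[leLHS]real_normK ?num_real// lerXn2r ?nnegrE ?mulr_ge0 ?l2norm_ge0//.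
exact: dot_Cauchy_Schwarz.
Qed.

Lemma opnorm_le m d (A : 'M[R]_(m, d)) (v : 'cV[R]_d) :
  l2norm (A *m v) <= opnorm A * l2norm v.
Proof.
have [/l2norm_eq0 ->|v0] := eqVneq (l2norm v) 0.
  by rewrite mulmx0 !l2norm0 mulr0.
have vp : 0 < l2norm v by rewrite lt_def v0 l2norm_ge0.
have [u u1 vE] : exists2 u, l2norm u = 1 & v = l2norm v *: u.
  exists ((l2norm v)^-1 *: v); first by rewrite l2normZ gtr0_norm ?invr_gt0// mulVf.
  by rewrite scalerA divff// scale1r.
have -> : A *m v = l2norm v *: (A *m u) by rewrite {1}vE scalemxAr.
rewrite l2normZ gtr0_norm// mulrC; apply: ler_wpM2r; first exact: ltW.
apply: ub_le_sup; last by exists u => //=; rewrite u1.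
exists (Num.sqrt (\sum_i l2norm (row i A)^T ^+ 2)) => _ [w /= w1 <-].
by apply: (le_trans (opnorm_bounded A w)); rewrite ler_piMr// sqrtr_ge0.
Qed.

(** By symmetry of [S], the squared norm of [S *m v] is the inner product of [v] with [A *m v]. *)
Lemma psd_sqrt_norm d (A S : 'M[R]_d) (v : 'cV[R]_d) : psd_sqrt A S ->
  l2norm (S *m v) ^+ 2 <= opnorm A * l2norm v ^+ 2.
Proof.
move=> [[ST _] SA]; rewrite sqr_l2norm dot_mulmx ST mulmxA SA.
apply: (le_trans (ler_norm _)); apply: (le_trans (dot_Cauchy_Schwarz _ _)).
rewrite expr2 mulrA [leRHS]mulrC; apply: ler_wpM2l; first exact: l2norm_ge0.
exact: opnorm_le.
Qed.

(** The topology on vectors is coordinatewise, so the Euclidean norm is bounded by the sum of the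
    absolute coordinates, each kept below [e / (d + 1)]; the successor covers [d = 0]. *)
Lemma lipschitz_l2_continuous d (L : R) (f : 'cV[R]_d -> R) : L <= 1 ->
  lipschitz_l2 L f -> continuous f.
Proof.
move=> L1 lf u; have FF : Filter (nbhs u) by exact: nbhs_filter.
apply/(@cvgrPdist_lt R R^o _ (nbhs u) FF) => e e0.
have l2le (v : 'cV[R]_d) : l2norm v <= \sum_i `|v i 0|.
  rewrite -(@ler_pXn2r _ 2) ?nnegrE ?l2norm_ge0 ?sumr_ge0//.
  rewrite sqr_sqrtr; last by apply: sumr_ge0 => i _; exact: sqr_ge0.
  rewrite [leRHS]expr2 mulr_suml; apply: ler_sum => i _.
  rewrite -[leLHS]real_normK ?num_real// expr2 ler_wpM2l//.
  by rewrite (bigD1 i)//= lerDl sumr_ge0.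
have eps0 : 0 < e / d.+1%:R by rewrite divr_gt0.
have : \forall v \near nbhs u, forall i : 'I_d, `|u i 0 - (v : 'cV[R]_d) i 0| < e / d.+1%:R.
  apply: filter_forall => i.
  by have /(@cvgrPdist_lt R R^o _ (nbhs u) FF) := @coord_continuous R d 1 i 0 u; exact.
apply: filterS => v hv.
apply: (le_lt_trans (lf u v)).
apply: (@le_lt_trans _ _ (l2norm (u - v))).
  by rewrite -[leRHS]mul1r ler_wpM2r ?l2norm_ge0.
apply: (le_lt_trans (l2le _)).
apply: (@le_lt_trans _ _ (\sum_(i < d) e / d.+1%:R)).
  by apply: ler_sum => i _; rewrite !mxE ltW.
rewrite sumr_const card_ord -[ltLHS]mulr_natl mulrCA -[ltRHS]mulr1 ltr_pM2l//.
by rewrite ltr_pdivrMr// mul1r ltr_nat.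
Qed.

End OperatorNorm.

Section Model.
Context {R : realType} {disp : measure_display} {Omega : measurableType disp}.
Variable P : probability Omega R.

Lemma law_exists d1 (T1 : measurableType d1) (U : Omega -> T1) : measurable_fun setT U ->
  exists Q : probability T1 R, forall A, measurable A -> P (U @^-1` A) = Q A.
Proof.
move=> mU.
pose U' : {mfun Omega >-> T1} := HB.pack U (@isMeasurableFun.Build _ _ _ _ U mU).
by exists (distribution P U').
Qed.

Lemma integral_law d1 (T1 : measurableType d1) (U : Omega -> T1) (Q : probability T1 R)
    (g : T1 -> \bar R) : measurable_fun setT U ->
  (forall A, measurable A -> P (U @^-1` A) = Q A) ->
  measurable_fun setT g -> (forall u, (0 <= g u)%E) ->
  (\int[Q]_u g u = \int[P]_w g (U w))%E.
Proof.
move=> mU UQ mg g0.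
pose U' : {mfun Omega >-> T1} := HB.pack U (@isMeasurableFun.Build _ _ _ _ U mU).
transitivity (\int[distribution P U']_u g u)%E; last exact: ge0_integral_distribution.
by apply: eq_measure_integral => A mA _; apply/esym; exact: UQ.
Qed.

Lemma has_lawP (X : {RV P >-> R}) (mu : probability R R) : has_law X mu ->
  forall A, measurable A -> P (X @^-1` A) = mu A.
Proof. by move=> h A mA; rewrite -h. Qed.

Lemma borel_measurable_R (A : set R) : borel A <-> measurable A.
Proof.
split; first by apply: smallest_sub; [exact: sigma_algebra_measurable|exact: open_measurable].
move=> mA; have cid : continuous (id : R -> R) by move=> x; exact: cvg_id.
by have := @continuous_measurable_borel R R id cid measurableT A mA; rewrite setTI.
Qed.

Lemma measurable_borelR d1 (T1 : measurableType d1) (X : T1 -> R) :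
  measurable_fun setT X -> measurable_fun setT (X : T1 -> borelType R).
Proof.
move=> mX _ B mB; rewrite setTI; apply: (measurable_preimage mX).
exact/borel_measurable_R.
Qed.

Lemma density_interval (mu : probability R R) (kappa a b : R) : has_density_le mu kappa ->
  a <= b -> (mu [set t | (a < t <= b)%R] <= (kappa * (b - a))%:E)%E.
Proof.
move=> [g [mg g0 gE]] ab.
have -> : [set t | a < t <= b] = [set` `]a, b]].
  by apply/seteqP; split => t /=; rewrite in_itv.
rewrite gE//; apply: (@le_trans _ _ (\int[lebesgue_measure]_(t in [set` `]a, b]]) kappa%:E)%E).
  apply: ge0_le_integral => //.
  - by move=> t _; rewrite lee_fin; have /andP[] := g0 t.
  - by apply/measurable_EFinP; exact: measurable_funTS.
  - by move=> t _; rewrite lee_fin; have /andP[] := g0 t.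
apply: (@le_trans _ _ (kappa%:E * lebesgue_measure ([set` `]a, b]] : set R))%E).
  by rewrite integral_cst.
rewrite lebesgue_measure_itv /= lte_fin.
move: ab; rewrite le_eqVlt => /predU1P[->|ab]; first by rewrite ltxx mule0 subrr mulr0.
by rewrite ab -EFinB -EFinM.
Qed.

Lemma mgf_independent (p : nat) (zv : 'I_p -> {RV P >-> R}) (mu : probability R R)
    (sigma : R) (a : 'I_p -> R) :
  mutually_independent P (fun j w => zv j w) -> (forall j, has_law (zv j) mu) ->
  mu.-integrable setT (fun t : R => t%:E) -> ('E_mu[fun t : R => t] = 0)%E ->
  T2_inequality mu sigma ->
  (\int[P]_w (expR (\sum_j a j * zv j w))%:E <=
   (expR ((sigma + 1) ^+ 2 * (\sum_j a j ^+ 2) / 2))%:E)%E.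
Proof.
move=> ind law imu mmu T2.
have mz j : measurable_fun setT (fun w => zv j w) by [].
have cexp (c : R) : continuous (fun t : R => expR (c * t)).
  move=> t; apply: continuous_comp; last exact: continuous_expR.
  exact: mulrl_continuous.
have -> : (\int[P]_w (expR (\sum_j a j * zv j w))%:E =
    \int[P]_w (\prod_j expR (a j * zv j w))%:E)%E.
  by apply: eq_integral => w _; rewrite expR_sum.
rewrite (@indep_integral_prod _ _ _ P 'I_p R (fun j w => zv j w)
  (fun j t => expR (a j * t))) //; last 2 first.
- by move=> j; exact: measurable_borelR.
- by move=> j; exact: continuous_measurable_borel.
have -> : expR ((sigma + 1) ^+ 2 * (\sum_j a j ^+ 2) / 2) =
    \prod_j expR ((sigma + 1) ^+ 2 * a j ^+ 2 / 2).
  by rewrite -expR_sum mulr_sumr mulr_suml; congr expR; apply: eq_bigr.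
rewrite -prodEFin; apply: lee_prod_nneg => j; apply/andP; split.
  by apply: integral_ge0 => w _; rewrite lee_fin expR_ge0.
apply: le_trans (T2_mgf (a j) T2 imu mmu).
rewrite le_eqVlt; apply/orP; left; apply/eqP; apply/esym.
apply: (@integral_law _ R (zv j) mu (fun t => (expR (a j * t))%:E)) => //.
- exact: has_lawP.
- apply/measurable_EFinP; apply: continuous_measurable_fun; exact: cexp.
Qed.

Section Feature.
Variables (p : nat) (zv : 'I_p -> {RV P >-> R}) (Sh A : 'M[R]_p) (x : Omega -> 'cV[R]_(p + 1)).
Hypothesis xE : forall w, x w = col_mx (Sh *m (\col_j zv j w)) (const_mx 1).

Lemma measurable_feature j : measurable_fun setT (fun w => x w j 0).
Proof.
pose h w : R := match fintype.split j with
  | inl a => \sum_k Sh a k * zv k w | inr _ => 1 end.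
rewrite (_ : (fun w => _) = h); last first.
  apply/funext => w; rewrite /h xE mxE; case: (fintype.split j) => a; rewrite !mxE//.
  by apply: eq_bigr => k _; rewrite !mxE.
rewrite /h; case: (fintype.split j) => [a|_] //.
by apply: measurable_bigsum => k _; apply: measurable_funM.
Qed.

(** The intercept coordinate contributes the deterministic factor [expR v2], the origin of the
    linear term [l2norm v]. The other coordinates form a sum with independent terms and coefficients
    [Sh *m v1], whose squared norm is controlled by the operator norm. *)
Lemma feature_mgf (mu : probability R R) (sigma sS : R) (v : 'cV[R]_(p + 1)) :
  mutually_independent P (fun j w => zv j w) -> (forall j, has_law (zv j) mu) ->
  mu.-integrable setT (fun t : R => t%:E) -> ('E_mu[fun t : R => t] = 0)%E ->
  T2_inequality mu sigma -> psd_sqrt A Sh -> opnorm A <= sS ->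
  (\int[P]_w (expR (dot (x w) v))%:E <=
   (expR (l2norm v + (sigma + 1) ^+ 2 * `|sS| / 2 * l2norm v ^+ 2))%:E)%E.
Proof.
move=> ind law imu mmu T2 sq op.
pose v1 := usubmx v; pose v2 := dsubmx v 0 0; pose a := Sh *m v1.
have vE : l2norm v ^+ 2 = l2norm v1 ^+ 2 + v2 ^+ 2.
  rewrite sqr_l2norm /dot big_split_ord /= big_ord1 sqr_l2norm /dot.
  congr (_ + _); last by rewrite /v2 !mxE expr2.
  by apply: eq_bigr => i _; rewrite !mxE.
have E w : dot (x w) v = \sum_j a j 0 * zv j w + v2.
  rewrite xE /dot big_split_ord /= big_ord1; congr (_ + _); last first.
    by rewrite col_mxEd mxE mul1r /v2 !mxE.
  transitivity (dot (Sh *m (\col_j zv j w)) v1).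
    by rewrite /dot; apply: eq_bigr => i _; rewrite col_mxEu [v1 i 0]mxE.
  rewrite dot_mulmx; have [[-> _] _] := sq.
  by rewrite /dot; apply: eq_bigr => i _; rewrite mxE mulrC.
have v2le : v2 <= l2norm v.
  apply: (le_trans (ler_norm _)); rewrite -(@ler_pXn2r _ 2) ?nnegrE ?l2norm_ge0//.
  by rewrite real_normK ?num_real// vE lerDr sqr_ge0.
have ale : l2norm a ^+ 2 <= `|sS| * l2norm v ^+ 2.
  apply: (le_trans (psd_sqrt_norm v1 sq)).
  apply: (@le_trans _ _ (`|sS| * l2norm v1 ^+ 2)).
    by rewrite ler_wpM2r ?sqr_ge0// (le_trans op)// ler_norm.
  by rewrite ler_wpM2l// vE lerDl sqr_ge0.
have mE : measurable_fun setT (fun w => (expR (\sum_j a j 0 * zv j w))%:E).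
  apply/measurable_EFinP; apply: measurableT_comp => //; apply: measurable_bigsum => k _.
  exact: measurable_funM.
have -> : (\int[P]_w (expR (dot (x w) v))%:E =
   \int[P]_w ((expR v2)%:E * (expR (\sum_j a j 0 * zv j w))%:E))%E.
  by apply: eq_integral => w _; rewrite E addrC expRD EFinM.
rewrite ge0_integralZl_EFin ?expR_ge0//.
have h := mgf_independent (fun j => a j 0) ind law imu mmu T2.
apply: (@le_trans _ _ ((expR v2)%:E *
   (expR ((sigma + 1) ^+ 2 * (\sum_j a j 0 ^+ 2) / 2))%:E)%E).
  by apply: lee_wpmul2l => //; rewrite lee_fin expR_ge0.
rewrite -EFinM -expRD lee_fin ler_expR lerD//.
have -> : \sum_j a j 0 ^+ 2 = l2norm a ^+ 2.
  by rewrite sqr_sqrtr//; apply: sumr_ge0 => i _; exact: sqr_ge0.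
rewrite (_ : (sigma + 1) ^+ 2 * `|sS| / 2 * l2norm v ^+ 2 =
  (sigma + 1) ^+ 2 * (`|sS| * l2norm v ^+ 2) / 2); last by ring.
by rewrite ler_wpM2r ?invr_ge0// ler_wpM2l ?sqr_ge0.
Qed.

End Feature.

(** For a frozen feature vector the residual is the noise plus a constant, so it falls in an
    interval of the same length and inherits the density bound, uniformly in [b]. *)
Lemma noise_density (d : nat) (x : Omega -> 'cV[R]_d) (ep : {RV P >-> R})
    (mu : probability R R) (kappa : R) (f : 'cV[R]_d -> R) (b : 'cV[R]_d) (t u : R) :
  (forall j, measurable_fun setT (fun w => x w j 0)) -> continuous f ->
  independent2 P x (ep : Omega -> R) -> has_law ep mu -> has_density_le mu kappa -> t <= u ->
  (P [set w | (t < f (x w) + ep w - dot (x w) b <= u)%R] <= (kappa * (u - t))%:E)%E.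
Proof.
move=> mx cf ind law dens tu.
have mV : measurable_fun setT (x : Omega -> borelType 'cV[R]_d).
  by apply: measurable_mx_borel => i j; rewrite (ord1 j).
have mf : measurable_fun setT (f : borelType 'cV[R]_d -> R).
  exact: continuous_measurable_borel.
have mdot : measurable_fun setT (fun v : borelType 'cV[R]_d => dot v b).
  apply: measurable_dot => // j.
  by apply: continuous_measurable_borel => v; exact: coord_continuous.
pose S : set (borelType 'cV[R]_d * R) := [set z | t < f z.1 + z.2 - dot z.1 b <= u].
have mr : measurable_fun setT (fun z : borelType 'cV[R]_d * R => f z.1 + z.2 - dot z.1 b).
  apply: measurable_funB; first apply: measurable_funD => //.
    exact: (@measurableT_comp _ _ _ _ (borelType 'cV[R]_d) _ f _ fst).
  exact: (@measurableT_comp _ _ _ _ (borelType 'cV[R]_d) _ (fun v => dot v b) _ fst).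
have mS : measurable S.
  rewrite (_ : S = [set z | t < f z.1 + z.2 - dot z.1 b] `&`
    [set z | f z.1 + z.2 - dot z.1 b <= u]).
    by apply: measurableI; [exact: measurable_lt_set|exact: measurable_le_set].
  by apply/seteqP; split => z; rewrite /S /=; [move=> /andP[]|move=> [-> ->]].
have UV (A : set R) (B : set (borelType 'cV[R]_d)) : measurable A -> measurable B ->
    P (ep @^-1` A `&` x @^-1` B) = (P (ep @^-1` A) * P (x @^-1` B))%E.
  by move=> mA mB; rewrite setIC muleC; apply: ind => //; exact/borel_measurable_R.
have mep : measurable_fun setT (ep : Omega -> R) by [].
have := indep_fubini_set mep mV (has_lawP law) UV mS; rewrite /S /= => ->.
have xE w : [set u0 | S (x w, u0)] =
    [set s | t - f (x w) + dot (x w) b < s <= u - f (x w) + dot (x w) b].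
  apply/seteqP; split => s; rewrite /S /= => /andP[h1 h2]; apply/andP; split; lra.
have k0 : 0 <= kappa by move: dens => [g [_ g0 _]]; have /andP[h1 h2] := g0 0; exact: le_trans h2.
have mxS w : measurable [set u0 | S (x w, u0)].
  rewrite (_ : [set _ | _] = xsection S (x w)); first exact: measurable_xsection.
  by apply/seteqP; split => s; rewrite /xsection /= inE.
apply: (@le_trans _ _ (\int[P]_w (kappa * (u - t))%:E)%E); last by rewrite integral_cst_probability.
apply: ge0_le_integral => //.
- rewrite (_ : (fun w => _) = (fun v : borelType 'cV[R]_d => mu (xsection S v)) \o x).
    exact: (measurableT_comp (measurable_fun_xsection mu mS) mV).
  apply/funext => w /=; congr (mu _).
  by apply/seteqP; split => s; rewrite /xsection /= inE.
- move=> w _; rewrite -/(S (x w, _)) xE; apply: le_trans (density_interval dens _) _.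
    by lra.
  by rewrite lee_fin; apply: ler_wpM2l => //; lra.
Qed.

End Model.

(** * Conditional coverage as a mass under the law of the test point *)

Section Coverage.
Context {R : realType} {disp : measure_display} {Omega : measurableType disp}.
Variable P : probability Omega R.
Variables (n d : nat) (x : 'I_n -> Omega -> 'cV[R]_d) (y : 'I_n -> Omega -> R).
Variables (x0 : Omega -> 'cV[R]_d) (y0 : Omega -> R).
Notation sample := (borelType ('cV[R]_d * R)%type).
Notation D := (fun i w => (x i w, y i w)).
Hypothesis n0 : (0 < n)%N.
Hypothesis mD : forall i, measurable_fun setT (D i : Omega -> sample).
Hypothesis mD0 : measurable_fun setT ((fun w => (x0 w, y0 w)) : Omega -> sample).
Hypothesis indep0 : independent2 P (fun w => (x0 w, y0 w))
  (fun w => (design x w, response y w)).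
Variable Q : probability sample R.
Hypothesis law0 : forall A : set sample, measurable A ->
  P ((fun w => (x0 w, y0 w)) @^-1` A) = Q A.
Variables (delta : nat -> R) (b0 : 'cV[R]_d) (k : nat) (q1 q2 : R).
Hypothesis q1i : 0 <= q1 <= 1.
Hypothesis q2i : 0 <= q2 <= 1.

Notation train := (borelType ('M[R]_(n, d) * 'cV[R]_n)%type).

Lemma loo_residualsE (X : 'M[R]_(n, d)) (Y : 'cV[R]_n) :
  loo_residuals delta X Y b0 k =
  [seq Y i 0 - dot (obs X i) (gdm delta [set~ i]%SET X Y b0 k) | i : 'I_n].
Proof. by apply: eq_map => i; rewrite /residual mulmx_dot gd_looE. Qed.

Lemma measurable_train_gdm (S : {set 'I_n}) j :
  measurable_fun setT (fun t : train => gdm delta S t.1 t.2 b0 k j 0).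
Proof.
apply: measurable_gdm => [i j' _|i _]; [exact: measurable_fst_coord|exact: measurable_snd_coord].
Qed.

Lemma measurable_train_quantile q : 0 <= q <= 1 ->
  measurable_fun setT (fun t : train => quantile (loo_residuals delta t.1 t.2 b0 k) q).
Proof.
move=> qi; rewrite (_ : (fun t => _) = fun t : train => quantile
  [seq t.2 i 0 - dot (obs t.1 i) (gdm delta [set~ i]%SET t.1 t.2 b0 k) | i : 'I_n] q).
  apply: (measurable_quantile (r := fun i (t : train) => t.2 i 0 -
    dot (obs t.1 i) (gdm delta [set~ i]%SET t.1 t.2 b0 k))) => // i.
  apply: measurable_funB; first exact: measurable_snd_coord.
  apply: measurable_dot => j; last exact: measurable_train_gdm.
  rewrite (_ : (fun t => _) = fun t : train => t.1 i j).
    exact: measurable_fst_coord.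
  by apply/funext => t; rewrite !mxE.
by apply/funext => t; rewrite loo_residualsE.
Qed.

(** The interval and the iterate are measurable functions of the training data, so freezing the data
    gives an explicit version of the conditional coverage, and any other version agrees with it
    almost surely. *)
Lemma coverage_fubini (g : Omega -> R) :
  cond_prob P (fun w => (design x w, response y w))
    [set w | residual (x0 w) (y0 w) (gd_full delta (design x w) (response y w) b0 k)
      \in `[quantile (loo_residuals delta (design x w) (response y w) b0 k) q1,
            quantile (loo_residuals delta (design x w) (response y w) b0 k) q2]] g ->
  {ae P, forall w, g w = fine (Q [set u |
    quantile (loo_resid x y delta b0 k w) q1 <=
      u.2 - dot u.1 (iter_on x y delta b0 [set: 'I_n]%SET k w) <=
    quantile (loo_resid x y delta b0 k w) q2])}.
Proof.
move=> cg.
pose al q (t : train) := quantile (loo_residuals delta t.1 t.2 b0 k) q.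
pose S : set (train * sample) := [set z | al q1 z.1 <=
  z.2.2 - dot z.2.1 (gdm delta [set: 'I_n]%SET z.1.1 z.1.2 b0 k) <= al q2 z.1].
have mr := @measurable_resid_joint R d _ train
  (fun t => gdm delta [set: 'I_n]%SET t.1 t.2 b0 k) (measurable_train_gdm _).
have ma q : 0 <= q <= 1 -> measurable_fun setT (fun z : train * sample => al q z.1).
  move=> qi; apply: (@measurableT_comp _ _ _ _ train _ (al q) _ fst) => //.
  exact: measurable_train_quantile.
have mS : measurable S.
  rewrite (_ : S = [set z | al q1 z.1 <=
      z.2.2 - dot z.2.1 (gdm delta [set: 'I_n]%SET z.1.1 z.1.2 b0 k)] `&`
    [set z | z.2.2 - dot z.2.1 (gdm delta [set: 'I_n]%SET z.1.1 z.1.2 b0 k) <= al q2 z.1]).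
    apply: measurableI; [exact: (measurable_le_set (ma q1 q1i) mr)|].
    exact: (measurable_le_set mr (ma q2 q2i)).
  by apply/seteqP; split => z; rewrite /S /=; [move=> /andP[]|move=> [-> ->]].
have mV : measurable_fun setT ((fun w => (design x w, response y w)) : Omega -> train).
  apply: measurable_mxmx_borel => i j.
    rewrite (_ : (fun w => _) = fun w => x i w j 0); first exact: (measurable_x mD).
    by apply/funext => w; rewrite !mxE.
  rewrite (ord1 j) (_ : (fun w => _) = y i); first exact: (measurable_y mD).
  by apply/funext => w; rewrite mxE.
have UV (A : set sample) (B : set train) : measurable A -> measurable B ->
    P ((fun w => (x0 w, y0 w)) @^-1` A `&` (fun w => (design x w, response y w)) @^-1` B) =
    (P ((fun w => (x0 w, y0 w)) @^-1` A) * P ((fun w => (design x w, response y w)) @^-1` B))%E.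
  by move=> mA mB; exact: indep0.
have ch := cond_prob_indep mV mD0 law0 UV mS.
rewrite (_ : [set w | S _] = [set w |
    residual (x0 w) (y0 w) (gd_full delta (design x w) (response y w) b0 k)
      \in `[quantile (loo_residuals delta (design x w) (response y w) b0 k) q1,
            quantile (loo_residuals delta (design x w) (response y w) b0 k) q2]]) in ch; last first.
  by apply/seteqP; split => w; rewrite /S /= in_itv /= /residual mulmx_dot gd_fullE.
apply: filterS (cond_prob_unique mV cg ch) => w ->.
have E : loo_residuals delta (design x w) (response y w) b0 k = loo_resid x y delta b0 k w.
  rewrite loo_residualsE; apply: eq_map => i; by rewrite responseE obs_design.
by rewrite /S /al /= E.
Qed.

End Coverage.

Section SampleModel.
Context {R : realType} {disp : measure_display} {Omega : measurableType disp}.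
Variable P : probability Omega R.
Variables (d : nat) (x : Omega -> 'cV[R]_d) (y : Omega -> R).
Notation sample := (borelType ('cV[R]_d * R)%type).
Variables (Q : probability sample R) (f : 'cV[R]_d -> R) (ep : {RV P >-> R})
  (mu : probability R R) (kappa m8 : R).
Hypothesis mx : forall j, measurable_fun setT (fun w => x w j 0).
Hypothesis cf : continuous f.
Hypothesis yE : forall w, y w = f (x w) + ep w.

Lemma measurable_response : measurable_fun setT y.
Proof.
rewrite (_ : y = fun w => f (x w) + ep w); last by apply/funext => w.
apply: measurable_funD => //.
apply: (@measurableT_comp _ _ _ _ (borelType 'cV[R]_d) _ f _ x).
  exact: continuous_measurable_borel.
by apply: measurable_mx_borel => i j; rewrite (ord1 j).
Qed.

Lemma measurable_sample : measurable_fun setT ((fun w => (x w, y w)) : Omega -> sample).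
Proof.
apply: measurable_mxR_borel; last exact: measurable_response.
by move=> i j; rewrite (ord1 j).
Qed.

Hypothesis lawD : forall A : set sample, measurable A -> P ((fun w => (x w, y w)) @^-1` A) = Q A.

Lemma sample_cdf_lip (b : 'cV[R]_d) (t u : R) :
  independent2 P x (ep : Omega -> R) -> has_law ep mu -> has_density_le mu kappa -> t <= u ->
  resid_cdf Q b u - resid_cdf Q b t <= kappa * (u - t).
Proof.
move=> ind law dens tu.
have mr : measurable_fun setT (fun e : sample => e.2 - dot e.1 b).
  exact: measurable_sample_resid.
pose I : set sample := [set e | t < e.2 - dot e.1 b <= u].
have mI : measurable I.
  rewrite (_ : I = [set e | t < e.2 - dot e.1 b] `&` [set e | e.2 - dot e.1 b <= u]).
    by apply: measurableI; [exact: measurable_lt_set|exact: measurable_le_set].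
  by apply/seteqP; split => e; rewrite /I /=; [move=> /andP[]|move=> [-> ->]].
have QI : (Q I <= (kappa * (u - t))%:E)%E.
  have := noise_density b mx cf ind law dens tu; apply: le_trans.
  have LE : (Q I <= P ((fun w => (x w, y w)) @^-1` I))%E by rewrite (lawD mI).
  apply: (le_trans LE); rewrite le_eqVlt; apply/orP; left; apply/eqP; congr (P _).
  by apply/seteqP; split => w; rewrite /I /= yE.
rewrite lerBlDr addrC -lee_fin EFinD -!resid_cdfE.
apply: (@le_trans _ _ (Q ([set e | e.2 - dot e.1 b <= t] `|` I))).
  apply: le_measure; rewrite ?inE; [exact: measurable_resid_le| |].
    by apply: measurableU => //; exact: measurable_resid_le.
  move=> e /= h; case: (lerP (e.2 - dot e.1 b) t) => h'; [by left|right].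
  by rewrite /I /= h' h.
apply: (le_trans (measureU2 _ (measurable_resid_le b t) mI)).
by apply: leeD.
Qed.

Lemma sample_response8 : ('E_P[(fun w => (y w ^+ 8)%R)] <= m8%:E)%E ->
  (\int[Q]_e (e.2 ^+ 8)%:E <= m8%:E)%E.
Proof.
rewrite unlock => h; apply: le_trans h.
have m8' : measurable_fun setT (fun e : sample => (e.2 ^+ 8)%:E).
  by apply/measurable_EFinP; apply: measurable_funX; exact: measurable_sample_snd.
rewrite (integral_law (U := (fun w => (x w, y w)) : Omega -> sample) measurable_sample lawD m8')//.
by move=> e; rewrite lee_fin pow8_ge0.
Qed.

Lemma sample_mgf (v : 'cV[R]_d) (C : R) :
  (\int[P]_w (expR (dot (x w) v))%:E <= C%:E)%E -> (\int[Q]_e (expR (dot e.1 v))%:E <= C%:E)%E.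
Proof.
move=> h; apply: le_trans h.
have mE : measurable_fun setT (fun e : sample => (expR (dot e.1 v))%:E).
  by apply/measurable_EFinP; apply: measurableT_comp => //; exact: measurable_sample_dot.
by rewrite (integral_law (U := (fun w => (x w, y w)) : Omega -> sample) measurable_sample lawD mE)//.
Qed.

End SampleModel.

Section LimitParameters.
Context {R : realType}.

(** Each term receives a third of [eps]. The order matters: [eta] is fixed first and [theta] is then
    a small multiple [r] of it, since only their ratio enters the second term. *)
Lemma small_parameters (kappa M eps : R) : 0 <= kappa -> 0 <= M -> 0 < eps ->
  exists eta theta e : R, [/\ 0 < eta, 0 < theta, 0 < e <= 2 &
    9 * kappa * eta + 2 * (M * (theta / eta) ^+ 8) + 6 * e <= eps].
Proof.
move=> k0 M0 eps0.
pose eta := eps / (27 * (kappa + 1)); pose r := Num.min 1 (eps / (6 * (M + 1))).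
have k1 : 0 < 27 * (kappa + 1) by rewrite mulr_gt0// ltr_wpDl.
have M1 : 0 < 6 * (M + 1) by rewrite mulr_gt0// ltr_wpDl.
have eta0 : 0 < eta by rewrite divr_gt0.
have r0 : 0 < r by rewrite lt_min ltr01 divr_gt0.
exists eta, (r * eta), (Num.min 2 (eps / 18)); split => //.
- by rewrite mulr_gt0.
- by rewrite lt_min ltr0n divr_gt0//= ge_min lexx.
have -> : r * eta / eta = r by rewrite mulfK// gt_eqF.
have h1 : 9 * kappa * eta <= eps / 3.
  have : kappa * eta <= (kappa + 1) * eta by rewrite ler_wpM2r ?(ltW eta0)// lerDl.
  have : (kappa + 1) * eta = eps / 27 by rewrite /eta; field; rewrite gt_eqF// ltr_wpDl.
  lra.
have h2 : M * r ^+ 8 <= eps / 6.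
  have r1 : r <= 1 by rewrite ge_min lexx.
  have r8 : r ^+ 8 <= r by rewrite exprS ler_piMr ?(ltW r0)// exprn_ile1 ?(ltW r0).
  have : M * r ^+ 8 <= (M + 1) * r by rewrite ler_pM ?exprn_ge0 ?(ltW r0)// lerDl.
  have : (M + 1) * r <= (M + 1) * (eps / (6 * (M + 1))).
    by rewrite ler_wpM2l ?addr_ge0// ge_min lexx orbT.
  have -> : (M + 1) * (eps / (6 * (M + 1))) = eps / 6 by field; rewrite gt_eqF// ltr_wpDl.
  lra.
have h3 : Num.min 2 (eps / 18) <= eps / 18 by rewrite ge_min lexx orbT.
lra.
Qed.

Lemma tail_eventually (m M e : R) : 0 <= m -> 0 <= M -> 0 < e ->
  \forall n \near \oo, 128 * (m + M * n%:R ^+ 4) / n%:R ^+ 8 <= e.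
Proof.
move=> m0 M0 e0; pose c := 128 * (m + M).
have c0 : 0 <= c by rewrite mulr_ge0// addr_ge0.
exists (Num.truncn (c / e)).+1 => // n /= hn.
have cn : c / e < n%:R.
  by apply: (lt_le_trans (truncnS_gt (c / e))); rewrite ler_nat.
have n1 : 1 <= n%:R :> R by rewrite ler1n (leq_trans _ hn).
have n0 : 0 < n%:R :> R by apply: lt_le_trans n1.
rewrite ltr_pdivrMr// in cn.
rewrite ler_pdivrMr ?exprn_gt0//.
have n4 : 1 <= n%:R ^+ 4 :> R by rewrite exprn_ege1.
have h1 : 128 * (m + M * n%:R ^+ 4) <= c * n%:R ^+ 4.
  rewrite /c -mulrA ler_wpM2l// mulrDl lerD2r -[leLHS]mulr1.
  by rewrite ler_wpM2l.
apply: (le_trans h1); have -> : n%:R ^+ 8 = n%:R ^+ 4 * n%:R ^+ 4 :> R by rewrite -exprD.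
rewrite [leRHS]mulrA; apply: ler_wpM2r; first exact: exprn_ge0.
apply: (le_trans (ltW cn)); rewrite [leLHS]mulrC; apply: ler_wpM2l; first exact: ltW.
by rewrite exprS ler_peMr ?(ltW n0)// exprn_ege1.
Qed.

(** Once [n] reaches [expR 1] the logarithm is at least 1, so its negative power is at most 1; the
    little-o bound with constant 1 then gives the claim. *)
Lemma step_count_eventually (K : nat -> nat) :
  (fun n => (K n)%:R : R^o) =o_\oo
    (fun n => n%:R * ln (n%:R : R) `^ (- (3 / 2)) : R^o) ->
  \forall n \near \oo, (K n <= n)%N.
Proof.
move=> /eqoP /(_ 1 ltr01) H.
have H2 : \forall n \near \oo, (Num.truncn (expR 1 : R) < n)%N.
  by exists (Num.truncn (expR 1 : R)).+1.
apply: filterS2 H H2 => n hK hn.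
have en : expR 1 <= n%:R :> R.
  by apply: (le_trans (ltW (truncnS_gt _))); rewrite ler_nat.
have n0 : 0 < n%:R :> R by apply: lt_le_trans en; exact: expR_gt0.
have ln1 : 1 <= ln (n%:R : R) by rewrite -ler_expR lnK.
have pw : ln (n%:R : R) `^ (- (3 / 2)) <= 1.
  have m0 : - (3 / 2) <= 0 :> R by rewrite oppr_le0 divr_ge0.
  by have := ler_powR ln1 m0; rewrite powRr0.
move: hK; rewrite mul1r !ger0_norm ?mulr_ge0 ?powR_ge0// => hK.
rewrite -(ler_nat R); apply: (le_trans hK).
by rewrite ler_piMr// ltW.
Qed.

Lemma bigmax_cvg0 (K : nat -> nat) (a : nat -> nat -> R) :
  (forall m, \forall n \near \oo, forall k, (1 <= k <= K n)%N -> `|a n k| <= m.+1%:R^-1) ->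
  (fun n => \big[Num.max/0]_(1 <= k < (K n).+1) `|a n k|) @ \oo --> (0 : R).
Proof.
move=> h; apply/cvgrPdist_lt => e e0.
have [m me] : exists m : nat, m.+1%:R^-1 < e :> R.
  exists (Num.truncn e^-1); rewrite -[ltRHS]invrK ltf_pV2 ?posrE ?invr_gt0//.
  exact: truncnS_gt.
apply: filterS (h m) => n hn.
rewrite sub0r normrN; apply: le_lt_trans me.
rewrite ger0_norm; last first.
  by rewrite big_seq; apply: (big_ind (fun r => 0 <= r)) => // r s r0 s0; rewrite le_max r0.
rewrite big_seq; apply: (big_ind (fun r => r <= m.+1%:R^-1)).
- by rewrite invr_ge0.
- by move=> r s r0 s0; rewrite ge_max r0.
- by move=> k; rewrite mem_index_iota => kK; exact: hn.
Qed.

End LimitParameters.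

Theorem theorem4 (R : realType) (d : measure_display) (Omega : measurableType d)
  (P : probability Omega R)
  (sigma_z sigma_Sigma sigma_eps m2 m4 m8 kappa_pdf Delta B0 zeta_L zeta_U : R)
  (p K : nat -> nat)
  (mu_z mu_eps : nat -> probability R R)
  (Sigma Sigma_half : forall n, 'M[R]_(p n))
  (f : forall n, 'cV[R]_(p n + 1) -> R) (L_f : nat -> R)
  (delta : nat -> nat -> R) (beta0 : forall n, 'cV[R]_(p n + 1))
  (z : forall n, 'I_n -> 'I_(p n) -> {RV P >-> R})
  (eps : forall n, 'I_n -> {RV P >-> R})
  (x : forall n, 'I_n -> Omega -> 'cV[R]_(p n + 1))
  (y : forall n, 'I_n -> Omega -> R)
  (x0 : forall n, Omega -> 'cV[R]_(p n + 1)) (y0 : nat -> Omega -> R)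
  (q1 q2 : R)
  (* training data *)
  (data_iid : forall n, (0 < n)%N ->
    iid P (fun (i : 'I_n) w => (x n i w, y n i w)))
  (* (F1) *)
  (Sigma_psd : forall n, (0 < n)%N -> psd (Sigma n))
  (Sigma_sqrt : forall n, (0 < n)%N -> psd_sqrt (Sigma n) (Sigma_half n))
  (z_indep : forall n (i : 'I_n), (0 < n)%N ->
    mutually_independent P (fun (j : 'I_(p n)) w => z n i j w))
  (z_law : forall n (i : 'I_n) (j : 'I_(p n)), (0 < n)%N ->
    has_law (z n i j) (mu_z n))
  (x_def : forall n (i : 'I_n) w, (0 < n)%N ->
    x n i w = col_mx (Sigma_half n *m (\col_j z n i j w)) (const_mx 1))
  (* (F2) *)
  (mu_z_integrable : forall n, (0 < n)%N ->
    (mu_z n).-integrable setT (fun t : R => t%:E))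
  (mu_z_mean : forall n, (0 < n)%N -> 'E_(mu_z n)[fun t : R => t]%E = 0%E)
  (mu_z_var : forall n, (0 < n)%N -> 'V_(mu_z n)[fun t : R => t]%E = 1%E)
  (mu_z_T2 : forall n, (0 < n)%N -> T2_inequality (mu_z n) sigma_z)
  (* (F3) *)
  (Sigma_op : forall n, (0 < n)%N -> opnorm (Sigma n) <= sigma_Sigma)
  (* (Y1) *)
  (y_def : forall n (i : 'I_n) w, (0 < n)%N ->
    y n i w = f n (x n i w) + eps n i w)
  (eps_indep : forall n (i : 'I_n), (0 < n)%N ->
    independent2 P (x n i) (eps n i : Omega -> R))
  (eps_law : forall n (i : 'I_n), (0 < n)%N -> has_law (eps n i) (mu_eps n))
  (* (Y2) *)
  (mu_eps_integrable : forall n, (0 < n)%N ->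
    (mu_eps n).-integrable setT (fun t : R => t%:E))
  (mu_eps_mean : forall n, (0 < n)%N -> 'E_(mu_eps n)[fun t : R => t]%E = 0%E)
  (mu_eps_T2 : forall n, (0 < n)%N -> T2_inequality (mu_eps n) sigma_eps)
  (* (Y3) *)
  (f_lip : forall n, (0 < n)%N -> lipschitz_l2 (L_f n) (f n))
  (L_f_le1 : forall n, (0 < n)%N -> L_f n <= 1)
  (* (Y4) *)
  (y_m8 : forall n (i : 'I_n), (0 < n)%N ->
    ('E_P[(fun w => (y n i w ^+ 8)%R)] <= m8%:E)%E)
  (y_m4 : forall n (i : 'I_n), (0 < n)%N ->
    ('E_P[(fun w => (y n i w ^+ 4)%R)] <= m4%:E)%E)
  (y_m2 : forall n (i : 'I_n), (0 < n)%N ->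
    ('E_P[(fun w => (y n i w ^+ 2)%R)] <= m2%:E)%E)
  (* test point *)
  (test_random : forall n, (0 < n)%N ->
    random_element (fun w => (x0 n w, y0 n w)))
  (test_law : forall n (i : 'I_n), (0 < n)%N ->
    identically_distributed P (fun w => (x0 n w, y0 n w))
                              (fun w => (x n i w, y n i w)))
  (test_indep : forall n, (0 < n)%N ->
    independent2 P (fun w => (x0 n w, y0 n w))
                   (fun w => (design (x n) w, response (y n) w)))
  (* step sizes, initialization and dimensions *)
  (delta_pos : forall n k, (0 < n)%N -> (k < K n)%N -> 0 < delta n k)
  (delta_sum : forall n, (0 < n)%N ->
    \sum_(1 <= k < (K n).+1) delta n k.-1 <= Delta)
  (beta0_le : forall n, (0 < n)%N -> l2norm (beta0 n) <= B0)
  (zeta_L_pos : 0 < zeta_L)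
  (aspect_ratio : forall n, (0 < n)%N ->
    zeta_L <= (p n)%:R / n%:R <= zeta_U)
  (K_littleo : (fun n => (K n)%:R : R^o) =o_\oo
    (fun n => n%:R * ln (n%:R : R) `^ (- (3 / 2)) : R^o))
  (* noise density *)
  (eps_density : forall n, (0 < n)%N -> has_density_le (mu_eps n) kappa_pdf)
  (q1_ge0 : 0 <= q1) (q1_le_q2 : q1 <= q2) (q2_le1 : q2 <= 1)
  (* conditional coverage probabilities *)
  (cov : nat -> nat -> Omega -> R)
  (cov_def : forall n k, (0 < n)%N -> (1 <= k <= K n)%N ->
    let X w := design (x n) w in
    let Y w := response (y n) w in
    let beta w := gd_full (delta n) (X w) (Y w) (beta0 n) k in
    let alpha q w :=
      quantile (loo_residuals (delta n) (X w) (Y w) (beta0 n) k) q in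
    cond_prob P (fun w => (X w, Y w))
      [set w | residual (x0 n w) (y0 n w) (beta w)
                 \in `[alpha q1 w, alpha q2 w]]
      (cov n k)) :
  {ae P, forall w,
    (fun n => \big[Num.max/0]_(1 <= k < (K n).+1)
                `|cov n k w - (q2 - q1)|) @ \oo --> (0 : R)}.
Proof.
pose c := (sigma_z + 1) ^+ 2 * `|sigma_Sigma| / 2.
have c0 : 0 <= c by rewrite divr_ge0// mulr_ge0// sqr_ge0.
have q1i : 0 <= q1 <= 1 by rewrite q1_ge0 (le_trans q1_le_q2).
have q2i : 0 <= q2 <= 1 by rewrite (le_trans q1_ge0).
have kappa0 : 0 <= kappa_pdf.
  have [g [_ g0 _]] := eps_density 1%N isT; have /andP[h1 h2] := g0 0; exact: le_trans h2.
have zetaU0 : 0 <= zeta_U.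
  by have /andP[h1 h2] := aspect_ratio 1%N isT; apply: le_trans (le_trans h1 h2); exact: ltW.
have delta_ge0 n k : (0 < n)%N -> (k < K n)%N -> 0 <= delta n k.
  by move=> n0 kK; exact: ltW (delta_pos n k n0 kK).
have deltaS n k : (0 < n)%N -> (k <= K n)%N -> \sum_(0 <= s < k) delta n s <= Delta.
  move=> n0 kK; apply: le_trans (delta_sum n n0); rewrite big_add1 /=.
  rewrite [leRHS](big_cat_nat (leq0n k) kK) /= lerDl big_nat_cond.
  by apply: sumr_ge0 => s /andP[/andP[_ sK] _]; exact: delta_ge0.
(* All the probabilistic input for a given [n] is condensed into the law [Q] of one observation,
   which is also the law of the test point: a Laplace bound, an eighth moment, a Lipschitz residual
   distribution, and the explicit form of the coverage. *)
have model n : (0 < n)%N -> exists Q : probability (borelType ('cV[R]_(p n + 1) * R)%type) R,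
    [/\ forall i, measurable_fun setT
          ((fun w => (x n i w, y n i w)) : Omega -> borelType ('cV[R]_(p n + 1) * R)%type),
        forall i (A : set (borelType ('cV[R]_(p n + 1) * R)%type)), measurable A ->
          P ((fun w => (x n i w, y n i w)) @^-1` A) = Q A,
        forall v : 'cV[R]_(p n + 1), (\int[Q]_e (expR (dot e.1 v))%:E <=
          (expR (l2norm v + c * l2norm v ^+ 2))%:E)%E,
        (\int[Q]_e (e.2 ^+ 8)%:E <= m8%:E)%E /\
        (forall (b : 'cV[R]_(p n + 1)) (t u : R), t <= u ->
          resid_cdf Q b u - resid_cdf Q b t <= kappa_pdf * (u - t))
      & forall k, (1 <= k <= K n)%N -> {ae P, forall w, cov n k w = fine (Q [set u |
          quantile (loo_resid (x n) (y n) (delta n) (beta0 n) k w) q1 <=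
          u.2 - dot u.1 (iter_on (x n) (y n) (delta n) (beta0 n) [set: 'I_n]%SET k w) <=
          quantile (loo_resid (x n) (y n) (delta n) (beta0 n) k w) q2])}].
  move=> n0; pose i0 := Ordinal n0.
  have mx i j : measurable_fun setT (fun w => x n i w j 0).
    by apply: measurable_feature => w; exact: x_def.
  have cf : continuous (f n) by apply: lipschitz_l2_continuous (f_lip n n0); exact: L_f_le1.
  have mD i : measurable_fun setT
      ((fun w => (x n i w, y n i w)) : Omega -> borelType ('cV[R]_(p n + 1) * R)%type).
    by apply: (measurable_sample (mx i) cf (ep := eps n i)) => w; exact: y_def.
  have mD0 : measurable_fun setT
      ((fun w => (x0 n w, y0 n w)) : Omega -> borelType ('cV[R]_(p n + 1) * R)%type).
    by move=> _ B mB; rewrite setTI; exact: test_random.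
  have [Q law0] := @law_exists _ _ _ P _ _ _ mD0.
  have lawD i (A : set (borelType ('cV[R]_(p n + 1) * R)%type)) : measurable A ->
      P ((fun w => (x n i w, y n i w)) @^-1` A) = Q A.
    by move=> mA; rewrite -law0//; apply/esym; exact: test_law.
  have yE w : y n i0 w = f n (x n i0 w) + eps n i0 w by exact: y_def.
  exists Q; split => //.
  - move=> v; apply: (sample_mgf (mx i0) cf yE (lawD i0)).
    apply: (@feature_mgf _ _ _ P (p n) (z n i0) (Sigma_half n) (Sigma n) (x n i0) _
      (mu_z n)) => //.
    + by move=> w; exact: x_def.
    + exact: z_indep.
    + by move=> j; exact: z_law.
    + exact: mu_z_integrable.
    + exact: mu_z_mean.
    + exact: mu_z_T2.
    + exact: Sigma_sqrt.
    + exact: Sigma_op.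
  - split; first exact: (sample_response8 (mx i0) cf yE (lawD i0) (y_m8 n i0 n0)).
    move=> b t u; apply: (sample_cdf_lip (mx i0) cf yE (lawD i0) b).
    + exact: eps_indep.
    + exact: eps_law.
    + exact: eps_density.
  - move=> k kK.
    exact: (coverage_fubini n0 mD mD0 (test_indep n n0) law0 q1i q2i (cov_def n k n0 kK)).
have m80 : 0 <= m8.
  by have [Q [_ _ _ [Qy8 _] _]] := model 1%N isT; exact: (m8_ge0 Qy8).
pose tau := 6 * (2 + zeta_U) + 2 + c.
have tau0 : 0 <= tau by rewrite !addr_ge0// mulr_ge0// addr_ge0.
(* The accuracy runs through the countable family [1 / (m + 1)], so that the almost sure events can
   be intersected at the end. *)
have main m : {ae P, forall w, \forall n \near \oo, forall k, (1 <= k <= K n)%N ->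
    `|cov n k w - (q2 - q1)| <= m.+1%:R^-1}.
  have e0 : 0 < m.+1%:R^-1 :> R by rewrite invr_gt0.
  have [eta [theta [e [eta0 theta0 e02 small]]]] := small_parameters kappa0 (moment8_ge0 c) e0.
  have /andP[ep0 _] := e02.
  (* [eta], [theta] and [e] depend on [m] but not on [n], hence neither does [Cst], and the failure
     probabilities are summable in [n]. *)
  have [Cst Cst0 hC] := bad_bound_le m8 Delta B0 c0 zetaU0 eta0 theta0 ep0.
  pose large n := [&& (0 < n)%N, (K n <= n)%N &
    128 * (m8 + moment8 c * n%:R ^+ 4) / n%:R ^+ 8 <= e].
  have large_near : \forall n \near \oo, large n.
    have h1 : \forall n \near \oo, (0 < n)%N by exists 1%N.
    have h2 := step_count_eventually K_littleo.
    have h3 := tail_eventually m80 (moment8_ge0 c) ep0.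
    by apply: filterS3 h1 h2 h3 => n a1 a2 a3; rewrite /large a1 a2.
  have ev n : exists F : set Omega, [/\ measurable F,
      (P F <= (Cst / (n%:R * Num.sqrt n%:R))%:E)%E &
      {ae P, forall w, ~ F w -> large n -> forall k, (1 <= k <= K n)%N ->
        `|cov n k w - (q2 - q1)| <= m.+1%:R^-1}].
    case: (boolP (large n)) => [|nl]; last first.
      (* The empty event serves all [n] that are not large. This includes [n = 0], where the
         required bound is 0 because division by zero returns 0. *)
      exists set0; split => //.
        by rewrite measure0 lee_fin divr_ge0// mulr_ge0// sqrtr_ge0.
      by apply: nearW.
    move=> /and3P[n0 Kn tailn].
    have [Q [mD lawD Qmgf [Qy8 Qlip] covE]] := model n n0.
    have [b bpos bn] := @block_size_exists n n0.
    (* The number of steps of length [eta] that cover the interval from [- n] to [n]. *)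
    pose A := (Num.truncn (2 * n%:R / eta)).+1.
    have u0 : 0 <= 2 * n%:R / eta by rewrite divr_ge0 ?mulr_ge0 ?(ltW eta0).
    have gridA : 2 * n%:R <= A%:R * eta.
      by rewrite -ler_pdivrMr//; exact: ltW (truncnS_gt _).
    have Aup : A%:R <= 2 * n%:R / eta + 1.
      by rewrite /A -[_.+1%:R]natr1 lerD2r truncn_le.
    have bszn : (0 < b <= n)%N.
      rewrite bpos /=; have /andP[h _] := bn; apply: leq_trans h.
      by rewrite -{1}(expn1 b) leq_pexp2l.
    have d0 : (0 < p n + 1)%N by rewrite addn1.
    have dn : (p n + 1)%:R <= (1 + zeta_U) * n%:R :> R.
      have n0' : 0 < n%:R :> R by rewrite ltr0n.
      have /andP[_] := aspect_ratio n n0; rewrite ler_pdivrMr// => h.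
      by rewrite natrD mulrDl mul1r addrC lerD// ler1n.
    have indD : mutually_independent P (fun i w => (x n i w, y n i w)).
      by have [] := data_iid n n0.
    have [mB PB] := bad_prob mD indD lawD c0 Qmgf Qy8 n0 d0 tau0
      (fun k => delta_ge0 n k n0) (fun k => deltaS n k n0) (beta0_le n n0) A bszn eta0 theta0 e02.
    exists (bad (x n) (y n) Q (delta n) (beta0 n) (K n) tau b A eta theta e); split => //.
      by apply: (le_trans PB); rewrite lee_fin; exact: hC.
    have allk : {ae P, forall w, forall k, (1 <= k <= K n)%N -> cov n k w = fine (Q [set u |
          quantile (loo_resid (x n) (y n) (delta n) (beta0 n) k w) q1 <=
          u.2 - dot u.1 (iter_on (x n) (y n) (delta n) (beta0 n) [set: 'I_n]%SET k w) <=
          quantile (loo_resid (x n) (y n) (delta n) (beta0 n) k w) q2])}.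
      apply: ae_foralln => k; case: (boolP (1 <= k <= K n)%N) => kK; last by apply: nearW.
      by apply: filterS (covE k kK) => w.
    apply: filterS allk => w hw nbad _ k kK; rewrite hw//; apply: le_trans small.
    apply: (good_coverage Qmgf Qy8 Qlip n0 bszn eta0 theta0 e02 tailn gridA nbad) => //.
    by have /andP[] := kK.
  have [F hF] := choice ev.
  have ae1 := @ae_eventually_not _ _ _ P F Cst Cst0
    (fun n => let: And3 a _ _ := hF n in a) (fun n => let: And3 _ a _ := hF n in a).
  have ae2 : {ae P, forall w, forall n, ~ F n w -> large n -> forall k, (1 <= k <= K n)%N ->
      `|cov n k w - (q2 - q1)| <= m.+1%:R^-1}.
    by apply: ae_foralln => n; have [] := hF n.
  apply: filterS2 ae1 ae2 => w h1 h2.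
  by apply: filterS2 h1 large_near => n nF ln; exact: h2.
have := ae_foralln main; apply: filterS => w hw.
exact: bigmax_cvg0.
Qed.
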